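(* Let $d\ge 2$, let $p\geq d$ and let $B$ be a smooth and closed magnetic field on $\mathbb{R}^d$ with $B\neq 0$ (i.e. $B$ is not identically zero). Then there exists a constant $C_{B,p,d}>0$ (depending only on $B$, $p$, $d$, and not on the choice of $A$) such that for every magnetic potential $A$ with $dA=B$ we have $$\int_{\mathbb{R}^d} |\nabla_A u|^p \,dx \;\geq\; C_{B,p,d}\int_{\mathbb{R}^d}\rho(x)\,|u|^p\,dx,\qquad \forall u\in\mathcal{D}(h_{A,p}),$$ where $$\rho(x):=\frac{1}{|x|^d\left(|\log|x||^p+|x|^{p-d}\right)}.$$
   Context: A magnetic field is a smooth function $B:\mathbb{R}^d\to\mathbb{R}^{d\times d}$ with skew-symmetric values, identified with a differential 2-form on $\mathbb{R}^d$; it is closed if its exterior derivative vanishes, $dB=0$. A magnetic potential for $B$ is a smooth vector field $A=(A_1,\dots,A_d):\mathbb{R}^d\to\mathbb{R}^d$, identified with a 1-form, such that $dA=B$, i.e. $B_{ij}=\partial A_j/\partial x^i-\partial A_i/\partial x^j$. The functions $u$ are complex-valued, and the magnetic gradient is $\nabla_A u:=\nabla u+iA(x)u$. The quadratic form is $h_{A,p}[u]:=\int_{\mathbb{R}^d}|\nabla_A u|^p\,dx$, and its domain $\mathcal{D}(h_{A,p})$ is the closure of $C_c^\infty(\mathbb{R}^d)$ with respect to the norm $\|u\|:=\left(h_{A,p}[u]+\|u\|_{L^p(\mathbb{R}^d)}^p\right)^{1/p}$. *)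

(* Defs.v *)
From HB Require Import structures.
From mathcomp Require Import all_boot all_order all_algebra.
From mathcomp Require Import all_classical all_reals all_analysis.
From mathcomp Require Import complex.

Set Implicit Arguments.
Unset Strict Implicit.
Unset Printing Implicit Defensive.

Import Order.TTheory GRing.Theory Num.Theory.
Import numFieldNormedType.Exports.

Local Open Scope classical_set_scope.
Local Open Scope ring_scope.
Local Open Scope complex_scope.

(* The sigma-algebra on R^n generated by the coordinates, i.e. the Borel one. *)
Section measurable_rV.
Variables (R : realType) (n : nat).

Definition rV_coord : 'I_n -> 'rV[R]_n -> measurableTypeR R :=
  fun i x => x ord0 i.

Let rV_set0 : g_sigma_preimage rV_coord set0.
Proof. exact: sigma_algebra0. Qed.

Let rV_setC A : g_sigma_preimage rV_coord A -> g_sigma_preimage rV_coord (~` A).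
Proof. exact: sigma_algebraC. Qed.

Let rV_bigcup (F : (set 'rV[R]_n)^nat) :
  (forall i, g_sigma_preimage rV_coord (F i)) ->
  g_sigma_preimage rV_coord (\bigcup_i F i).
Proof. exact: sigma_algebra_bigcup. Qed.

HB.instance Definition _ := @isMeasurable.Build default_measure_display
  'rV[R]_n (g_sigma_preimage rV_coord) rV_set0 rV_setC rV_bigcup.

Lemma measurable_rV_coord i :
  measurable_fun [set: 'rV[R]_n] (@rV_coord i).
Proof.
move=> _ Y mY; rewrite setTI; apply: sub_sigma_algebra => /=.
rewrite -bigcup_seq/=; exists i => /=; first by rewrite mem_index_enum.
by exists Y => //; rewrite setTI.
Qed.

Lemma measurable_fun_rVP d (T : measurableType d) (f : T -> 'rV[R]_n) :
  (forall i, measurable_fun [set: T] (@rV_coord i \o f)) ->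
  measurable_fun [set: T] f.
Proof.
move=> mf _ A mA; rewrite setTI.
suff : g_sigma_preimage rV_coord `<=` [set B | measurable (f @^-1` B)].
  exact.
apply: smallest_sub.
  split => /=; first by rewrite preimage_set0.
    by move=> B mB; rewrite setTD -preimage_setC; exact: measurableC.
  by move=> F mF; rewrite preimage_bigcup; exact: bigcup_measurable.
rewrite -bigcup_seq; apply: bigcup_sub => i _ _ [B mB <-] /=.
by rewrite setTI -[X in measurable X]setTI; exact: mf.
Qed.

End measurable_rV.

(* Lebesgue measure on R^n, as the iterated product of lebesgue_measure
   transported along the identification R * R^n = R^(n+1). *)
Section lebesgue_rV.
Variable R : realType.

Definition rV_cons n (z : measurableTypeR R * 'rV[R]_n) : 'rV[R]_n.+1 :=
  \row_j (if unlift ord0 j is Some k then z.2 ord0 k else z.1).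

Definition rV_uncons n (x : 'rV[R]_n.+1) : measurableTypeR R * 'rV[R]_n :=
  (x ord0 ord0, \row_j x ord0 (lift ord0 j)).

Lemma rV_consK n : cancel (@rV_cons n) (@rV_uncons n).
Proof.
move=> [a v]; rewrite /rV_uncons /rV_cons mxE unlift_none/=; congr pair.
by apply/rowP => j; rewrite !mxE liftK.
Qed.

Lemma measurable_rV_cons n : measurable_fun [set: _] (@rV_cons n).
Proof.
apply: measurable_fun_rVP => j; have [k ->|->] := unliftP ord0 j.
  rewrite (_ : _ \o _ = @rV_coord R n k \o snd).
    by apply: measurableT_comp => //; exact: measurable_rV_coord.
  by apply/funext => z /=; rewrite /rV_coord /rV_cons mxE liftK.
rewrite (_ : _ \o _ = fst)//.
by apply/funext => z /=; rewrite /rV_coord /rV_cons mxE unlift_none.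
Qed.

Lemma measurable_rV_uncons n : measurable_fun [set: _] (@rV_uncons n).
Proof.
apply/measurable_fun_pairP; split => /=.
  exact: (measurable_rV_coord (ord0 : 'I_n.+1)).
apply: measurable_fun_rVP => j.
rewrite (_ : _ \o _ = @rV_coord R n.+1 (lift ord0 j)).
  exact: measurable_rV_coord.
by apply/funext => x /=; rewrite /rV_coord mxE.
Qed.

Section step.
Variables (n : nat) (mu : {sigma_finite_measure set 'rV[R]_n -> \bar R}).

Definition lebesgue_rV_step : set 'rV[R]_n.+1 -> \bar R :=
  pushforward (@lebesgue_measure R \x mu)%E (@rV_cons n).

HB.instance Definition _ := Measure.copy lebesgue_rV_step
  (@measure_function_pushforward__canonical__measure_function_Measure
     _ _ _ _ _ (@lebesgue_measure R \x mu)%E _ (@measurable_rV_cons n)).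

Let lebesgue_rV_step_sigma_finite : sigma_finite setT lebesgue_rV_step.
Proof.
have /sigma_finiteP[F [TF ndF Foo]] := sigma_finiteT (@lebesgue_measure R).
have /sigma_finiteP[G [TG ndG Goo]] := sigma_finiteT mu.
exists (fun k => @rV_uncons n @^-1` (F k `*` G k)).
  rewrite -preimage_bigcup (_ : \bigcup_k _ = setT) ?preimage_setT//.
  rewrite -subTset => -[x y] _.
  have [k _ Fkx] : (\bigcup_k F k) x by rewrite -TF.
  have [l _ Gly] : (\bigcup_k G k) y by rewrite -TG.
  exists (maxn k l) => //; split => /=.
  - by move: x Fkx; exact/subsetPset/ndF/leq_maxl.
  - by move: y Gly; exact/subsetPset/ndG/leq_maxr.
move=> k; have [mF Fk] := Foo k; have [mG Gk] := Goo k; split.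
  rewrite -[X in measurable X]setTI.
  by apply: measurable_rV_uncons => //; exact: measurableX.
rewrite /lebesgue_rV_step /pushforward -comp_preimage.
rewrite (_ : _ \o _ = id); last by apply/funext => z /=; exact: rV_consK.
by rewrite preimage_id product_measure1E// lte_mul_pinfty// ge0_fin_numE.
Qed.

HB.instance Definition _ := @Measure_isSigmaFinite.Build _ _ _
  lebesgue_rV_step lebesgue_rV_step_sigma_finite.
End step.

Fixpoint lebesgue_rV n : {sigma_finite_measure set 'rV[R]_n -> \bar R} :=
  match n with
  | 0 => \d_(0 : 'rV[R]_0)
  | n'.+1 => lebesgue_rV_step (lebesgue_rV n')
  end.

End lebesgue_rV.

Lemma lebesgue_rV_box (R : realType) n (A : 'I_n -> set (measurableTypeR R)) :
  (forall i, measurable (A i)) ->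
  lebesgue_rV R n [set x : 'rV[R]_n | forall i, A i (x ord0 i)] =
  (\prod_(i < n) lebesgue_measure (A i))%E.
Proof.
elim: n A => [|n IH] A mA /=.
  by rewrite big_ord0 diracE mem_set// => -[].
rewrite big_ord_recl -IH// /lebesgue_rV_step /pushforward.
pose B := [set x : 'rV[R]_n | forall i, A (lift ord0 i) (x ord0 i)].
have mB : measurable B.
  rewrite (_ : B = \bigcap_(i in [set: 'I_n])
                     (@rV_coord R n i @^-1` A (lift ord0 i))).
    apply: fin_bigcap_measurable => // i _.
    by rewrite -[X in measurable X]setTI; exact: measurable_rV_coord.
  by apply/seteqP; split=> [x Bx i _|x Bx i]; exact: Bx.
rewrite -/B -product_measure1E//; congr (_ _); apply/seteqP; split => -[a v] /= h.
  split; first by have := h ord0; rewrite mxE unlift_none.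
  by move=> i; have := h (lift ord0 i); rewrite mxE liftK.
move=> i; rewrite mxE; case: unliftP => [k ->|->]; last exact: h.1.
exact: h.2.
Qed.

Section magnetic.
Variables (R : realType) (d : nat).
Local Notation vec := 'rV[R]_d.
Local Notation mu := (lebesgue_rV R d).

(* The library norm on 'rV[R]_d is the sup norm, hence the two Euclidean norms
   below. *)
Definition eucl_norm (x : vec) : R := Num.sqrt (\sum_j x ord0 j ^+ 2).

Definition cnorm (z : R[i]) : R := ComplexField.Normc.normc z.

Definition ceucl_norm (v : 'rV[R[i]]_d) : R :=
  Num.sqrt (\sum_j cnorm (v ord0 j) ^+ 2).

Definition partial (j : 'I_d) (f : vec -> R) : vec -> R :=
  fun x => 'D_('e_j) f x.

(* C^k: all partial derivatives of order at most k exist and are continuous *)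
Fixpoint of_class_C (k : nat) (f : vec -> R) : Prop :=
  match k with
  | 0 => continuous f
  | k'.+1 => continuous f /\ forall j,
      (forall x, derivable f x 'e_j) /\ of_class_C k' (partial j f)
  end.

Definition smooth (f : vec -> R) : Prop := forall k, of_class_C k f.

Definition compactly_supported (V : nmodType) (f : vec -> V) : Prop :=
  compact (closure [set x | f x != 0]).

(* C_c^oo(R^d), for real- and complex-valued functions *)
Definition rtest (phi : vec -> R) : Prop :=
  smooth phi /\ compactly_supported phi.

Definition ctest (phi : vec -> R[i]) : Prop :=
  [/\ smooth (fun x => complex.Re (phi x)),
      smooth (fun x => complex.Im (phi x)) &
      compactly_supported phi].

Definition magnetic_field (B : vec -> 'M[R]_d) : Prop :=
  (forall i j, smooth (fun x => B x i j)) /\ (forall x, (B x)^T = - B x).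

Definition closed_form2 (B : vec -> 'M[R]_d) : Prop := forall x i j k,
  partial i (fun y => B y j k) x + partial j (fun y => B y k i) x
  + partial k (fun y => B y i j) x = 0.

Definition magnetic_potential (B : vec -> 'M[R]_d) (A : vec -> vec) : Prop :=
  (forall j, smooth (fun x => A x ord0 j)) /\
  (forall x i j, B x i j = partial i (fun y => A y ord0 j) x
                         - partial j (fun y => A y ord0 i) x).

Definition loc_integrable (f : vec -> R) : Prop :=
  measurable_fun [set: vec] f /\
  forall K, compact K -> (\int[mu]_(x in K) `|f x|%:E < +oo)%E.

Definition weak_partial (j : 'I_d) (f g : vec -> R) : Prop :=
  [/\ loc_integrable f, loc_integrable g &
      forall phi, rtest phi ->
        (\int[mu]_x (f x * partial j phi x)%:E =
         - \int[mu]_x (g x * phi x)%:E)%E].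

Definition weak_gradient (u : vec -> R[i]) (g : vec -> 'rV[R[i]]_d) : Prop :=
  forall j,
    weak_partial j (fun x => complex.Re (u x))
                   (fun x => complex.Re (g x ord0 j)) /\
    weak_partial j (fun x => complex.Im (u x))
                   (fun x => complex.Im (g x ord0 j)).

Definition gradient (phi : vec -> R[i]) : vec -> 'rV[R[i]]_d := fun x =>
  \row_j (partial j (fun y => complex.Re (phi y)) x +i*
          partial j (fun y => complex.Im (phi y)) x).

(* In the definitions below a function u : R^d -> C is always accompanied by g,
   a representative of its weak gradient (unique up to null sets), so that
   magnetic_gradient A u g is grad u + i A u and magnetic_form A p u g is
   h_{A,p}[u]. *)

Definition magnetic_gradient (A : vec -> vec) (u : vec -> R[i])
    (g : vec -> 'rV[R[i]]_d) : vec -> 'rV[R[i]]_d :=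
  fun x => g x + \row_j ('i%C * (A x ord0 j)%:C * u x).

Definition magnetic_form (A : vec -> vec) (p : R) (u : vec -> R[i])
    (g : vec -> 'rV[R[i]]_d) : \bar R :=
  (\int[mu]_x (ceucl_norm (magnetic_gradient A u g x) `^ p)%:E)%E.

Definition form_norm (A : vec -> vec) (p : R) (u : vec -> R[i])
    (g : vec -> 'rV[R[i]]_d) : \bar R :=
  ((magnetic_form A p u g + \int[mu]_x (cnorm (u x) `^ p)%:E) `^ p^-1)%E.

(* u belongs to the closure of C_c^oo(R^d) for form_norm, g being its weak
   gradient.  The weak gradient of u - phi is g - gradient phi.  That |u|^p and
   |grad u + i A u|^p are integrable follows, as form_norm is finite on test
   functions. *)
Definition form_domain (A : vec -> vec) (p : R) (u : vec -> R[i])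
    (g : vec -> 'rV[R[i]]_d) : Prop :=
  weak_gradient u g /\
  forall e : R, 0 < e -> exists2 phi, ctest phi &
    (form_norm A p (u \- phi)%R (g \- gradient phi)%R < e%:E)%E.

(* The conventions 0^-1 = 0 and ln 0 = 0 only matter at x = 0; on the unit sphere
   the second term of the sum keeps the denominator positive. *)
Definition hardy_weight (p : R) (x : vec) : R :=
  (eucl_norm x ^+ d *
   (`|ln (eucl_norm x)| `^ p + eucl_norm x `^ (p - d%:R)))^-1.

End magnetic.

(* Main.v *)
(** Everything is obtained by integrating divergences of explicit compactly
    supported vector fields, so no gauge has to be chosen and no diamagnetic
    inequality is needed: the constants never see A.

    Write D = grad_A u and fix a test function u.
    - Radial fields. If F(x) = (x - c) f(|x - c|^2) satisfies
      div F >= k w^p - V and |F| <= K w^(p-1), then integrating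
      div (F |u|^p) gives  int w^p |u|^p <= C (int |D|^p + int V |u|^p).
      A field centred at a point x0 with B(x0) <> 0 gives a weight w^p with the
      right decay at infinity and V supported in a small ball around x0; a field
      centred at the origin, smoothed at scale eta, gives the singular weight, V
      being bounded with compact support and hence dominated by the first weight.
    - Near x0. For the current J_j = Im (conj u D_j u) one has
      d_i J_j - d_j J_i = B_ij |u|^2 + 2 Im (conj (D_i u) D_j u).
      Multiplying by a cutoff times |u|^(p-2) and integrating bounds |u|^p near x0
      by |D|^p and an arbitrarily small multiple of the previous weight.
    Adding the three estimates, then removing the smoothing by density and
    monotone convergence, gives the theorem. *)
Require Import Defs.
From mathcomp Require Import all_boot all_order all_algebra.
From mathcomp Require Import all_classical all_reals all_analysis.
From mathcomp Require Import measurable_realfun complex ring lra.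
Import Order.TTheory GRing.Theory Num.Theory numFieldNormedType.Exports.
Set Implicit Arguments.
Unset Strict Implicit.
Unset Printing Implicit Defensive.
Local Open Scope classical_set_scope.
Local Open Scope ring_scope.

(** * Integration of continuous functions on R^n *)

(** For p >= d there is no nontrivial Hardy weight without a field, and the radial estimate shows
    why: the field at infinity, smoothed at its centre, has divergence - d w^p there. The potential
    V repairs exactly this defect, and it is all that the magnetic field has to pay for; hence one
    point with B(x0) <> 0 suffices. In the commutator estimate the cutoff chi costs a power: the
    gradient of chi^2 is only bounded by chi, so the error chi |u|^p cannot be absorbed by chi^2
    |u|^p. Its coefficient is made small by Young's inequality and the weight at infinity, bounded
    below on the ball, absorbs it. The order of choices avoids a circle: B fixes the ball, the ball
    fixes the field at infinity and V, and only then is the small coefficient chosen. At the origin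
    x |x|^(-d) is divergence free, so the gain comes from the logarithm alone. All constants there
    are uniform in eta, so the smoothing can be removed at the end. *)

Lemma measurable_rV_box (R : realType) n (A : 'I_n -> set (measurableTypeR R)) :
  (forall i, measurable (A i)) ->
  measurable [set x : 'rV[R]_n | forall i, A i (x ord0 i)].
Proof.
move=> mA; rewrite (_ : [set _ | _] =
    \bigcap_(i in [set: 'I_n]) (@rV_coord R n i @^-1` A i)).
  apply: fin_bigcap_measurable => // i _.
  by rewrite -[X in measurable X]setTI; exact: measurable_rV_coord.
by apply/seteqP; split=> [x Bx i _|x Bx i]; exact: Bx.
Qed.

(** Balls of the sup norm are boxes, so an open set is the countable union of the boxes inside it
    with rational centre and half-side the inverse of a positive integer. *)
Lemma open_measurable_rV (R : realType) n (U : set 'rV[R]_n) :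
  open U -> measurable U.
Proof.
move=> oU.
pose box (z : 'rV[rat]_n * nat) := [set y : 'rV[R]_n | forall i,
  y ord0 i \in `]ratr (z.1 ord0 i) - z.2.+1%:R^-1,
                  ratr (z.1 ord0 i) + z.2.+1%:R^-1[].
have mbox z : measurable (box z).
  by apply: (measurable_rV_box (A := fun i => [set` _])) => i.
rewrite (_ : U = \bigcup_z (if `[< box z `<=` U >] then box z else set0)).
  apply: countable_bigcupT_measurable => [|z]; last by case: ifP.
  exact: countableP.
apply/seteqP; split => [x Ux|x [z _]]; last first.
  by case: ifPn => // /asboolP; exact.
have /nbhs_ballP[e /= e0 xeU] : nbhs x U by apply: open_nbhs_nbhs.
(* Two half-sides must fit below [e]: both [x] and any [y] in the box lie within one half-side of
   its centre. *)
have [k ke] : exists k, k.+1%:R^-1 + k.+1%:R^-1 < e :> R.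
  have e20 : 0 < e / 2 by rewrite divr_gt0.
  exists (Num.truncn (e / 2)^-1); rewrite [ltRHS]splitr.
  suff : (Num.truncn (e / 2)^-1).+1%:R^-1 < e / 2 by move=> h; apply: ltrD.
  by rewrite invf_plt ?posrE// truncnS_gt.
have k0 : 0 < k.+1%:R^-1 :> R by rewrite invr_gt0.
have qP i : exists q : rat, ratr q \in
    `](x ord0 i - k.+1%:R^-1), (x ord0 i + k.+1%:R^-1)[%R.
  by apply: rat_in_itvoo; rewrite ltrBlDr -addrA ltrDl addr_gt0.
have {qP}[q qP] := choice qP.
exists (\row_i q i, k) => //; case: ifPn => [_ i /=|/asboolPn []].
  have := qP i; rewrite !in_itv/= mxE; move: (x _ _) => a.
  by rewrite ltrBlDr ltrBlDr andbC.
move=> y /= boxy; apply: xeU; split => // i0 i.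
rewrite (_ : i0 = ord0); last exact: ord1.
have := qP i; have := boxy i.
rewrite /= !in_itv/= mxE /ball/= => yq xq.
suff close (a b r s : R) : s + s < e -> r - s < b < r + s ->
    a - s < r < a + s -> `|a - b| < e by exact: close ke yq xq.
by move=> ? /andP[? ?] /andP[? ?]; rewrite ltr_norml; apply/andP; split; lra.
Qed.

Lemma continuous_measurable_rV (R : realType) n (f : 'rV[R]_n -> R) :
  continuous f -> measurable_fun [set: 'rV[R]_n] f.
Proof.
move=> /continuousP cf.
apply: (measurability _ (RGenOpens.measurableE R)) => //.
move=> _ [_ [a [b ->] <-]]; rewrite setTI.
by apply: open_measurable_rV; apply: cf; exact: interval_open.
Qed.

(** Vanishing outside a cube, instead of compactness of a closure, passes to products and to the
    slices used in the induction on dimension by mere inspection. *)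
Definition bounded_support (R : realType) n (f : 'rV[R]_n -> R) :=
  exists M : R, forall (x : 'rV[R]_n) i, M < `|x ord0 i| -> f x = 0.

Section integration.
Variable R : realType.

Lemma measurable_rV_cube n (M : R) :
  measurable [set x : 'rV[R]_n | forall i, x ord0 i \in `[- M, M]].
Proof. exact: (@measurable_rV_box _ _ (fun=> [set` `[- M, M]])). Qed.

Lemma lebesgue_rV_cube_fin n (M : R) :
  (lebesgue_rV R n [set x : 'rV[R]_n | forall i, x ord0 i \in `[- M, M]%R]
   < +oo)%E.
Proof.
rewrite (@lebesgue_rV_box _ _ (fun=> [set` `[- M, M]]))//.
rewrite (eq_bigr (fun=> (if - M < M then M - - M else 0)%:E)).
  by rewrite prodEFin ltry.
by move=> i _; rewrite lebesgue_measure_itv/= lte_fin; case: ifP.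
Qed.

Lemma compact_cube n (M : R) :
  compact [set x : 'rV[R]_n | forall i, x ord0 i \in `[- M, M]].
Proof.
have := @rV_compact R^o n (fun=> [set` `[- M, M]]).
by apply => _; exact: segment_compact.
Qed.

Lemma bounded_supportP n (f : 'rV[R]_n -> R) M :
  (forall (x : 'rV[R]_n) i, M < `|x ord0 i| -> f x = 0) ->
  forall x, f x != 0 -> forall i, x ord0 i \in `[- M, M].
Proof.
move=> fM x fx0 i; rewrite in_itv/= -ler_norml leNgt.
by apply: contra fx0 => /fM ->.
Qed.

Lemma bounded_support_bounded n (f : 'rV[R]_n -> R) : continuous f ->
  bounded_support f -> exists K, forall x, `|f x| <= K.
Proof.
move=> cf [M fM].
have := @continuous_compact _ _ f _ (continuous_subspaceT cf) (@compact_cube n M).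
move=> /compact_bounded[K [_ /(_ (K + 1))]]; rewrite ltrDl ltr01 => /(_ erefl) fK.
exists (Num.max (K + 1) 0) => x; have [->|fx0] := eqVneq (f x) 0.
  by rewrite normr0 le_max lexx orbT.
rewrite le_max fK//=; exists x => //; exact: bounded_supportP fM _ fx0.
Qed.

Lemma integrable_bounded_support n (f : 'rV[R]_n -> R) : continuous f ->
  bounded_support f -> (lebesgue_rV R n).-integrable setT (EFin \o f).
Proof.
move=> cf sf; have [K fK] := bounded_support_bounded cf sf.
have [M fM] := sf; pose Q := [set x : 'rV[R]_n | forall i, x ord0 i \in `[- M, M]].
have mQ : measurable Q by exact: measurable_rV_cube.
rewrite (_ : EFin \o f = (EFin \o f) \_ Q).
  apply/(integrable_mkcond _ mQ)/measurable_bounded_integrable => //.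
  - exact: lebesgue_rV_cube_fin.
  - by apply: measurable_funTS; exact: continuous_measurable_rV.
  - exists K; split; first exact: num_real.
    by move=> a Ka x _ /=; exact: le_trans (fK x) (ltW Ka).
apply/funext => x; rewrite patchE; case: ifPn => //= /negP xQ.
have [->//|fx0] := eqVneq (f x) 0.
by exfalso; apply: xQ; rewrite mem_set//; exact: bounded_supportP fM _ fx0.
Qed.

End integration.

(** * Integrals of partial derivatives vanish *)

Section divergence.
Variable R : realType.

(** A directional derivative only sees the function on one line. Derivatives on R^n can thus be read
    as derivatives of one-variable functions or of slices, and conversely. *)
Lemma derive_along (V V' : normedModType R) (f : V -> R) (g : V' -> R) a v b w :
  (forall h : R, f (h *: v + a) = g (h *: w + b)) ->
  derivable f a v = derivable g b w /\ 'D_v f a = 'D_w g b.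
Proof.
move=> fg; have fab : f a = g b by have := fg 0; rewrite !scale0r !add0r.
rewrite /derivable /derive.
suff -> : (fun h : R => h^-1 *: ((f \o shift a) (h *: v) - f a)) =
          (fun h : R => h^-1 *: ((g \o shift b) (h *: w) - g b)) by [].
by apply/funext => h /=; rewrite fg fab.
Qed.

Lemma bounded_support_partial n (j : 'I_n) (f : 'rV[R]_n -> R) :
  bounded_support f -> bounded_support (partial j f).
Proof.
move=> [M fM]; exists M => x i Mx; rewrite /partial.
rewrite (@near_eq_derive _ _ _ f (cst 0)) ?derive_cst//.
have cx : {for x, continuous (fun y : 'rV[R]_n => `|y ord0 i|)}.
  apply: (@continuous_comp _ _ _ (fun y : 'rV[R]_n => y ord0 i) (fun z : R => `|z|)).
    exact: coord_continuous.
  exact: norm_continuous.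
have : \forall y \near (x : 'rV[R]_n), M < `|(y : 'rV[R]_n) ord0 i| by exact: (cvgr_gt _ cx).
by apply: filterS => y /fM.
Qed.

Lemma integral_derive1_eq0 (f f' : R -> R) (M : R) :
  (forall x : R, is_derive x (1 : R) f (f' x)) -> continuous f' ->
  (forall x, M < `|x| -> f x = 0) ->
  (\int[lebesgue_measure]_x (f' x)%:E = 0)%E.
Proof.
(* Strictly above [M], so that [f] vanishes at both end points and near every point beyond them;
   positive, so that the interval is not degenerate. *)
move=> df cf' fM; pose K := Num.max M 0 + 1.
have MK : M < K by rewrite ltr_pwDr// le_max lexx.
have K0 : 0 < K by rewrite ltr_pwDr// le_max lexx orbT.
have f'0 x : K < `|x| -> f' x = 0.
  move=> Kx; have [_ <-] := df x.
  rewrite (@near_eq_derive _ _ _ f (cst 0)) ?derive_cst//.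
  have : \forall y \near (x : R), K < `|y|.
    by exact: (cvgr_gt _ (@norm_continuous _ _ x) _ Kx).
  by apply: filterS => y Ky; apply: fM; exact: lt_trans Ky.
transitivity (\int[lebesgue_measure]_(x in `[(- K)%R, K]) (f' x)%:E)%E.
  rewrite [RHS]integral_mkcond; apply: eq_integral => x _.
  rewrite patchE; case: ifPn => // /negP xK; congr EFin; apply: f'0.
  rewrite ltNge; apply/negP => Kx; apply: xK.
  by rewrite mem_set//= in_itv/= -ler_norml.
have cf : continuous f.
  by move=> x; apply/differentiable_continuous/derivable1_diffP; case: (df x).
rewrite (@continuous_FTC2 _ f' f); first by rewrite !fM ?subee// ?normrN gtr0_norm.
- by rewrite gtrN.
- exact: continuous_subspaceT.
- split => [x _| |].
  + by case: (df x).
  + exact/cvg_at_right_filter/cf.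
  + exact/cvg_at_left_filter/cf.
- by move=> x _; rewrite derive1E; case: (df x).
Qed.

Lemma continuous_to_rV (T : topologicalType) n (f : T -> 'rV[R]_n) :
  (forall i, continuous (fun t => f t ord0 i)) -> continuous f.
Proof.
move=> cf t A [P tP PA].
have : \forall s \near t, forall i, P ord0 i (f s ord0 i).
  by apply: filter_forall => i; exact: cf (tP ord0 i).
apply: filterS => s Ps; apply: PA => i j.
by rewrite (_ : i = ord0)//; exact: ord1.
Qed.

Lemma continuous_rV_cons1 n (v : 'rV[R]_n) :
  continuous (fun a : R => rV_cons (a, v)).
Proof.
apply: continuous_to_rV => i; have [k ->|->] := unliftP ord0 i.
  under eq_fun do rewrite /rV_cons mxE liftK.
  exact: cst_continuous.
by under eq_fun do rewrite /rV_cons mxE unlift_none.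
Qed.

Lemma continuous_rV_cons2 n (a : R) :
  continuous (fun v : 'rV[R]_n => rV_cons (a, v)).
Proof.
apply: continuous_to_rV => i; have [k ->|->] := unliftP ord0 i.
  under eq_fun do rewrite /rV_cons mxE liftK.
  exact: coord_continuous.
under eq_fun do rewrite /rV_cons mxE unlift_none.
exact: cst_continuous.
Qed.

Lemma rV_cons_shift0 n (h a : R) (v : 'rV[R]_n) :
  rV_cons (h *: 1 + a, v) = h *: 'e_ord0 + rV_cons (a, v).
Proof.
apply/rowP => i; rewrite !mxE eqxx/=; case: unliftP => [k ->|->].
  by rewrite mulr0 add0r.
by [].
Qed.

Lemma rV_cons_shiftS n (h a : R) (v : 'rV[R]_n) k :
  rV_cons (a, h *: 'e_k + v) = h *: 'e_(lift ord0 k) + rV_cons (a, v).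
Proof.
apply/rowP => i; rewrite !mxE eqxx/=; case: unliftP => [l ->|->].
  by rewrite !mxE eqxx/= (inj_eq lift_inj).
by rewrite mulr0 add0r.
Qed.

Lemma integral_lebesgue_rV_step n (f : 'rV[R]_n.+1 -> R) :
  continuous f -> bounded_support f ->
  (lebesgue_measure \x lebesgue_rV R n)%E.-integrable setT
    (fun z => (f (rV_cons z))%:E) /\
  (\int[lebesgue_rV R n.+1]_x (f x)%:E =
   \int[lebesgue_measure \x lebesgue_rV R n]_z (f (rV_cons z))%:E)%E.
Proof.
move=> cf sf.
have mf : measurable_fun [set: 'rV[R]_n.+1] (EFin \o f).
  by apply/measurable_EFinP; exact: continuous_measurable_rV.
have mc := @measurable_rV_cons R n.
have intf : (lebesgue_measure \x lebesgue_rV R n)%E.-integrable setT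
    ((EFin \o f) \o (@rV_cons R n)).
  apply/integrableP; split; first exact: measurableT_comp mf mc.
  have /integrableP[_] := integrable_bounded_support cf sf.
  rewrite /= /lebesgue_rV_step ge0_integral_pushforward//.
  apply/measurable_EFinP; apply: measurableT_comp => //.
  exact: continuous_measurable_rV.
split; first exact: intf.
by rewrite /= /lebesgue_rV_step (integral_pushforward mc mf).
Qed.

(** By Fubini: if [j] is the first coordinate, integrate in it first and use the fundamental theorem
    of calculus; otherwise freeze the first coordinate and use the induction hypothesis on the
    slice. *)
Lemma integral_partial_eq0 n (j : 'I_n) (f : 'rV[R]_n -> R) :
  (forall x, derivable f x 'e_j) -> continuous (partial j f) ->
  bounded_support f ->
  (\int[lebesgue_rV R n]_x (partial j f x)%:E = 0)%E.
Proof.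
elim: n j f => [[]//|n IH] j f df cf' sf.
have [intf ->] := integral_lebesgue_rV_step cf' (bounded_support_partial j sf).
have [M fM] := sf.
have [k jk|j0] := unliftP ord0 j; last first.
  rewrite -integral21_prod_meas1//; apply: integral0_eq => v _.
  rewrite /fubini_G; apply: (@integral_derive1_eq0 (fun a => f (rV_cons (a, v))) _ M).
  - move=> a; have := df (rV_cons (a, v)); rewrite /partial j0.
    have [<- <-] := @derive_along _ _ (fun a => f (rV_cons (a, v))) f a 1 _ _
      (fun h => congr1 f (rV_cons_shift0 h a v)).
    exact: derivableP.
  - move=> a; apply: (@continuous_comp _ _ _ (fun a => rV_cons (a, v)) (partial j f)).
      exact: continuous_rV_cons1.
    exact: cf'.
  - by move=> a Ma; apply: (fM _ ord0); rewrite /rV_cons mxE unlift_none.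
rewrite -integral12_prod_meas1//; apply: integral0_eq => a _.
have along v := @derive_along _ _ (fun v => f (rV_cons (a, v))) f v 'e_k _ _
  (fun h => congr1 f (rV_cons_shiftS h a v k)).
rewrite /fubini_F -[RHS](IH k (fun v => f (rV_cons (a, v)))).
- by apply: eq_integral => v _; rewrite /partial (along v).2 jk.
- by move=> v; rewrite (along v).1 -jk; exact: df.
- rewrite (_ : partial _ _ = fun v => partial j f (rV_cons (a, v))).
    move=> v; apply: (@continuous_comp _ _ _ (fun v => rV_cons (a, v)) (partial j f)).
      exact: continuous_rV_cons2.
    exact: cf'.
  by apply/funext => v; rewrite /partial (along v).2 jk.
- exists M => v i Mv; apply: (fM _ (lift ord0 i)).
  by rewrite /rV_cons mxE liftK.
Qed.

End divergence.

(** * Functions of class C^1 and symmetry of second derivatives *)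

Section calculus.
Variable R : realType.

Lemma is_derive_line (V : normedModType R) (f : V -> R) (v y : V) (s df : R) :
  is_derive (s *: v + y) v f df -> is_derive s (1 : R) (fun t : R => f (t *: v + y)) df.
Proof.
move=> [dfy <-].
have along := @derive_along _ _ _ (fun t : R => f (t *: v + y)) f s 1 (s *: v + y) v.
have [|d1 d2] := along.
  by move=> h; congr f; rewrite -[h%:A]/(h * 1) mulr1 scalerDl addrA.
by apply: DeriveDef; [rewrite d1|rewrite d2].
Qed.

(** Only a directional derivative of [f] is assumed, so the chain rule is applied to the restriction
    of [f] to the line through [x] in direction [v]. *)
Lemma is_derive_chain (V : normedModType R) (f : V -> R) (h : R -> R)
    (x v : V) (df dh : R) :
  is_derive x v f df -> is_derive (f x) (1 : R) h dh ->
  is_derive x v (h \o f) (dh * df).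
Proof.
move=> dfx dhx.
have lf : is_derive (0 : R) (1 : R) (fun t : R => f (t *: v + x)) df.
  by apply: is_derive_line; rewrite scale0r add0r.
have lhf : is_derive (0 : R) (1 : R) (h \o (fun t : R => f (t *: v + x))) (dh * df).
  by apply: is_derive1_comp; rewrite scale0r add0r.
have [|d1 d2] := @derive_along _ _ _ (fun t : R => (h \o f) (t *: v + x)) (h \o f) 0 1 x v.
  by move=> t /=; rewrite addr0 -[t%:A]/(t * 1) mulr1.
by case: lhf => lhf1 lhf2; apply: DeriveDef; [rewrite -d1|rewrite -d2].
Qed.

Lemma ler_dist_half (u v w e : R) :
  `|u - w| <= e / 2 -> `|v - w| <= e / 2 -> `|u - v| <= e.
Proof.
move=> uw vw; rewrite (splitr e) -(subrKA w) (le_trans (ler_normD _ _))//.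
by rewrite lerD// distrC.
Qed.

(** The second difference of [f] over a square of side h is symmetric in the two directions. The
    mean value theorem, applied twice in either order, makes it h^2 times either mixed derivative at
    some point of the square; continuity at [x] concludes. *)
Lemma partialC n (f : 'rV[R]_n -> R) (i j : 'I_n) x : of_class_C 2 f ->
  partial i (partial j f) x = partial j (partial i f) x.
Proof.
move=> [cf f2].
have mixed (k l : 'I_n) (y : 'rV[R]_n) (h : R) : 0 < h ->
  exists s t : R, [/\ 0 <= s <= h, 0 <= t <= h &
    f (h *: 'e_k + (h *: 'e_l + y)) - f (h *: 'e_k + y)
    - (f (h *: 'e_l + y) - f y)
    = partial l (partial k f) (t *: 'e_l + (s *: 'e_k + y)) * (h * h)].
  move=> h0; have [dk [ck d2k]] := f2 k; have [dlk ck2] := d2k l.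
  pose g (s : R) := f (s *: 'e_k + (h *: 'e_l + y)) - f (s *: 'e_k + y).
  have dg (s : R) : is_derive s (1 : R) g
      (partial k f (s *: 'e_k + (h *: 'e_l + y)) - partial k f (s *: 'e_k + y)).
    by apply: is_deriveB; apply: is_derive_line; apply: derivableP.
  have cg : continuous g.
    by move=> s; apply/differentiable_continuous/derivable1_diffP; case: (dg s).
  have [s + gE] := MVT h0 (fun s _ => dg s) (continuous_subspaceT cg).
  rewrite in_itv/= => /andP[s0 sh].
  pose g2 (t : R) := partial k f (t *: 'e_l + (s *: 'e_k + y)).
  have dg2 (t : R) : is_derive t (1 : R) g2
      (partial l (partial k f) (t *: 'e_l + (s *: 'e_k + y))).
    by apply: is_derive_line; apply: derivableP.
  have cg2 : continuous g2.
    by move=> t; apply/differentiable_continuous/derivable1_diffP; case: (dg2 t).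
  have [t + g2E] := MVT h0 (fun t _ => dg2 t) (continuous_subspaceT cg2).
  rewrite in_itv/= => /andP[t0 th].
  exists s, t; split; [by rewrite !ltW|by rewrite !ltW|].
  move: gE g2E; rewrite /g /g2 !scale0r !add0r !subr0 => -> g2E.
  by rewrite mulrA -g2E addrCA.
apply/eqP; rewrite -subr_eq0 -normr_eq0 eq_le normr_ge0 andbT.
apply/ler_addgt0Pr => e e0; rewrite add0r.
have [_ [_ /(_ i) [_ cji]]] := f2 j; have [_ [_ /(_ j) [_ cij]]] := f2 i.
have e20 : 0 < e / 2 by rewrite divr_gt0.
have /cvgrPdist_le/(_ _ e20)/nbhs_ballP[a /= a0 xa] := cji x.
have /cvgrPdist_le/(_ _ e20)/nbhs_ballP[b /= b0 xb] := cij x.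
(* Points of the square of side c / K are at distance at most (c / K) (K - 1) < c from [x]. *)
pose c := Num.min a b; pose K : R := `|'e_i : 'rV[R]_n| + `|'e_j : 'rV[R]_n| + 1.
have c0 : 0 < c by rewrite lt_min a0.
have K0 : 0 < K by rewrite ltr_pwDr// addr_ge0.
have h0 : 0 < c / K by rewrite divr_gt0.
have ballc (s t : R) : 0 <= s <= c / K -> 0 <= t <= c / K ->
    ball x c (s *: 'e_i + (t *: 'e_j + x)).
  move=> /andP[s0 sh] /andP[t0 th]; rewrite -ball_normE /ball_/=.
  rewrite addrA opprD addrCA subrr addr0 normrN.
  rewrite (le_lt_trans (ler_normD _ _))// !normrZ !ger0_norm//.
  apply: (@le_lt_trans _ _ (c / K * (K - 1))).
    by rewrite /K addrK mulrDr lerD// ler_wpM2r.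
  by rewrite mulrBr mulr1 divfK ?gt_eqF// gtrBl.
have [s [t [sh th]]] := mixed i j x _ h0.
have [s' [t' [sh' th']]] := mixed j i x _ h0.
rewrite [in X in X -> _ -> _](addrCA (c / K *: 'e_j)).
have hh : c / K * (c / K) != 0 by rewrite mulf_neq0// gt_eqF.
move: (c / K * (c / K)) hh => hh hh0 E2 E1.
have E : partial i (partial j f) (t' *: 'e_i + (s' *: 'e_j + x)) =
         partial j (partial i f) (t *: 'e_j + (s *: 'e_i + x)).
  apply: (mulIf hh0).
  (* The two second differences differ by the exchange of their middle values. *)
  have swap (a1 a2 a3 a4 : R) : a1 - a2 - (a3 - a4) = a1 - a3 - (a2 - a4).
    by ring.
  rewrite swap in E2.
  exact: (etrans (esym E2) E1).
have ca : c <= a by rewrite ge_min lexx.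
have cb : c <= b by rewrite ge_min lexx orbT.
have := xa _ (le_ball ca (ballc _ _ th' sh')).
have := xb _ (le_ball cb (ballc _ _ sh th)).
rewrite E [_ + (t *: _ + _)]addrCA => yb ya.
exact: (ler_dist_half ya yb).
Qed.

End calculus.

(** * Calculus with explicit partial derivatives *)

Section C1_functions.
Variables (R : realType) (n : nat).
Local Notation vec := 'rV[R]_n.

(** The partial derivatives are data given by formulas, so that the divergence of a product comes
    out in closed form, ready for [ring]. *)
Definition C1_with (f : vec -> R) (f' : 'I_n -> vec -> R) :=
  continuous f /\ forall j, continuous (f' j) /\
    forall x, is_derive x 'e_j f (f' j x).

Lemma C1_with_ext f f' g g' :
  f =1 g -> (forall j, f' j =1 g' j) -> C1_with f f' -> C1_with g g'.
Proof.
move=> /funext -> fg'; suff -> : f' = g' by [].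
by apply/funext => j; exact/funext.
Qed.

Lemma of_class_C1_with f : of_class_C 1 f -> C1_with f (fun j => partial j f).
Proof.
by move=> [cf df]; split=> // j; have [dfj cfj] := df j; split=> // x; exact: derivableP.
Qed.

Lemma C1_with_cst c : C1_with (fun=> c) (fun _ _ => 0).
Proof.
split=> [|j]; first exact: cst_continuous.
by split=> [|x]; [exact: cst_continuous|exact: is_derive_cst].
Qed.

Lemma C1_with_coord k : C1_with (fun x => x ord0 k) (fun j _ => (j == k)%:R).
Proof.
split=> [|j]; first exact: coord_continuous.
split=> [|x]; first exact: cst_continuous.
have [|d1 d2] := @derive_along _ _ _ (fun x : vec => x ord0 k)
    (fun t : R => t * (j == k)%:R + x ord0 k) x 'e_j 0 1.
  by move=> h; rewrite !mxE eqxx/= addr0 -[h%:A]/(h * 1) mulr1 eq_sym.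
have dl : is_derive (0 : R) (1 : R) (fun t : R => t * (j == k)%:R + x ord0 k) (j == k)%:R.
  apply: is_derive_eq.
  by rewrite scaler0 add0r addr0 -[LHS]/(_ * 1) mulr1.
by case: dl => dl1 dl2; apply: DeriveDef; [rewrite d1|rewrite d2].
Qed.

Lemma C1_withD f f' g g' : C1_with f f' -> C1_with g g' ->
  C1_with (fun x => f x + g x) (fun j x => f' j x + g' j x).
Proof.
move=> [cf df] [cg dg]; split=> [x|j]; first by exact: (cvgD (cf x) (cg x)).
have [cf' dfj] := df j; have [cg' dgj] := dg j; split=> x.
  by exact: (cvgD (cf' x) (cg' x)).
exact: is_deriveD.
Qed.

Lemma C1_withM f f' g g' : C1_with f f' -> C1_with g g' ->
  C1_with (fun x => f x * g x) (fun j x => f' j x * g x + f x * g' j x).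
Proof.
move=> [cf df] [cg dg]; split=> [x|j]; first by exact: (cvgM (cf x) (cg x)).
have [cf' dfj] := df j; have [cg' dgj] := dg j; split=> x.
  exact: (cvgD (cvgM (cf' x) (cg x)) (cvgM (cf x) (cg' x))).
by apply: is_derive_eq; rewrite addrC; congr (_ + _); rewrite mulrC.
Qed.

Lemma C1_withZ c f f' : C1_with f f' ->
  C1_with (fun x => c * f x) (fun j x => c * f' j x).
Proof.
move=> /(C1_withM (C1_with_cst c)); apply: C1_with_ext => // j x.
by rewrite mul0r add0r.
Qed.

Lemma C1_withB f f' g g' : C1_with f f' -> C1_with g g' ->
  C1_with (fun x => f x - g x) (fun j x => f' j x - g' j x).
Proof.
move=> hf /(C1_withZ (- 1))/(C1_withD hf).
by apply: C1_with_ext => [x|j x]; rewrite mulN1r.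
Qed.

Lemma C1_with_sum m (f : 'I_m -> vec -> R) f' :
  (forall k, C1_with (f k) (f' k)) ->
  C1_with (fun x => \sum_k f k x) (fun j x => \sum_k f' k j x).
Proof.
elim: m f f' => [|m IH] f f' hf.
  apply: C1_with_ext (C1_with_cst 0) => [x|j x]; by rewrite big_ord0.
have := C1_withD (hf ord0) (IH _ _ (fun k => hf (lift ord0 k))).
by apply: C1_with_ext => [x|j x]; rewrite big_ord_recl.
Qed.

Lemma C1_with_comp (h h' : R -> R) f f' : C1_with f f' ->
  (forall x, is_derive (f x) (1 : R) h (h' (f x))) ->
  (forall x, {for f x, continuous h'}) ->
  C1_with (fun x => h (f x)) (fun j x => h' (f x) * f' j x).
Proof.
move=> [cf df] dh ch'; split=> [x|j].
  apply: continuous_comp; first exact: cf.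
  by apply/differentiable_continuous/derivable1_diffP; case: (dh x).
have [cf' dfj] := df j; split=> x; last exact: is_derive_chain.
by exact: (cvgM (continuous_comp (cf x) (ch' x)) (cf' x)).
Qed.

End C1_functions.

(** * Densities of integral zero *)

Section exact_densities.
Variables (R : realType) (n : nat).
Local Notation vec := 'rV[R]_n.
Local Notation mu := (lebesgue_rV R n).

(* Abstracts divergences of compactly supported C^1 vector fields: only these three
   properties are used. *)
Definition exact_density (h : vec -> R) :=
  [/\ continuous h, bounded_support h & (\int[mu]_x (h x)%:E = 0)%E].

Lemma exact_density_partial (f : vec -> R) f' j : C1_with f f' ->
  bounded_support f -> exact_density (f' j).
Proof.
move=> [cf /(_ j)[cf' df]] sf.
have -> : f' j = partial j f by apply/funext => x; case: (df x).
have cpf : continuous (partial j f).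
  by rewrite (_ : partial j f = f' j)//; apply/funext => x; case: (df x).
split=> //; first exact: bounded_support_partial.
by apply: integral_partial_eq0 => // x; case: (df x).
Qed.

Lemma bounded_supportD (f g : vec -> R) : bounded_support f -> bounded_support g ->
  bounded_support (fun x => f x + g x).
Proof.
move=> [M fM] [N gN]; exists (Num.max M N) => x i; rewrite gt_max => /andP[Mx Nx].
by rewrite (fM _ _ Mx) (gN _ _ Nx) addr0.
Qed.

Lemma bounded_supportMl (f g : vec -> R) : bounded_support f ->
  bounded_support (fun x => f x * g x).
Proof. by move=> [M fM]; exists M => x i Mx; rewrite (fM _ _ Mx) mul0r. Qed.

Lemma bounded_supportMr (f g : vec -> R) : bounded_support g ->
  bounded_support (fun x => f x * g x).
Proof. by move=> [M gM]; exists M => x i Mx; rewrite (gM _ _ Mx) mulr0. Qed.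

Lemma exact_densityD f g : exact_density f -> exact_density g ->
  exact_density (fun x => f x + g x).
Proof.
move=> [cf sf f0] [cg sg g0]; split.
- by move=> x; exact: (cvgD (cf x) (cg x)).
- exact: bounded_supportD.
- under eq_integral do rewrite EFinD.
  rewrite integralD//; first by rewrite f0 g0 adde0.
  + exact: integrable_bounded_support.
  + exact: integrable_bounded_support.
Qed.

Lemma exact_densityZ c f : exact_density f -> exact_density (fun x => c * f x).
Proof.
move=> [cf sf f0]; split.
- by move=> x; exact: (cvgM (cvg_cst c) (cf x)).
- exact: bounded_supportMr.
- under eq_integral do rewrite EFinM.
  rewrite integralZl//; first by rewrite f0 mule0.
  exact: integrable_bounded_support.
Qed.

Lemma exact_density0 : exact_density (fun=> 0).
Proof.
by split; [exact: cst_continuous|exists 0|rewrite integral0].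
Qed.

Lemma exact_density_sum m (f : 'I_m -> vec -> R) :
  (forall k, exact_density (f k)) -> exact_density (fun x => \sum_k f k x).
Proof.
elim: m f => [|m IH] f hf.
  by under eq_fun do rewrite big_ord0; exact: exact_density0.
under eq_fun do rewrite big_ord_recl.
by apply: exact_densityD => //; exact: IH.
Qed.

(** This turns pointwise inequalities into integral ones: [h] is integrable with integral 0, so
    adding it to [g] changes nothing on the right. *)
Lemma le_integral_exact (f g h : vec -> R) :
  measurable_fun setT f -> (forall x, 0 <= f x) ->
  continuous g -> bounded_support g -> exact_density h ->
  (forall x, f x <= h x + g x) ->
  (\int[mu]_x (f x)%:E <= \int[mu]_x (g x)%:E)%E.
Proof.
move=> mf f0 cg sg [ch sh h0] fgh.
have -> : (\int[mu]_x (g x)%:E = \int[mu]_x (h x + g x)%:E)%E.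
  rewrite -[LHS]add0e -h0 -integralD//.
  - exact: integrable_bounded_support.
  - exact: integrable_bounded_support.
apply: ge0_le_integral => //.
- by move=> x _; rewrite lee_fin.
- exact/measurable_EFinP.
- apply/measurable_EFinP; apply: continuous_measurable_rV => x.
  exact: (cvgD (ch x) (cg x)).
- by move=> x _; rewrite lee_fin.
Qed.

End exact_densities.

(** * Real inequalities and functions of one variable *)

Section real_inequalities.
Variable R : realType.
Implicit Types p e m D x y : R.

Lemma powR_mul_sqr m p : 0 <= m -> 1 < p -> m `^ (p - 2) * m ^+ 2 = m `^ p.
Proof.
move=> m0 p1; rewrite expr2 mulrA (_ : p - 2 = p - 1 - 1); last by lra.
rewrite [X in X * m]mulrC mulr_powRB1 ?subr_gt0// mulrC.
by rewrite mulr_powRB1// (lt_trans _ p1).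
Qed.

(* The two regimes D <= e m and m < D / e give Young's inequality with constants
   that are explicit powers of e. *)
Lemma young_powR p e m D : 1 <= p -> 0 < e -> 0 <= m -> 0 <= D ->
  m `^ (p - 1) * D <= e * m `^ p + e `^ (1 - p) * D `^ p.
Proof.
move=> p1 e0 m0 D0; have p0 : 0 < p by rewrite (lt_le_trans _ p1).
have [Dem|Dem] := leP D (e * m).
  rewrite -[X in X <= _]addr0 lerD ?mulr_ge0 ?powR_ge0//.
  by rewrite -(mulr_powRB1 m0 p0) mulrA mulrC ler_wpM2r ?powR_ge0.
rewrite -[X in X <= _]add0r lerD ?mulr_ge0 ?powR_ge0 ?(ltW e0)//.
rewrite -(mulr_powRB1 D0 p0) mulrCA [leLHS]mulrC ler_wpM2l//.
rewrite -[1 - p]opprB powRN [leRHS]mulrC ler_pdivlMr ?powR_gt0//.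
rewrite -(powRM _ m0 (ltW e0)) ge0_ler_powR ?nnegrE ?mulr_ge0 ?subr_ge0 ?(ltW e0)//.
by rewrite mulrC ltW.
Qed.

Lemma young_powR2 p e m D : 2 <= p -> 0 < e <= 1 -> 0 <= m -> 0 <= D ->
  m `^ (p - 2) * D ^+ 2 <= e * m `^ p + e `^ (2 - p) * D `^ p.
Proof.
move=> p2 /andP[e0 e1] m0 D0; have p1 : 1 < p by rewrite (lt_le_trans _ p2)// ltr1n.
have [Dem|Dem] := leP D (e * m).
  rewrite -[X in X <= _]addr0 lerD ?mulr_ge0 ?powR_ge0//.
  rewrite -(powR_mul_sqr m0 p1) [leRHS]mulrCA ler_wpM2l ?powR_ge0//.
  rewrite (@le_trans _ _ ((e * m) ^+ 2)) ?lerXn2r ?nnegrE ?mulr_ge0 ?(ltW e0)//.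
  (* Here e <= 1 is needed: (e m)^2 <= e m^2. *)
  by rewrite exprMn ler_wpM2r ?sqr_ge0// expr2 ler_piMl// ltW.
rewrite -[X in X <= _]add0r lerD ?mulr_ge0 ?powR_ge0 ?(ltW e0)//.
rewrite -(powR_mul_sqr D0 p1) mulrA ler_wpM2r ?sqr_ge0//.
rewrite -[2 - p]opprB powRN [leRHS]mulrC ler_pdivlMr ?powR_gt0//.
rewrite -(powRM _ m0 (ltW e0)) ge0_ler_powR ?nnegrE ?mulr_ge0 ?subr_ge0 ?(ltW e0)//.
by rewrite mulrC ltW.
Qed.

Lemma powR_add_le p x y : 0 <= p -> 0 <= x -> 0 <= y ->
  (x + y) `^ p <= 2 `^ p * (x `^ p + y `^ p).
Proof.
move=> p0 x0 y0; wlog xy : x y x0 y0 / x <= y.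
  move=> h; have [xy|yx] := leP x y; first exact: h.
  by rewrite addrC [X in _ * X]addrC h// ltW.
rewrite (@le_trans _ _ ((2 * y) `^ p))//.
  rewrite ge0_ler_powR ?nnegrE ?addr_ge0 ?mulr_ge0//.
  by rewrite mulr_natl mulr2n lerD2r.
by rewrite powRM// ler_wpM2l ?powR_ge0// lerDr powR_ge0.
Qed.

End real_inequalities.

(** * Powers and positive parts of class C^1 on the line *)

Section one_variable.
Variable R : realType.

Lemma continuous_norm_powR (b : R) : 0 <= b -> continuous (fun t : R => `|t| `^ b).
Proof.
rewrite le_eqVlt => /predU1P[<-|b0] t.
  rewrite (_ : (fun t : R => _) = cst 1); first exact: cst_continuous.
  by apply/funext => x; rewrite powRr0.
have [->|t0] := eqVneq t 0; last first.
  apply: (@continuous_comp _ _ _ (fun t : R => `|t|) (fun t : R => t `^ b)).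
    exact: norm_continuous.
  apply/differentiable_continuous/derivable1_diffP.
  have nt : 0 < `|t| by rewrite normr_gt0.
  by case: (is_derive1_powR b nt).
apply/cvgrPdist_lt => e e0; rewrite normr0 powR0 ?gt_eqF//.
have eb : 0 < e `^ b^-1 by rewrite powR_gt0.
have eE : (e `^ b^-1) `^ b = e.
  by rewrite -powRrM mulVf ?gt_eqF// powRr1// ltW.
apply/nbhs_ballP; exists (e `^ b^-1) => //= x.
rewrite /ball/= sub0r normrN => xe.
rewrite sub0r normrN ger0_norm ?powR_ge0// -eE.
by apply: gt0_ltr_powR => //; rewrite nnegrE// ltW.
Qed.

(* Extends t `^ a to a C^1 function on the line: powR itself is 1 on negative
   numbers, hence not differentiable at 0. *)
Definition signed_powR (a t : R) := t * `|t| `^ (a - 1).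

Lemma signed_powRE a t : 0 < a -> 0 <= t -> signed_powR a t = t `^ a.
Proof. by move=> a0 t0; rewrite /signed_powR ger0_norm// mulr_powRB1. Qed.

Lemma is_derive_signed_powR a (t : R) : 1 <= a ->
  is_derive t (1 : R) (signed_powR a) (a * `|t| `^ (a - 1)).
Proof.
move=> a1; have a0 : 0 < a by rewrite (lt_le_trans _ a1).
have [t0|t0|->] := ltgtP t 0.
- have nt : 0 < - t by rewrite oppr_gt0.
  have dN : is_derive t (1 : R) (-%R : R -> R) (- 1).
    by apply: is_deriveN; exact: is_derive_id.
  have dc : is_derive t (1 : R) ((fun y : R => y `^ a) \o -%R) (a * (- t) `^ (a - 1) * - 1).
    by apply: is_derive1_comp; exact: is_derive1_powR.
  have dP := is_deriveN dc.
  rewrite ltr0_norm// -[a * _]mulr1 -[X in _ * X]opprK mulrN.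
  apply: near_eq_is_derive dP.
  near=> x; have x0 : x < 0 by near: x; exact: lt_nbhsl.
  rewrite /signed_powR ltr0_norm// -[X in _ = X * _]opprK mulNr mulr_powRB1//.
  by rewrite oppr_ge0 ltW.
- rewrite gtr0_norm//; apply: near_eq_is_derive (is_derive1_powR a t0).
  by near=> x; rewrite signed_powRE// ltW//; near: x; exact: lt_nbhsr.
(* At 0 the difference quotient is exactly |h|^(a-1), without the factor [a]. This is harmless: for
   a > 1 both limits are 0, and for a = 1 the factor is 1. *)
- have -> : a * `|0 : R| `^ (a - 1) = `|0 : R| `^ (a - 1).
    move: a1; rewrite le_eqVlt => /predU1P[<-|a1]; first by rewrite mul1r.
    by rewrite normr0 powR0 ?mulr0// subr_eq0 gt_eqF.
  have h : (fun h : R => h^-1 *: ((signed_powR a \o shift 0) (h *: (1 : R)) - signed_powR a 0))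
      @ 0^' --> (`|0 : R| `^ (a - 1) : R).
    apply: (@cvg_trans _ ((fun t : R => `|t| `^ (a - 1)) @ 0^')).
      apply: near_eq_cvg; near=> x; rewrite /= /signed_powR mul0r subr0 addr0.
      rewrite -[x%:A]/(x * 1) mulr1 -[RHS]/(_ * _) mulKf//.
      by near: x; exact: nbhs_dnbhs_neq.
    apply: cvg_within_filter; apply: continuous_norm_powR.
    by rewrite subr_ge0.
  by apply: DeriveDef; [apply/cvg_ex; eexists; exact: h|exact/cvg_lim].
Unshelve. all: by end_near. Qed.

(** Squaring makes the positive part C^1; both cutoffs of the proof are built from it. *)
Definition sqr_pos (t : R) := Num.max t 0 ^+ 2.

Lemma sqr_posE t : sqr_pos t = 2^-1 * (signed_powR 2 t + t ^+ 2).
Proof.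
rewrite /sqr_pos /signed_powR (_ : 2 - 1 = 1 :> R); last by lra.
rewrite powRr1//; case: ltrP => t0; first by rewrite ltr0_norm//; lra.
by rewrite ger0_norm//; lra.
Qed.

Lemma continuous_maxr0 : continuous (fun t : R => Num.max t 0).
Proof.
by move=> x; apply: (@continuous_max _ _ id (cst 0)) => //; exact: cst_continuous.
Qed.

Lemma is_derive_sqr_pos (t : R) :
  is_derive t (1 : R) sqr_pos (2 * Num.max t 0).
Proof.
rewrite (_ : sqr_pos = 2^-1 \*: (fun t => signed_powR 2 t + t ^+ 2)); last first.
  by apply/funext => x; rewrite sqr_posE.
have d1 : is_derive t (1 : R) (signed_powR 2) (2 * `|t| `^ (2 - 1)).
  by apply: is_derive_signed_powR; rewrite ler1n.
have d2 : is_derive t (1 : R) (fun t : R => t ^+ 2) (2 * t).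
  by apply: is_derive_eq; rewrite -[LHS]/(t * 1 + t * 1); ring.
have d3 := is_deriveZ 2^-1 (is_deriveD d1 d2).
apply: is_derive_eq; rewrite (_ : 2 - 1 = 1 :> R); last by lra.
rewrite powRr1// -[LHS]/(_ * _); case: ltrP => t0; first by rewrite ltr0_norm//; lra.
by rewrite ger0_norm//; lra.
Qed.

End one_variable.

(** * Covariant derivatives and radial fields *)

Section covariant.
Variables (R : realType) (n : nat).
Local Notation vec := 'rV[R]_n.
Variables (A : vec -> vec) (a b : vec -> R).

(** Together with [cov_im]: real and imaginary parts of D_j u = d_j u + i A_j u for u = a + i b. *)
Definition cov_re (j : 'I_n) (x : vec) := partial j a x - A x ord0 j * b x.
Definition cov_im (j : 'I_n) (x : vec) := partial j b x + A x ord0 j * a x.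
Definition modulus (x : vec) := Num.sqrt (a x ^+ 2 + b x ^+ 2).
Definition cov_norm (x : vec) :=
  Num.sqrt (\sum_j (cov_re j x ^+ 2 + cov_im j x ^+ 2)).

Lemma modulus_ge0 x : 0 <= modulus x. Proof. exact: sqrtr_ge0. Qed.
Lemma cov_norm_ge0 x : 0 <= cov_norm x. Proof. exact: sqrtr_ge0. Qed.

Lemma sqr_modulus x : modulus x ^+ 2 = a x ^+ 2 + b x ^+ 2.
Proof. by rewrite sqr_sqrtr// addr_ge0// sqr_ge0. Qed.

Lemma cov_norm_ge j x : cov_re j x ^+ 2 + cov_im j x ^+ 2 <= cov_norm x ^+ 2.
Proof.
rewrite sqr_sqrtr; last by apply: sumr_ge0 => i _; rewrite addr_ge0// sqr_ge0.
rewrite (bigD1 j)//= lerDl; apply: sumr_ge0 => i _; by rewrite addr_ge0// sqr_ge0.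
Qed.

Lemma abs_le_mul (u v w : R) : 0 <= v -> 0 <= w -> u ^+ 2 <= v ^+ 2 * w ^+ 2 ->
  `|u| <= v * w.
Proof.
move=> v0 w0 uvw; rewrite -(ler_pXn2r (n := 2))// ?nnegrE ?mulr_ge0//.
by rewrite real_normK ?num_real// exprMn.
Qed.

(** The left side is the modulus of Re (conj u D_j u); by Lagrange's identity, the square missing
    from |u|^2 |D_j u|^2 is that of Im (conj u D_j u). *)
Lemma abs_re_le j x :
  `|a x * cov_re j x + b x * cov_im j x| <= modulus x * cov_norm x.
Proof.
apply: abs_le_mul; rewrite ?modulus_ge0 ?cov_norm_ge0// sqr_modulus.
apply: le_trans (ler_wpM2l _ (cov_norm_ge j x)); last by rewrite addr_ge0// sqr_ge0.
move: (cov_re j x) (cov_im j x) (a x) (b x) => al be a0 b0.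
have := sqr_ge0 (a0 * be - b0 * al); lra.
Qed.

Lemma abs_im_le j x :
  `|a x * cov_im j x - b x * cov_re j x| <= modulus x * cov_norm x.
Proof.
apply: abs_le_mul; rewrite ?modulus_ge0 ?cov_norm_ge0// sqr_modulus.
apply: le_trans (ler_wpM2l _ (cov_norm_ge j x)); last by rewrite addr_ge0// sqr_ge0.
move: (cov_re j x) (cov_im j x) (a x) (b x) => al be a0 b0.
have := sqr_ge0 (a0 * al + b0 * be); lra.
Qed.

(** The terms in [A] cancel, so the gradient of |u|^2 is 2 Re (conj u D u) for every potential. This
    is what replaces the diamagnetic inequality. *)
Lemma C1_with_msq : of_class_C 1 a -> of_class_C 1 b ->
  C1_with (fun x => a x ^+ 2 + b x ^+ 2)
    (fun j x => 2 * (a x * cov_re j x + b x * cov_im j x)).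
Proof.
move=> /of_class_C1_with ha /of_class_C1_with hb.
apply: C1_with_ext (C1_withD (C1_withM ha ha) (C1_withM hb hb)) => [x|j x] //.
by rewrite /cov_re /cov_im; ring.
Qed.

End covariant.

(** * The radial estimate *)

Section radial.
Variables (R : realType) (n : nat).
Local Notation vec := 'rV[R]_n.

Definition dist2 (c x : vec) := \sum_j (x ord0 j - c ord0 j) ^+ 2.

Implicit Types c x : vec.

Lemma dist2_ge0 c x : 0 <= dist2 c x.
Proof. by apply: sumr_ge0 => j _; exact: sqr_ge0. Qed.

Lemma coord_le_dist2 c x j : `|x ord0 j - c ord0 j| <= Num.sqrt (dist2 c x).
Proof.
rewrite -sqrtr_sqr ler_wsqrtr// /dist2 (bigD1 j)//= lerDl.
by apply: sumr_ge0 => i _; exact: sqr_ge0.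
Qed.

Lemma C1_with_coordB c j :
  C1_with (fun x : vec => x ord0 j - c ord0 j) (fun i _ => (i == j)%:R).
Proof.
apply: C1_with_ext (C1_withB (C1_with_coord R j) (C1_with_cst _ (c ord0 j))) => // i x.
by rewrite subr0.
Qed.

Lemma C1_with_dist2 c :
  C1_with (dist2 c) (fun j x => 2 * (x ord0 j - c ord0 j)).
Proof.
apply: C1_with_ext (C1_with_sum
  (fun j => C1_withM (C1_with_coordB c j) (C1_with_coordB c j))) => [x|j x].
  by [].
rewrite (bigD1 j)//= eqxx mul1r mulr1 big1 ?addr0; first by ring.
by move=> i /negPf; rewrite eq_sym => ->; rewrite mul0r mulr0 addr0.
Qed.

Lemma sqrtr_powR (t p : R) : 0 <= t -> Num.sqrt t `^ p = t `^ (p / 2).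
Proof. by move=> t0; rewrite -powR12_sqrt// -powRrM mulrC. Qed.

(** With s = |x - x0|^2, div (F |u|^p) = (n f + 2 s f') |u|^p + p f |u|^(p-2) (x - x0) . Re (conj u
    D u). Young's inequality absorbs half of c w^p |u|^p from the last term. [C] is chosen before
    the profiles [f], [w], [V], which makes it uniform in any smoothing parameter hidden in them. *)
Lemma radial_estimate (p c K : R) : 2 <= p -> 0 < c -> 0 <= K ->
  exists2 C : R, 0 <= C & forall (x0 : vec) (f f' w V : R -> R),
  (forall s : R, 0 <= s -> is_derive s (1 : R) f (f' s)) ->
  (forall s : R, 0 <= s -> {for s, continuous f'}) ->
  (forall s : R, 0 <= s -> 0 <= w s) ->
  (forall s : R, 0 <= s -> c * w s `^ p - V s <= n%:R * f s + 2 * s * f' s) ->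
  (forall s : R, 0 <= s -> Num.sqrt s * `|f s| <= K * w s `^ (p - 1)) ->
  forall (A : vec -> vec) (a b : vec -> R),
    of_class_C 1 a -> of_class_C 1 b -> bounded_support a -> bounded_support b ->
  exists2 h, exact_density h &
    forall x, c / 2 * (w (dist2 x0 x) `^ p * modulus a b x `^ p) <=
      h x + V (dist2 x0 x) * modulus a b x `^ p + C * cov_norm A a b x `^ p.
Proof.
(* [L] collects the p of the chain rule, the bound [K] on the field, and an [n] from bounding each
   coordinate of the scalar product separately. The choice of [e] gives L e <= c / 2. *)
move=> p2 c0 K0; pose L := p * n%:R * K; pose e := c / (2 * (L + 1)).
have L0 : 0 <= L by rewrite !mulr_ge0// (le_trans _ p2).
have e0 : 0 < e by rewrite divr_gt0// mulr_gt0// ltr_wpDl.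
exists (L * e `^ (1 - p)); first by rewrite mulr_ge0// powR_ge0.
move=> x0 f f' w V df cf' w0 hV hK A a b Ca Cb sa sb.
pose P x := signed_powR (p / 2) (a x ^+ 2 + b x ^+ 2).
pose P' (t : R) : R := p / 2 * `|t| `^ (p / 2 - 1).
have p21 : 1 <= p / 2 by lra.
have cP' (t : R) : {for t, continuous P'}.
  apply: (cvgM (cvg_cst _)).
  by apply: continuous_norm_powR; rewrite subr_ge0.
have CP : C1_with P (fun j x => P' (a x ^+ 2 + b x ^+ 2) *
    (2 * (a x * cov_re A a b j x + b x * cov_im A a b j x))).
  apply: (C1_with_comp (h := signed_powR (p / 2)) (C1_with_msq A Ca Cb)) => x.
    exact: is_derive_signed_powR.
  exact: cP'.
have Cf : C1_with (fun x => f (dist2 x0 x))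
    (fun j x => f' (dist2 x0 x) * (2 * (x ord0 j - x0 ord0 j))).
  apply: (C1_with_comp (h := f) (C1_with_dist2 x0)) => x.
    exact/df/dist2_ge0.
  exact/cf'/dist2_ge0.
have sP : bounded_support P.
  have [M aM] := sa; have [N bN] := sb; exists (Num.max M N) => x i.
  rewrite gt_max => /andP[Mx Nx].
  by rewrite /P (aM _ _ Mx) (bN _ _ Nx) /signed_powR expr0n addr0 mul0r.
have CG j := C1_withM (C1_with_coordB x0 j) (C1_withM Cf CP).
have sG j : bounded_support (fun x => (x ord0 j - x0 ord0 j) * (f (dist2 x0 x) * P x)).
  by do 2 apply: bounded_supportMr.
exists (fun x => \sum_j ((j == j)%:R * (f (dist2 x0 x) * P x) +
    (x ord0 j - x0 ord0 j) * (f' (dist2 x0 x) * (2 * (x ord0 j - x0 ord0 j)) * P x +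
    f (dist2 x0 x) * (P' (a x ^+ 2 + b x ^+ 2) *
    (2 * (a x * cov_re A a b j x + b x * cov_im A a b j x)))))).
  by apply: exact_density_sum => j; exact: exact_density_partial (CG j) (sG j).
move=> x; set s := dist2 x0 x; have s0 : 0 <= s by exact: dist2_ge0.
set m := modulus a b x; set D := cov_norm A a b x.
have m0 : 0 <= m by exact: modulus_ge0.
have D0 : 0 <= D by exact: cov_norm_ge0.
have msq0 : 0 <= a x ^+ 2 + b x ^+ 2 by rewrite addr_ge0// sqr_ge0.
have PE : P x = m `^ p.
  by rewrite /P signed_powRE ?sqrtr_powR// (lt_le_trans _ p21).
have P'E : P' (a x ^+ 2 + b x ^+ 2) = p / 2 * m `^ (p - 2).
  rewrite /P' ger0_norm// /m /modulus sqrtr_powR//; congr (_ * _ `^ _); lra.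
pose X := \sum_j (x ord0 j - x0 ord0 j) * (a x * cov_re A a b j x + b x * cov_im A a b j x).
have Xle : `|X| <= n%:R * (Num.sqrt s * (m * D)).
  apply: (le_trans (ler_norm_sum _ _ _)).
  rewrite -[n in n%:R]card_ord -sum1_card natr_sum mulr_suml.
  apply: ler_sum => j _; rewrite mul1r normrM ler_pM//.
    exact: coord_le_dist2.
  exact: abs_re_le.
have -> : \sum_j ((j == j)%:R * (f s * P x) +
    (x ord0 j - x0 ord0 j) * (f' s * (2 * (x ord0 j - x0 ord0 j)) * P x +
    f s * (P' (a x ^+ 2 + b x ^+ 2) *
    (2 * (a x * cov_re A a b j x + b x * cov_im A a b j x))))) =
  (n%:R * f s + 2 * s * f' s) * m `^ p + f s * (p * m `^ (p - 2)) * X.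
  transitivity (\sum_j (f s * m `^ p +
      (2 * f' s * m `^ p) * (x ord0 j - x0 ord0 j) ^+ 2 +
      (f s * (p * m `^ (p - 2))) * ((x ord0 j - x0 ord0 j) *
      (a x * cov_re A a b j x + b x * cov_im A a b j x)))).
    by apply: eq_bigr => j _; rewrite eqxx mul1r PE P'E; field.
  rewrite !big_split/= -!mulr_sumr sumr_const card_ord -mulr_natl -/X -/(dist2 x0 x) -/s.
  by ring.
have hm : (c * w s `^ p - V s) * m `^ p <= (n%:R * f s + 2 * s * f' s) * m `^ p.
  by rewrite ler_wpM2r ?powR_ge0// hV.
have wm0 : 0 <= w s * m by rewrite mulr_ge0// w0.
have hX : `|f s * (p * m `^ (p - 2)) * X| <=
    L * (e * (w s `^ p * m `^ p) + e `^ (1 - p) * D `^ p).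
  have p1 : 1 <= p by rewrite (le_trans _ p2)// ler1n.
  rewrite -powRM ?w0//.
  apply: (@le_trans _ _ (L * ((w s * m) `^ (p - 1) * D))); last first.
    by rewrite ler_wpM2l// young_powR.
  (* Splitting (w m)^(p-1) as w^(p-1) m^(p-2) m separates the bound on the field from the factor
     m^(p-2) of the chain rule. *)
  have -> : L * ((w s * m) `^ (p - 1) * D) =
      (p * m `^ (p - 2)) * (n%:R * (K * w s `^ (p - 1) * (m * D))).
    rewrite powRM ?w0// -(@mulr_powRB1 _ m (p - 1)) ?subr_gt0 ?(lt_le_trans _ p2) ?ltr1n//.
    rewrite (_ : p - 1 - 1 = p - 2); last by lra.
    by rewrite /L; ring.
  rewrite mulrAC [f s * X * _]mulrC normrM ger0_norm; last first.
    by rewrite mulr_ge0 ?powR_ge0// (le_trans _ p2).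
  rewrite ler_wpM2l ?mulr_ge0 ?powR_ge0 ?(le_trans _ p2)//.
  rewrite normrM; apply: (le_trans (ler_wpM2l (normr_ge0 _) Xle)).
  rewrite mulrCA; apply: ler_wpM2l; first exact: ler0n.
  by rewrite [leLHS]mulrA ler_wpM2r ?mulr_ge0// mulrC hK.
have Le : L * e <= c / 2.
  rewrite /e mulrA ler_pdivrMr ?mulr_gt0 ?ltr_wpDl//.
  rewrite (_ : c / 2 * (2 * (L + 1)) = L * c + c); first by rewrite lerDl ltW.
  by field.
have wm : 0 <= w s `^ p * m `^ p by rewrite mulr_ge0// powR_ge0.
have := ler_wpM2r wm Le; move: hX hm; rewrite ler_norml => /andP[+ _].
move: (w s `^ p) (m `^ p) (D `^ p) (f s * _ * X) (e `^ (1 - p)) (_ + 2 * s * _).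
by move=> W M Z Y Q S; lra.
Qed.

End radial.

(** * The commutator estimate *)

Section current.
Variables (R : realType) (n : nat).
Local Notation vec := 'rV[R]_n.
Variables (A : vec -> vec) (a b : vec -> R).
Hypotheses (A1 : forall k, of_class_C 1 (fun x => A x ord0 k)).
Hypotheses (a2 : of_class_C 2 a) (b2 : of_class_C 2 b).

Lemma of_class_C21 (f : vec -> R) : of_class_C 2 f -> of_class_C 1 f.
Proof.
by move=> [cf df]; split=> // j; have [dfj [cfj _]] := df j.
Qed.

Definition current (j : 'I_n) (x : vec) :=
  a x * cov_im A a b j x - b x * cov_re A a b j x.

Definition dcov_re (j k : 'I_n) (x : vec) := partial k (partial j a) x -
  (partial k (fun y => A y ord0 j) x * b x + A x ord0 j * partial k b x).
Definition dcov_im (j k : 'I_n) (x : vec) := partial k (partial j b) x +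
  (partial k (fun y => A y ord0 j) x * a x + A x ord0 j * partial k a x).
Definition dcurrent (j k : 'I_n) (x : vec) :=
  partial k a x * cov_im A a b j x + a x * dcov_im j k x -
  (partial k b x * cov_re A a b j x + b x * dcov_re j k x).

Lemma C1_with_current j : C1_with (current j) (dcurrent j).
Proof.
have h1 (f : vec -> R) : of_class_C 2 f -> of_class_C 1 (partial j f).
  by move=> [_ /(_ j)[]].
have ha := of_class_C1_with (of_class_C21 a2).
have hb := of_class_C1_with (of_class_C21 b2).
have hre : C1_with (cov_re A a b j) (dcov_re j).
  exact: (C1_withB (of_class_C1_with (h1 _ a2)) (C1_withM (of_class_C1_with (A1 j)) hb)).
have him : C1_with (cov_im A a b j) (dcov_im j).
  exact: (C1_withD (of_class_C1_with (h1 _ b2)) (C1_withM (of_class_C1_with (A1 j)) ha)).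
exact: (C1_withB (C1_withM ha him) (C1_withM hb hre)).
Qed.

(** All derivatives are independent variables, except that the second derivatives of [a] and [b] are
    already identified with their transposes; they cancel, and [A] survives only through its
    curl. *)
Lemma curl_ring (dja djb dia dib ddij_a ddij_b dAji dAij Ai Aj x y : R) :
  (dia * (djb + Aj * x) + x * (ddij_b + (dAji * x + Aj * dia)) -
   (dib * (dja - Aj * y) + y * (ddij_a - (dAji * y + Aj * dib)))) -
  (dja * (dib + Ai * x) + x * (ddij_b + (dAij * x + Ai * dja)) -
   (djb * (dia - Ai * y) + y * (ddij_a - (dAij * y + Ai * djb)))) =
  (dAji - dAij) * (x ^+ 2 + y ^+ 2) +
  2 * ((dia - Ai * y) * (djb + Aj * x) - (dib + Ai * x) * (dja - Aj * y)).
Proof. by ring. Qed.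

Lemma curl_current i j x : dcurrent j i x - dcurrent i j x =
  (partial i (fun y => A y ord0 j) x - partial j (fun y => A y ord0 i) x) *
    (a x ^+ 2 + b x ^+ 2) +
  2 * (cov_re A a b i x * cov_im A a b j x - cov_im A a b i x * cov_re A a b j x).
Proof.
rewrite /dcurrent /dcov_re /dcov_im (partialC j i x a2) (partialC j i x b2).
exact: curl_ring.
Qed.

Lemma cross_le i j x :
  `|cov_re A a b i x * cov_im A a b j x - cov_im A a b i x * cov_re A a b j x|
  <= cov_norm A a b x * cov_norm A a b x.
Proof.
apply: abs_le_mul; rewrite ?cov_norm_ge0//.
apply: le_trans (ler_pM _ _ (cov_norm_ge A a b i x) (cov_norm_ge A a b j x)).
- move: (cov_re A a b i x) (cov_im A a b i x) (cov_re A a b j x) (cov_im A a b j x).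
  by move=> u v w z; have := sqr_ge0 (u * w + v * z); lra.
- by rewrite addr_ge0// sqr_ge0.
- by rewrite addr_ge0// sqr_ge0.
Qed.

End current.

Section commutator.
Variables (R : realType) (n : nat).
Local Notation vec := 'rV[R]_n.

(** Here [r] is the square of the radius of the supporting ball. The C^1 cutoff is the square of
    this function; the function itself measures the size of the gradient of that cutoff. *)
Definition tent (r : R) (c x : vec) : R := Num.max (r - dist2 c x) 0.

Lemma tent_ge0 r c x : 0 <= tent r c x. Proof. by rewrite le_max lexx orbT. Qed.

Lemma tent_le r c x : 0 <= r -> tent r c x <= r.
Proof. by move=> r0; rewrite ge_max r0 lerBlDr lerDl dist2_ge0. Qed.

Lemma continuous_dist2 c : continuous (dist2 c : vec -> R).
Proof. by case: (C1_with_dist2 c). Qed.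

Lemma continuous_tent r c : continuous (tent r c).
Proof.
move=> x; apply: (@continuous_comp _ _ _ (fun x => r - dist2 c x) (fun t : R => Num.max t 0)).
  exact: (cvgB (cvg_cst _) (@continuous_dist2 c x)).
exact: continuous_maxr0.
Qed.

Lemma bounded_support_tent r c : bounded_support (tent r c).
Proof.
exists (Num.sqrt `|r| + \sum_k `|c ord0 k|) => x i xi.
rewrite /tent max_r// subr_le0 leNgt; apply/negP => xr.
move: xi; apply/negP; rewrite -leNgt -(subrK (c ord0 i) (x ord0 i)).
rewrite (le_trans (ler_normD _ _))// lerD//.
  rewrite (le_trans (coord_le_dist2 _ _ _))// ler_wsqrtr// (le_trans (ltW xr))//.
  exact: ler_norm.
by rewrite (bigD1 i)//= lerDl sumr_ge0.
Qed.

Lemma C1_with_sqr_tent r c : C1_with (fun x : vec => tent r c x ^+ 2)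
  (fun j x => 2 * tent r c x * (- (2 * (x ord0 j - c ord0 j)))).
Proof.
have hr := C1_withB (C1_with_cst n r) (C1_with_dist2 c).
apply: C1_with_ext (C1_with_comp (h := @sqr_pos R)
  (h' := fun t => 2 * Num.max t 0) hr _ _) => [x|j x|x|x].
- by [].
- by rewrite sub0r.
- exact: is_derive_sqr_pos.
- exact: (cvgM (cvg_cst _) (@continuous_maxr0 _ _)).
Qed.

(** Where [tent] is positive, |x - c| <= sqrt r. Differentiating the square loses one power of
    [tent]; this is the source of the error term that only the weight at infinity can absorb. *)
Lemma dtent_le r c (j : 'I_n) x : 0 <= r ->
  `|2 * tent r c x * (- (2 * (x ord0 j - c ord0 j)))| <=
  4 * Num.sqrt r * tent r c x.
Proof.
move=> r0; rewrite normrM normrN !normrM (ger0_norm (tent_ge0 r c x)) !normr_nat.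
rewrite (_ : 2 * _ * _ = 4 * (tent r c x * `|x ord0 j - c ord0 j|)); last by ring.
rewrite -mulrA ler_wpM2l// mulrC; have [tr|tr] := leP (r - dist2 c x) 0.
  by rewrite /tent max_r// !mulr0.
rewrite ler_wpM2r ?tent_ge0// (le_trans (coord_le_dist2 _ _ _))// ler_wsqrtr//.
by rewrite ltW// -subr_gt0.
Qed.


(** The commutator estimate at one point: [chi1] is the tent, [be] the field component, [M] the
    regularized modulus, [h] the exact density, and [E] what the density contains besides the
    magnetic term. *)
Lemma commutator_real (p e k r K b0 be chi1 m D h E : R) :
  2 <= p -> 0 < e <= 1 -> 0 < k -> 0 <= r -> 0 <= K ->
  0 <= chi1 <= r -> 0 <= m -> 0 <= D -> 0 < b0 ->
  (0 < chi1 -> b0 <= be) ->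
  K = 8 * Num.sqrt r + (2 * p - 2) * r + b0 * r ->
  let M := Num.sqrt (m ^+ 2 + k) in
  h = E + chi1 ^+ 2 * M `^ (p - 2) * (be * m ^+ 2) ->
  `|E| <= 8 * Num.sqrt r * chi1 * (M `^ (p - 2) * (m * D)) +
          (2 * p - 2) * chi1 ^+ 2 * (M `^ (p - 2) * D ^+ 2) ->
  b0 * (chi1 ^+ 2 * m `^ p) <= h +
    3 * K * 2 `^ (p / 2) * e * (chi1 * m `^ p) +
    2 * K * r * (e `^ (1 - p) + e `^ (2 - p)) * D `^ p +
    K * (3 * 2 `^ (p / 2) + e `^ (2 - p)) * k `^ (p / 2) * chi1.
Proof.
move=> p2 e01 k0 r0 K0 /andP[chi0 chir] m0 D0 b00 hb KE M hE hEle.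
have /andP[e0 e1] := e01.
have M2 : M ^+ 2 = m ^+ 2 + k by rewrite sqr_sqrtr// addr_ge0 ?sqr_ge0// ltW.
have M0 : 0 <= M by exact: sqrtr_ge0.
have mM : m <= M by rewrite -(ler_pXn2r (n := 2))// ?nnegrE// M2 lerDl ltW.
have p1 : 1 < p by rewrite (lt_le_trans _ p2)// ltr1n.
have p0 : 0 <= p by rewrite (le_trans _ p2).
have Q0 : 0 <= M `^ (p - 2) by exact: powR_ge0.
have y1 : M `^ (p - 2) * (m * D) <= e * M `^ p + e `^ (1 - p) * D `^ p.
  apply: le_trans (young_powR (ltW p1) e0 M0 D0).
  rewrite mulrA ler_wpM2r// -(@mulr_powRB1 _ M (p - 1)) ?subr_gt0// mulrC.
  by rewrite (_ : p - 1 - 1 = p - 2) ?ler_wpM2r//; lra.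
have y2 := young_powR2 p2 e01 M0 D0.
have y3 := young_powR2 p2 e01 M0 (sqrtr_ge0 k).
rewrite sqr_sqrtr ?(ltW k0)// sqrtr_powR ?(ltW k0)// in y3.
have y4 : M `^ p <= 2 `^ (p / 2) * (m `^ p + k `^ (p / 2)).
  have -> : m `^ p = (m ^+ 2) `^ (p / 2).
    by rewrite -sqrtr_powR ?sqr_ge0// sqrtr_sqr ger0_norm.
  rewrite /M sqrtr_powR ?addr_ge0 ?sqr_ge0 ?(ltW k0)//.
  by rewrite powR_add_le ?divr_ge0 ?sqr_ge0// ltW.
(* The magnetic term only yields M^(p-2) m^2; completing it to M^p costs M^(p-2) k, which [y3]
   treats with sqrt k in the role of [D]. *)
have y5 : M `^ (p - 2) * m ^+ 2 = M `^ p - M `^ (p - 2) * k.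
  by rewrite -(powR_mul_sqr M0 p1) M2; ring.
have y6 : m `^ p <= M `^ p by rewrite ge0_ler_powR ?nnegrE.
have main : b0 * (chi1 ^+ 2 * M `^ p) <= h + `|E| + b0 * chi1 ^+ 2 * (M `^ (p - 2) * k).
  have : b0 * (chi1 ^+ 2 * (M `^ (p - 2) * m ^+ 2)) <=
      be * (chi1 ^+ 2 * (M `^ (p - 2) * m ^+ 2)).
    move: (chi0); rewrite le_eqVlt => /predU1P[<-|/hb bb].
      by rewrite expr0n/= !mul0r !mulr0.
    by rewrite ler_wpM2r// !mulr_ge0// ?sqr_ge0.
  rewrite hE (_ : chi1 ^+ 2 * _ * (be * _) =
    be * (chi1 ^+ 2 * (M `^ (p - 2) * m ^+ 2))); last by ring.
  by have := ler_norm (- E); rewrite normrN y5; lra.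
move: (M `^ (p - 2)) (M `^ p) (m `^ p) (D `^ p) (k `^ (p / 2)) (2 `^ (p / 2))
  (e `^ (1 - p)) (e `^ (2 - p)) (powR_ge0 D p) (powR_ge0 k (p / 2))
  (powR_ge0 e (1 - p)) (powR_ge0 e (2 - p)) (powR_ge0 m p) (powR_ge0 2 (p / 2))
  hE hEle Q0 y1 y2 y3 y4 y5 y6 main.
move=> Q Mp mp Dp kp T c1 c2 Dp0 kp0 c10 c20 mp0 T0 _ hEle Q0 y1 y2 y3 y4 _ y6 main.
pose s := Num.sqrt r; have s0 : 0 <= s by exact: sqrtr_ge0.
(* All errors are brought to the first power of the cutoff, the worst that occurs; [K] is the sum of
   the resulting coefficients. *)
have chi2 : chi1 ^+ 2 <= r * chi1 by rewrite expr2 ler_wpM2r.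
have [k1 k2 k3] : [/\ 0 <= 8 * s, 0 <= (2 * p - 2) * r & 0 <= b0 * r].
  by split; rewrite ?mulr_ge0//; lra.
have b1 : `|E| + b0 * chi1 ^+ 2 * (Q * k) <=
    K * chi1 * (Q * (m * D) + Q * D ^+ 2 + Q * k).
  have t1 : 0 <= Q * (m * D) by rewrite !mulr_ge0.
  have t2 : 0 <= Q * D ^+ 2 by rewrite !mulr_ge0 ?sqr_ge0//.
  have t3 : 0 <= Q * k by rewrite !mulr_ge0// ltW.
  have : b0 * chi1 ^+ 2 * (Q * k) <= b0 * r * chi1 * (Q * k).
    by rewrite ler_wpM2r// -mulrA ler_wpM2l// ltW.
  have : (2 * p - 2) * chi1 ^+ 2 * (Q * D ^+ 2) <= (2 * p - 2) * r * chi1 * (Q * D ^+ 2).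
    by rewrite ler_wpM2r// -mulrA ler_wpM2l//; lra.
  have u1 := mulr_ge0 (mulr_ge0 k1 chi0) t2.
  have u2 := mulr_ge0 (mulr_ge0 k1 chi0) t3.
  have u3 := mulr_ge0 (mulr_ge0 k2 chi0) t1.
  have u4 := mulr_ge0 (mulr_ge0 k2 chi0) t3.
  have u5 := mulr_ge0 (mulr_ge0 k3 chi0) t1.
  have u6 := mulr_ge0 (mulr_ge0 k3 chi0) t2.
  by move: hEle u1 u2 u3 u4 u5 u6; rewrite KE -/s; lra.
(* Three uses of Young's inequality give 3 e M^p; passing from M^p to m^p + k^(p/2) costs the factor
   [T], and e <= 1 is used for the part with k^(p/2). *)
have b2 : Q * (m * D) + Q * D ^+ 2 + Q * k <= 3 * T * e * mp + (c1 + c2) * Dp + (3 * T + c2) * kp.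
  have : e * Mp <= e * (T * (mp + kp)) by rewrite ler_wpM2l// ltW.
  have : e * (T * kp) <= T * kp by rewrite ler_piMl// mulr_ge0.
  lra.
have Kc : 0 <= K * chi1 by rewrite mulr_ge0.
have b3 := ler_wpM2l Kc b2.
have b4 : K * chi1 * ((c1 + c2) * Dp) <= 2 * K * r * (c1 + c2) * Dp.
  have -> : 2 * K * r * (c1 + c2) * Dp = K * r * ((c1 + c2) * Dp) + K * r * ((c1 + c2) * Dp) by ring.
  have t : 0 <= (c1 + c2) * Dp by rewrite mulr_ge0// addr_ge0.
  rewrite -[leLHS]addr0 lerD//; last by rewrite !mulr_ge0 ?addr_ge0.
  by rewrite ler_wpM2r// ler_wpM2l.
have b5 : b0 * (chi1 ^+ 2 * mp) <= b0 * (chi1 ^+ 2 * Mp).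
  by rewrite ler_wpM2l ?(ltW b00)// ler_wpM2l// sqr_ge0.
lra.
Qed.

End commutator.

Section commutator_estimate.
Variables (R : realType) (n : nat).
Local Notation vec := 'rV[R]_n.

Lemma C1_with_powR_shift (u : vec -> R) u' (k q : R) : 0 < k -> (forall x, 0 <= u x) ->
  C1_with u u' ->
  C1_with (fun x => (u x + k) `^ q)
          (fun j x => q * (u x + k) `^ (q - 1) * u' j x).
Proof.
move=> k0 u0 hu; have uk x : 0 < u x + k by rewrite ltr_wpDl.
have huk := C1_withD hu (C1_with_cst n k).
apply: C1_with_ext (C1_with_comp (h := fun t => t `^ q)
  (h' := fun t => q * t `^ (q - 1)) huk _ _) => [x|j x|x|x].
- by [].
- by rewrite addr0.
- exact: is_derive1_powR.
- have cq : {for u x + k, continuous (fun t : R => t `^ (q - 1))}.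
    apply/differentiable_continuous/derivable1_diffP.
    by case: (is_derive1_powR (q - 1) (uk x)).
  exact: (cvgM (cvg_cst _) cq).
Qed.

(** Each of the two terms of the curl contributes 4 r t from the cutoff and p - 2 from the power of
    the modulus, and the cross term contributes 2: hence 8 r and 2 p - 2. *)
Lemma current_error_le (q r k p t y1 y2 z1 z2 J1 J2 w m D : R) :
  2 <= p -> 0 <= q -> 0 <= r -> 0 < k -> 0 <= t -> 0 <= m -> 0 <= D ->
  `|y1| <= 4 * r * t -> `|y2| <= 4 * r * t ->
  `|z1| <= m * D -> `|z2| <= m * D -> `|J1| <= m * D -> `|J2| <= m * D ->
  `|w| <= D * D ->
  `|(y1 * q + t ^+ 2 * ((p - 2) / 2 * (q / (m ^+ 2 + k)) * (2 * z1))) * J2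
    - (y2 * q + t ^+ 2 * ((p - 2) / 2 * (q / (m ^+ 2 + k)) * (2 * z2))) * J1
    + t ^+ 2 * q * (2 * w)| <=
  8 * r * t * (q * (m * D)) + (2 * p - 2) * t ^+ 2 * (q * D ^+ 2).
Proof.
move=> p2 q0 r0 k0 t0 m0 D0 hy1 hy2 hz1 hz2 hJ1 hJ2 hw.
have mD : 0 <= m * D by rewrite mulr_ge0.
have mk : 0 < m ^+ 2 + k by rewrite ltr_wpDl ?sqr_ge0.
have t2q : 0 <= t ^+ 2 * q by rewrite mulr_ge0 ?sqr_ge0.
have step (y z J : R) : `|y| <= 4 * r * t -> `|z| <= m * D -> `|J| <= m * D ->
    `|(y * q + t ^+ 2 * ((p - 2) / 2 * (q / (m ^+ 2 + k)) * (2 * z))) * J| <=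
    4 * r * t * (q * (m * D)) + (p - 2) * t ^+ 2 * (q * D ^+ 2).
  move=> hy hz hJ; rewrite mulrDl (le_trans (ler_normD _ _))// lerD//.
    rewrite -mulrA normrM ler_pM ?normr_ge0// normrM (ger0_norm q0) ler_wpM2l//.
  rewrite (_ : _ * J = (p - 2) * (t ^+ 2 * q) * ((z * J) / (m ^+ 2 + k)));
    last by field; rewrite gt_eqF.
  rewrite normrM ger0_norm; last by rewrite mulr_ge0// subr_ge0.
  rewrite [leRHS](_ : _ = (p - 2) * (t ^+ 2 * q) * D ^+ 2); last by ring.
  rewrite ler_wpM2l//; first by rewrite mulr_ge0// subr_ge0.
  rewrite normrM (ger0_norm (x := _^-1)) ?invr_ge0 ?(ltW mk)// ler_pdivrMr//.
  rewrite (@le_trans _ _ ((m * D) * (m * D)))//; first by rewrite normrM ler_pM.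
  rewrite (_ : m * D * (m * D) = D ^+ 2 * m ^+ 2); last by ring.
  (* The factor m^2 / (m^2 + k) is at most 1, so the bound is uniform in [k]. *)
  by rewrite ler_wpM2l ?sqr_ge0// lerDl ltW.
have s1 := step _ _ _ hy1 hz1 hJ2; have s2 := step _ _ _ hy2 hz2 hJ1.
have s3 : `|t ^+ 2 * q * (2 * w)| <= 2 * t ^+ 2 * (q * D ^+ 2).
  rewrite normrM (ger0_norm t2q) [leRHS](_ : _ = t ^+ 2 * q * (2 * (D * D))); last by ring.
  by rewrite ler_wpM2l// normrM normr_nat ler_wpM2l.
rewrite (le_trans (ler_normD _ _))//.
rewrite (le_trans (lerD (ler_normB _ _) s3))//.
by apply: le_trans (lerD (lerD s1 s2) (lexx _)) _; lra.
Qed.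

(* |u|^(p-2) is replaced by (|u|^2 + k)^((p-2)/2), which is C^1 also where u
   vanishes; the price is the last term, which tends to 0 with k. *)
Lemma commutator_estimate (p r b0 : R) (x0 : vec) (i j : 'I_n) (be : vec -> R) (eps : R) :
  2 <= p -> 0 < r -> 0 < b0 -> 0 < eps ->
  (forall x, dist2 x0 x < r -> b0 <= be x) ->
  exists2 C : R, 0 <= C & forall (A : vec -> vec) (a b : vec -> R),
    (forall k, of_class_C 1 (fun x => A x ord0 k)) ->
    of_class_C 2 a -> of_class_C 2 b -> bounded_support a -> bounded_support b ->
    (forall x, be x = partial i (fun y => A y ord0 j) x
                    - partial j (fun y => A y ord0 i) x) ->
  forall k, 0 < k -> exists2 h, exact_density h &
    forall x, tent r x0 x ^+ 2 * modulus a b x `^ p <= h x +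
      eps * (tent r x0 x * modulus a b x `^ p) +
      C * cov_norm A a b x `^ p + C * k `^ (p / 2) * tent r x0 x.
Proof.
move=> p2 r0 b00 eps0 hb.
pose K := 8 * Num.sqrt r + (2 * p - 2) * r + b0 * r.
have K0 : 0 <= K.
  by rewrite !addr_ge0// mulr_ge0 ?(ltW r0) ?(ltW b00)// ?sqrtr_ge0//; lra.
pose L := 3 * K * 2 `^ (p / 2).
have L0 : 0 <= L by rewrite !mulr_ge0// powR_ge0.
(* Makes the coefficient [L * e] of the first-power error at most [eps * b0], and keeps e <= 1 for
   Young's inequality. *)
pose e := Num.min 1 (eps * b0 / (L + 1)).
have e0 : 0 < e by rewrite lt_min ltr01 divr_gt0// ?mulr_gt0// ltr_wpDl.
have e1 : e <= 1 by rewrite ge_min lexx.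
have Le : L * e <= eps * b0.
  rewrite (@le_trans _ _ (L * (eps * b0 / (L + 1))))//.
    by rewrite ler_wpM2l// ge_min lexx orbT.
  rewrite mulrA ler_pdivrMr ?ltr_wpDl// mulrC mulrDr mulr1 lerDl.
  by rewrite mulr_ge0 ?(ltW eps0) ?(ltW b00).
pose C1 := 2 * K * r * (e `^ (1 - p) + e `^ (2 - p)).
pose C2 := K * (3 * 2 `^ (p / 2) + e `^ (2 - p)).
have C10 : 0 <= C1.
  by apply: mulr_ge0; [rewrite !mulr_ge0 ?(ltW r0)|rewrite addr_ge0 ?powR_ge0].
have C20 : 0 <= C2.
  by apply: mulr_ge0 => //; apply: addr_ge0; rewrite ?mulr_ge0 ?powR_ge0.
exists ((C1 + C2) / b0); first by rewrite divr_ge0 ?addr_ge0 ?(ltW b00).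
move=> A a b A1 a2 b2 sa sb hbe k k0.
have msq0 x : 0 <= a x ^+ 2 + b x ^+ 2 by rewrite addr_ge0// sqr_ge0.
pose q x := (a x ^+ 2 + b x ^+ 2 + k) `^ ((p - 2) / 2).
pose q' (l : 'I_n) x := (p - 2) / 2 * (a x ^+ 2 + b x ^+ 2 + k) `^ ((p - 2) / 2 - 1) *
  (2 * (a x * cov_re A a b l x + b x * cov_im A a b l x)).
have Cq : C1_with q q'.
  exact: (C1_with_powR_shift _ k0 msq0 (C1_with_msq A (of_class_C21 a2) (of_class_C21 b2))).
have Cpsi := C1_withM (C1_with_sqr_tent r x0) Cq.
have CG l := C1_withM Cpsi (C1_with_current A1 a2 b2 l).
have sG l : bounded_support (fun x => tent r x0 x ^+ 2 * q x * current A a b l x).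
  apply: bounded_supportMl; apply: bounded_supportMl.
  by apply: bounded_supportMl; exact: bounded_support_tent.
(* With psi = tent^2 (|u|^2 + k)^((p-2)/2), the density is d_i (psi J_j) - d_j (psi J_i), divided by
   [b0] to normalize the left-hand side. *)
have E1 := exact_density_partial i (CG j) (sG j).
have E2 := exact_density_partial j (CG i) (sG i).
have /(exact_densityZ b0^-1) Eh := exact_densityD E1 (exact_densityZ (- 1) E2).
eexists; first exact: Eh.
move=> x.
set m := modulus a b x; set D := cov_norm A a b x; set t := tent r x0 x.
have m0 : 0 <= m by exact: modulus_ge0.
have D0 : 0 <= D by exact: cov_norm_ge0.
have t0 : 0 <= t by exact: tent_ge0.
have m2 : a x ^+ 2 + b x ^+ 2 = m ^+ 2 by rewrite sqr_modulus.
have mk : 0 < m ^+ 2 + k by rewrite ltr_wpDl ?sqr_ge0.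
pose M := Num.sqrt (m ^+ 2 + k).
have qE : q x = M `^ (p - 2) by rewrite /q m2 /M sqrtr_powR// ltW.
have q'E l : q' l x = (p - 2) / 2 * (M `^ (p - 2) / (m ^+ 2 + k)) *
    (2 * (a x * cov_re A a b l x + b x * cov_im A a b l x)).
  by rewrite -qE /q' /q m2 powRB ?powRr1 ?(ltW mk)// (gt_eqF mk) implybT.
pose y (l : 'I_n) := 2 * t * - (2 * (x ord0 l - x0 ord0 l)).
pose z (l : 'I_n) := a x * cov_re A a b l x + b x * cov_im A a b l x.
pose J (l : 'I_n) := current A a b l x.
pose w := cov_re A a b i x * cov_im A a b j x - cov_im A a b i x * cov_re A a b j x.
pose E := (y i * q x + t ^+ 2 * ((p - 2) / 2 * (q x / (m ^+ 2 + k)) * (2 * z i))) * J j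
    - (y j * q x + t ^+ 2 * ((p - 2) / 2 * (q x / (m ^+ 2 + k)) * (2 * z j))) * J i
    + t ^+ 2 * q x * (2 * w).
have Ele : `|E| <= 8 * Num.sqrt r * t * (q x * (m * D)) +
    (2 * p - 2) * t ^+ 2 * (q x * D ^+ 2).
  apply: current_error_le => //; rewrite ?powR_ge0 ?sqrtr_ge0//.
  - exact: dtent_le (ltW r0).
  - exact: dtent_le (ltW r0).
  - exact: abs_re_le.
  - exact: abs_re_le.
  - exact: abs_im_le.
  - exact: abs_im_le.
  - exact: cross_le.
have curlE := curl_current A a2 b2 i j x.
rewrite -hbe m2 -/w in curlE.
set h := (X in b0^-1 * X).
have hE : h = E + t ^+ 2 * q x * (be x * m ^+ 2).
  rewrite /h q'E (q'E j) -/t -/(y i) -/(y j) -/(J i) -/(J j) -/(z i) -/(z j) -qE /E.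
  move: curlE; move: (dcurrent A a b j i x) (dcurrent A a b i j x) => u v uv.
  rewrite (_ : be x * m ^+ 2 = u - v - 2 * w); last by rewrite uv; ring.
  by ring.
have t_r : 0 <= t <= r by rewrite t0 tent_le// ltW.
have hb' : 0 < t -> b0 <= be x.
  by rewrite /t /tent lt_max ltxx orbF subr_gt0; exact: hb.
rewrite qE in hE Ele.
have := @commutator_real _ p e k r K b0 (be x) t m D h E p2 _ k0 (ltW r0) K0 t_r m0 D0 b00
  hb' erefl hE Ele.
rewrite e0 e1 => /(_ isT) main.
have Dp : 0 <= D `^ p by exact: powR_ge0.
have mp : 0 <= t * m `^ p by rewrite mulr_ge0// powR_ge0.
have kp : 0 <= k `^ (p / 2) * t by rewrite mulr_ge0// powR_ge0.
have u1 := ler_wpM2r mp Le.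
have u2 := mulr_ge0 C20 Dp; have u3 := mulr_ge0 C10 kp.
rewrite -(ler_pM2l b00) (le_trans main)//.
rewrite (_ : b0 * _ = h + eps * b0 * (t * m `^ p) + (C1 + C2) * D `^ p +
    (C1 + C2) * (k `^ (p / 2) * t)); last by field; rewrite gt_eqF.
rewrite -/L -/C1 -/C2 -(mulrA C2).
move: u1 u2 u3; move: (t * m `^ p) (D `^ p) (k `^ (p / 2) * t) => X Y Z.
lra.
Qed.

End commutator_estimate.

(** * The fields at infinity and at the origin *)

Section derivatives.
Variable R : realType.
Implicit Types (f g : R -> R) (s df dg : R).

Lemma is_derive_mul f g s df dg :
  is_derive s (1 : R) f df -> is_derive s (1 : R) g dg ->
  is_derive s (1 : R) (fun t => f t * g t) (df * g s + f s * dg).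
Proof. by move=> hf hg; apply: is_derive_eq; rewrite addrC mulrC. Qed.

Lemma is_derive_powR_comp f s df (q : R) : is_derive s (1 : R) f df -> 0 < f s ->
  is_derive s (1 : R) (fun t => f t `^ q) (q * f s `^ (q - 1) * df).
Proof.
move=> hf f0; have dq : is_derive (f s) (1 : R) (fun t => t `^ q) (q * f s `^ (q - 1)).
  exact: is_derive1_powR.
exact: (@is_derive1_comp _ (fun t => t `^ q) f).
Qed.

Lemma is_derive_ln_comp f s df : is_derive s (1 : R) f df -> 0 < f s ->
  is_derive s (1 : R) (fun t => ln (f t)) ((f s)^-1 * df).
Proof.
move=> hf f0; have dq : is_derive (f s) (1 : R) (@ln R) (f s)^-1 by exact: is_derive1_ln.
exact: (@is_derive1_comp _ (@ln R) f).
Qed.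

Lemma is_derive_addc (k s : R) : is_derive s (1 : R) (fun t => t + k) 1.
Proof. by apply: is_derive_eq; rewrite addr0. Qed.

Lemma is_derive_continuous f s df : is_derive s (1 : R) f df -> {for s, continuous f}.
Proof. by move=> [h _]; apply/differentiable_continuous/derivable1_diffP. Qed.

End derivatives.

Section field_at_infinity.
Variables (R : realType) (n : nat) (p eta : R).
Implicit Types s q : R.
Hypotheses (n2 : (2 <= n)%N) (np : n%:R <= p) (eta0 : 0 < eta).

(* In the critical case p = n a logarithm is needed; for p > n it must be absent. *)
Let crit : R := (p == n%:R)%:R.

Definition log_inf (s : R) := 1 + crit * (ln (s + eta) - ln eta).
Definition weight_inf (s : R) := (s + eta) `^ (- 2^-1) / log_inf s.
(** Without smoothing, x |x|^(-p) has divergence (n - p) |x|^(-p) <= 0, hence the minus sign. For p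
    = n this vanishes and the divergence comes from the logarithm alone. The weight is the one for
    which |F| <= w^(p-1). *)
Definition field_inf (s : R) := - ((s + eta) `^ (- (p / 2)) * log_inf s `^ (1 - p)).
Definition dfield_inf (s : R) :=
  - (- (p / 2) * (s + eta) `^ (- (p / 2) - 1) * log_inf s `^ (1 - p) +
     (s + eta) `^ (- (p / 2)) *
       ((1 - p) * log_inf s `^ (1 - p - 1) * (crit * (s + eta)^-1))).

Lemma shift_gt0 s : 0 <= s -> 0 < s + eta.
Proof. by move=> s0; rewrite ltr_wpDl. Qed.

Lemma crit01 : 0 <= crit <= 1.
Proof. by rewrite /crit; case: (_ == _); rewrite ?lexx ler01. Qed.

Lemma log_inf_ge1 s : 0 <= s -> 1 <= log_inf s.
Proof.
move=> s0; have /andP[c0 _] := crit01; rewrite lerDl mulr_ge0// subr_ge0.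
by rewrite ler_ln ?posrE ?shift_gt0// lerDr.
Qed.

Lemma log_inf_gt0 s : 0 <= s -> 0 < log_inf s.
Proof. by move=> s0; rewrite (lt_le_trans _ (log_inf_ge1 s0)). Qed.

Lemma is_derive_log_inf s : 0 <= s ->
  is_derive s (1 : R) log_inf (crit * (s + eta)^-1).
Proof.
move=> s0; have d := is_derive_ln_comp (is_derive_addc eta s) (shift_gt0 s0).
have h := is_deriveD (is_derive_cst (1 : R) s 1) (is_derive_mul
  (is_derive_cst crit s 1) (is_deriveB d (is_derive_cst (ln eta) s 1))).
by apply: (is_derive_eq h); rewrite add0r mul0r add0r subr0 mulr1.
Qed.

Lemma is_derive_field_inf s : 0 <= s ->
  is_derive s (1 : R) field_inf (dfield_inf s).
Proof.
move=> s0; apply: is_deriveN; apply: is_derive_mul.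
  have := is_derive_powR_comp (- (p / 2)) (is_derive_addc eta s) (shift_gt0 s0).
  by rewrite mulr1.
exact: is_derive_powR_comp (is_derive_log_inf s0) (log_inf_gt0 s0).
Qed.

Lemma continuous_dfield_inf s : 0 <= s -> {for s, continuous dfield_inf}.
Proof.
move=> s0.
have c1 q := is_derive_continuous
  (is_derive_powR_comp q (is_derive_addc eta s) (shift_gt0 s0)).
have c2 q := is_derive_continuous
  (is_derive_powR_comp q (is_derive_log_inf s0) (log_inf_gt0 s0)).
have c3 : {for s, continuous (fun t => (t + eta)^-1)}.
  apply: continuousV; first by rewrite gt_eqF// shift_gt0.
  exact: is_derive_continuous (is_derive_addc eta s).
apply: cvgN; apply: cvgD.
  exact: (cvgM (cvgM (cvg_cst _) (c1 _)) (c2 _)).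
exact: (cvgM (c1 _) (cvgM (cvgM (cvg_cst _) (c2 _)) (cvgM (cvg_cst _) c3))).
Qed.

Lemma weight_inf_gt0 s : 0 <= s -> 0 < weight_inf s.
Proof. by move=> s0; rewrite divr_gt0 ?powR_gt0 ?shift_gt0 ?log_inf_gt0. Qed.

Lemma weight_inf_powR s q : 0 <= s ->
  weight_inf s `^ q = (s + eta) `^ (- (q / 2)) * log_inf s `^ (- q).
Proof.
move=> s0; rewrite powRM ?powR_ge0 ?invr_ge0 ?(ltW (log_inf_gt0 s0))//.
rewrite -powRrM -(powR_inv1 (ltW (log_inf_gt0 s0))) -powRrM.
by congr (_ `^ _ * _ `^ _); [field|rewrite mulN1r].
Qed.

Lemma sqrt_field_inf_le s : 0 <= s ->
  Num.sqrt s * `|field_inf s| <= 1 * weight_inf s `^ (p - 1).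
Proof.
move=> s0; rewrite weight_inf_powR// mul1r /field_inf normrN opprB.
rewrite ger0_norm ?mulr_ge0 ?powR_ge0// mulrA ler_wpM2r ?powR_ge0//.
rewrite (_ : - ((p - 1) / 2) = 2^-1 + - (p / 2)); last by field.
rewrite powRD ?(gt_eqF (shift_gt0 s0)) ?implybT//.
rewrite ler_wpM2r ?powR_ge0// powR12_sqrt ?(ltW (shift_gt0 s0))//.
by rewrite ler_wsqrtr// lerDl ltW.
Qed.

(** For eta / (s + eta) = 0 the bracket is (p - n) [log_inf] + 2 (p - 1) [crit], which is positive;
    at s = 0 it equals - n. The sign thus depends on the ratio of [s] to [eta]. *)
Lemma div_field_infE s : 0 <= s ->
  n%:R * field_inf s + 2 * s * dfield_inf s = weight_inf s `^ p *
   ((p - n%:R) * log_inf s - p * (log_inf s * (eta / (s + eta))) +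
    2 * (p - 1) * crit * (1 - eta / (s + eta))).
Proof.
move=> s0; have se := shift_gt0 s0; have l0 := log_inf_gt0 s0.
rewrite weight_inf_powR// /field_inf /dfield_inf.
have -> : (s + eta) `^ (- (p / 2) - 1) = (s + eta) `^ (- (p / 2)) / (s + eta).
  by rewrite powRB ?(gt_eqF se) ?implybT// powRr1// ltW.
have -> : log_inf s `^ (1 - p - 1) = log_inf s `^ (- p) by congr (_ `^ _); ring.
have -> : log_inf s `^ (1 - p) = log_inf s * log_inf s `^ (- p).
  by rewrite powRD ?(gt_eqF l0) ?implybT// powRr1// ltW.
by field; rewrite gt_eqF.
Qed.

Lemma crit_gt0 : 0 < (p - n%:R) + 2 * (p - 1) * crit.
Proof.
have n2' : 2 <= n%:R :> R by rewrite ler_nat.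
move: np; rewrite le_eqVlt /crit => /predU1P[<-|npl].
  by rewrite eqxx/=; lra.
by rewrite gt_eqF//=; lra.
Qed.

Lemma div_field_inf_ge s : 0 <= s ->
  weight_inf s `^ p * ((p - n%:R) + 2 * (p - 1) * crit
    - 5 * p * Num.sqrt (eta / (s + eta))) <=
  n%:R * field_inf s + 2 * s * dfield_inf s.
Proof.
move=> s0; rewrite div_field_infE// ler_wpM2l ?powR_ge0//.
have se := shift_gt0 s0; have l1 := log_inf_ge1 s0.
have q0 : 0 < eta / (s + eta) by rewrite divr_gt0.
set th := Num.sqrt _; have th0 : 0 < th by rewrite sqrtr_gt0.
have th2 : eta / (s + eta) = th ^+ 2 by rewrite sqr_sqrtr// ltW.
have th1 : th <= 1.
  rewrite -sqrtr1 ler_wsqrtr// ler_pdivrMr// mul1r lerDr//.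
have lth : log_inf s * th <= 3.
  have /andP[c0 c1] := crit01.
  (* Since (s + eta) / eta is the square of [th^-1], the bound ln y < y gives [log_inf] <= 1 + 2 /
     th, so that [log_inf] th^2 is only of order th. *)
  have lnE : ln (s + eta) - ln eta = 2 * ln th^-1.
    rewrite -ln_div ?posrE// -(invf_div eta) th2 -exprVn lnXn ?invr_gt0//.
    by rewrite mulr_natl.
  have := ln_sublinear (x := th^-1); rewrite invr_gt0 th0 => /(_ isT) lns.
  have ln0 : 0 <= ln th^-1 by rewrite ln_ge0// invf_ge1.
  have : log_inf s <= 1 + 2 * th^-1.
    rewrite /log_inf lnE lerD2l (@le_trans _ _ (1 * (2 * ln th^-1)))//.
      by rewrite ler_wpM2r// mulr_ge0.
    by rewrite mul1r ler_wpM2l// ltW.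
  move=> /(ler_wpM2r (ltW th0))/le_trans; apply.
  by rewrite mulrDl mul1r mulfVK ?gt_eqF//; lra.
have /andP[c0 c1] := crit01; rewrite th2.
have n2' : 2 <= n%:R :> R by rewrite ler_nat.
have p2 : 2 <= p := le_trans n2' np.
have p0 : 0 <= p by lra.
(* The errors 3 p th and 2 (p - 1) th add up to at most 5 p th. *)
have h1 : p * (log_inf s * th ^+ 2) <= 3 * p * th.
  rewrite expr2 [log_inf s * _]mulrA mulrA mulrC [leRHS]mulrC ler_wpM2l ?(ltW th0)//.
  by rewrite [leRHS]mulrC ler_wpM2l.
have hc : crit * th ^+ 2 <= th.
  by rewrite expr2 mulrA ler_piMl ?(ltW th0)// mulr_ile1// ltW.
have p10 : 0 <= 2 * (p - 1) by lra.
have h2 := ler_wpM2l p10 hc.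
have h3 : (p - n%:R) * 1 <= (p - n%:R) * log_inf s by rewrite ler_wpM2l// subr_ge0.
lra.
Qed.

Lemma weight_inf_powR_le s : 0 <= s -> weight_inf s `^ p <= eta `^ (- (p / 2)).
Proof.
move=> s0; have n2' : 2 <= n%:R :> R by rewrite ler_nat.
have p2 : 2 <= p := le_trans n2' np.
rewrite weight_inf_powR// -[leRHS]mulr1 ler_pM ?powR_ge0//.
  rewrite !powRN lef_pV2 ?posrE ?powR_gt0 ?shift_gt0//.
  rewrite ge0_ler_powR ?nnegrE ?(ltW eta0) ?(ltW (shift_gt0 s0)) ?lerDr//.
  by rewrite divr_ge0//; lra.
rewrite powRN invf_le1 ?powR_gt0 ?log_inf_gt0// -(powRr0 (log_inf s)).
by rewrite ler_powR ?log_inf_ge1//; lra.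
Qed.

End field_at_infinity.

Lemma exists_field_inf (R : realType) (n : nat) (p r : R) :
  (2 <= n)%N -> n%:R <= p -> 0 < r ->
  exists eta c V0 : R, [/\ 0 < eta, 0 < c, 0 <= V0 & forall s, 0 <= s ->
    c * weight_inf n p eta s `^ p - V0 * Num.max (r - s) 0 ^+ 2 <=
    n%:R * field_inf n p eta s + 2 * s * dfield_inf n p eta s].
Proof.
move=> n2 np r0; set c1 := (p - n%:R) + 2 * (p - 1) * (p == n%:R)%:R.
have c10 : 0 < c1 by exact: crit_gt0.
have n2' : 2 <= n%:R :> R by rewrite ler_nat.
have p2 : 2 <= p := le_trans n2' np.
have p0 : 0 < p by lra.
(* For s >= r / 2 this gives sqrt (eta / (s + eta)) <= c1 / (10 p), so that the error 5 p th is at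
   most c1 / 2. *)
pose eta := r / 2 * (c1 / (10 * p)) ^+ 2.
have eta0 : 0 < eta by rewrite mulr_gt0 ?exprn_gt0 ?divr_gt0// mulr_gt0.
(* For s < r / 2 the error is at most 5 p w^p <= 5 p eta^(-p/2), while the squared tent is at least
   r^2 / 4: [V0] is the quotient of the two. *)
exists eta, (c1 / 2), (5 * p * eta `^ (- (p / 2)) * (4 / r ^+ 2)); split => //.
- by rewrite divr_gt0.
- by rewrite !mulr_ge0 ?powR_ge0 ?invr_ge0 ?sqr_ge0// ltW.
move=> s s0; apply: le_trans (div_field_inf_ge n2 np eta0 s0).
rewrite -/c1; set W := weight_inf _ _ _ _ `^ p; set th := Num.sqrt _.
have W0 : 0 <= W by exact: powR_ge0.
have We : W <= eta `^ (- (p / 2)) by exact: weight_inf_powR_le.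
have th1 : th <= 1.
  by rewrite -sqrtr1 ler_wsqrtr// ler_pdivrMr ?mul1r ?lerDr// ltr_wpDl.
have [sr|sr] := ltP s (r / 2).
  have rs : (r / 2) ^+ 2 <= Num.max (r - s) 0 ^+ 2.
    rewrite lerXn2r ?nnegrE ?divr_ge0 ?(ltW r0)// ?le_max ?lexx ?orbT//.
    by apply/orP; left; lra.
  have h1 : 5 * p * W <= 5 * p * eta `^ (- (p / 2)) * (4 / r ^+ 2) * Num.max (r - s) 0 ^+ 2.
    rewrite -[leRHS]mulrA (@le_trans _ _ (5 * p * eta `^ (- (p / 2)) * 1))//.
      by rewrite mulr1 ler_wpM2l// mulr_ge0// ltW.
    rewrite ler_wpM2l ?mulr_ge0 ?powR_ge0 ?(ltW p0)//.
    rewrite [leLHS](_ : 1 = 4 / r ^+ 2 * (r / 2) ^+ 2); last by field; rewrite gt_eqF.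
    by rewrite ler_wpM2l// divr_ge0// sqr_ge0.
  have h2 : 5 * p * th * W <= 5 * p * W.
    by rewrite ler_wpM2r// ler_piMr// mulr_ge0// ltW.
  have h3 : 0 <= c1 * W by rewrite mulr_ge0// ltW.
  lra.
have h : 5 * p * th <= c1 / 2.
  suff : th <= c1 / (10 * p).
    move=> /(ler_wpM2l (x := 5 * p)) h; apply: le_trans (h _) _; first by rewrite mulr_ge0// ltW.
    by rewrite le_eqVlt; apply/orP; left; apply/eqP; field; rewrite gt_eqF.
  rewrite -[leRHS]ger0_norm ?divr_ge0 ?mulr_ge0 ?(ltW c10) ?(ltW p0)// -sqrtr_sqr.
  rewrite ler_wsqrtr// ler_pdivrMr ?ltr_wpDl// {1}/eta mulrC.
  by rewrite ler_wpM2l ?sqr_ge0// (le_trans sr)// lerDl ltW.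
have h2 : 5 * p * th * W <= c1 / 2 * W by rewrite ler_wpM2r.
have h3 : 0 <= 5 * p * eta `^ (- (p / 2)) * (4 / r ^+ 2) * Num.max (r - s) 0 ^+ 2.
  apply: mulr_ge0; last exact: sqr_ge0.
  by rewrite !mulr_ge0 ?powR_ge0 ?invr_ge0 ?sqr_ge0// ltW.
lra.
Qed.

(** * The smoothed field at the origin *)

Section field_at_origin.
Variables (R : realType) (n : nat) (p eta : R).
Implicit Types s q : R.
Hypotheses (n2 : (2 <= n)%N) (np : n%:R <= p) (eta0 : 0 < eta) (eta1 : eta <= 1).

(** Comparable to - ln (s + eta) near 0, yet at least 1 for every s >= 0, so that its powers never
    degenerate. *)
Definition log_zero s := 1 + (ln (s + (eta + 1)) - ln (s + eta)).
(** The exponent [n] puts the factor s^n into s [dcutoff s]; it cancels the singularity (s +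
    eta)^(-n/2) of the core, and the derivative of the cutoff contributes a bounded potential,
    uniformly in [eta]. *)
Definition cutoff s := sqr_pos (1 - s ^+ n).
Definition dcutoff s := 2 * Num.max (1 - s ^+ n) 0 * (- (n%:R * s ^+ n.-1)).
Definition weight_zero s :=
  cutoff s `^ p^-1 * (s + eta) `^ (- (n%:R / (2 * p))) / log_zero s.
Definition core_zero s := (s + eta) `^ (- (n%:R / 2)) * log_zero s `^ (1 - p).
Definition dcore_zero s :=
  - (n%:R / 2) * (s + eta) `^ (- (n%:R / 2) - 1) * log_zero s `^ (1 - p) +
  (s + eta) `^ (- (n%:R / 2)) *
    ((1 - p) * log_zero s `^ (1 - p - 1) * ((s + (eta + 1))^-1 - (s + eta)^-1)).
Definition field_zero s := cutoff s * core_zero s.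
Definition dfield_zero s := dcutoff s * core_zero s + cutoff s * dcore_zero s.

Let p2 : 2 <= p.
Proof. by apply: le_trans np; rewrite ler_nat. Qed.

Let shift1_gt0 s : 0 <= s -> 0 < s + (eta + 1).
Proof. by move=> s0; rewrite ltr_wpDl// addr_gt0. Qed.

Let sh0 s (s0 : 0 <= s) := shift_gt0 eta0 s0.

Lemma log_zero_ge1 s : 0 <= s -> 1 <= log_zero s.
Proof.
move=> s0; rewrite lerDl subr_ge0 ler_ln ?posrE ?sh0 ?shift1_gt0//.
by rewrite lerD2l lerDl.
Qed.

Lemma log_zero_gt0 s : 0 <= s -> 0 < log_zero s.
Proof. by move=> s0; rewrite (lt_le_trans _ (log_zero_ge1 s0)). Qed.

Lemma cutoff_ge0 s : 0 <= cutoff s. Proof. exact: sqr_ge0. Qed.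

Lemma cutoff_le1 s : 0 <= s -> cutoff s <= 1.
Proof.
move=> s0; rewrite expr_le1//; last by rewrite le_max lexx orbT.
by rewrite ge_max ler01 andbT lerBlDr lerDl exprn_ge0.
Qed.

Lemma core_zero_ge0 s : 0 <= core_zero s.
Proof. by rewrite mulr_ge0 ?powR_ge0. Qed.

Lemma is_derive_log_zero s : 0 <= s ->
  is_derive s (1 : R) log_zero ((s + (eta + 1))^-1 - (s + eta)^-1).
Proof.
move=> s0; have d1 := is_derive_ln_comp (is_derive_addc eta s) (sh0 s0).
have d2 := is_derive_ln_comp (is_derive_addc (eta + 1) s) (shift1_gt0 s0).
have h := is_deriveD (is_derive_cst (1 : R) s 1) (is_deriveB d2 d1).
by apply: (is_derive_eq h); rewrite add0r !mulr1.
Qed.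

Lemma is_derive_cutoff s : is_derive s (1 : R) cutoff (dcutoff s).
Proof.
have dX : is_derive s (1 : R) (fun t => 1 - t ^+ n) (- (n%:R * s ^+ n.-1)).
  have h := is_deriveB (is_derive_cst (1 : R) s 1) (is_deriveX n (is_derive_id s (1 : R))).
  have -> : (fun t : R => 1 - t ^+ n) = cst 1 - id ^+ n.
    by apply/funext => t; rewrite !fctE.
  by apply: (is_derive_eq h); rewrite sub0r -[_ *: 1]/(_ * 1) mulr1.
exact: (@is_derive1_comp _ (@sqr_pos R) (fun t => 1 - t ^+ n) s _ _
  (is_derive_sqr_pos (1 - s ^+ n)) dX).
Qed.

Lemma is_derive_field_zero s : 0 <= s ->
  is_derive s (1 : R) field_zero (dfield_zero s).
Proof.
move=> s0; apply: is_derive_mul; first exact: is_derive_cutoff.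
apply: is_derive_mul.
  have := is_derive_powR_comp (- (n%:R / 2)) (is_derive_addc eta s) (sh0 s0).
  by rewrite mulr1.
exact: is_derive_powR_comp (is_derive_log_zero s0) (log_zero_gt0 s0).
Qed.

Lemma continuous_dfield_zero s : 0 <= s -> {for s, continuous dfield_zero}.
Proof.
move=> s0.
have c1 q := is_derive_continuous
  (is_derive_powR_comp q (is_derive_addc eta s) (sh0 s0)).
have c2 q := is_derive_continuous
  (is_derive_powR_comp q (is_derive_log_zero s0) (log_zero_gt0 s0)).
have c3 (k : R) : 0 < s + k -> {for s, continuous (fun t => (t + k)^-1)}.
  move=> sk; apply: continuousV; first by rewrite gt_eqF.
  exact: is_derive_continuous (is_derive_addc k s).
have cX m : {for s, continuous (fun t : R => t ^+ m)} by exact: exprn_continuous.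
have cm : {for s, continuous (fun t : R => Num.max (1 - t ^+ n) 0)}.
  apply: (@continuous_comp _ _ _ (fun t : R => 1 - t ^+ n) (fun t : R => Num.max t 0)).
    exact: (cvgB (cvg_cst _) (cX n)).
  exact: continuous_maxr0.
have ccore : {for s, continuous core_zero} by exact: (cvgM (c1 _) (c2 _)).
have ccut := is_derive_continuous (is_derive_cutoff s).
have cdcut : {for s, continuous dcutoff}.
  exact: (cvgM (cvgM (cvg_cst _) cm) (cvgN (cvgM (cvg_cst _) (cX _)))).
have cinv : {for s, continuous (fun t : R => (t + (eta + 1))^-1 - (t + eta)^-1)}.
  exact: (cvgB (c3 _ (shift1_gt0 s0)) (c3 _ (sh0 s0))).
have cdcore : {for s, continuous dcore_zero}.
  apply: cvgD; first exact: (cvgM (cvgM (cvg_cst _) (c1 _)) (c2 _)).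
  exact: (cvgM (c1 _) (cvgM (cvgM (cvg_cst _) (c2 _)) cinv)).
exact: (cvgD (cvgM cdcut ccore) (cvgM ccut cdcore)).
Qed.

Lemma weight_zero_ge0 s : 0 <= s -> 0 <= weight_zero s.
Proof.
by move=> s0; rewrite !mulr_ge0 ?powR_ge0// invr_ge0 ltW// log_zero_gt0.
Qed.

Lemma weight_zero_powR s q : 0 <= s -> weight_zero s `^ q =
  cutoff s `^ (q / p) * (s + eta) `^ (- (n%:R * q / (2 * p))) * log_zero s `^ (- q).
Proof.
move=> s0; have l0 := log_zero_gt0 s0; have p0 : 0 < p := lt_le_trans (ltr0Sn _ _) p2.
rewrite powRM ?mulr_ge0 ?powR_ge0 ?invr_ge0 ?(ltW l0)//.
rewrite powRM ?powR_ge0// -(powR_inv1 (ltW l0)) -!powRrM mulN1r.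
by congr (_ `^ _ * _ `^ _ * _); field; rewrite gt_eqF.
Qed.

Lemma weight_zero_powRp s : 0 <= s -> weight_zero s `^ p =
  cutoff s * ((s + eta) `^ (- (n%:R / 2)) * log_zero s `^ (- p)).
Proof.
move=> s0; have p0 : p != 0 := lt0r_neq0 (lt_le_trans (ltr0Sn _ _) p2).
rewrite weight_zero_powR// mulfV// powRr1 ?cutoff_ge0// mulrA.
by congr (_ * _ `^ _ * _); field.
Qed.

(** Up to cutoff and logarithm, |F| / w^(p-1) is at most (s + eta)^(1/2 - n/(2p)). The exponent is
    nonnegative because n <= p, and s + eta <= 2 on the support, whence the constant 2. *)
Lemma sqrt_field_zero_le s : 0 <= s ->
  Num.sqrt s * `|field_zero s| <= 2 * weight_zero s `^ (p - 1).
Proof.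
move=> s0; have se := sh0 s0; have p0 : 0 < p := lt_le_trans (ltr0Sn _ _) p2.
rewrite /field_zero (ger0_norm (mulr_ge0 (cutoff_ge0 s) (core_zero_ge0 s))) /core_zero.
have [s1|s1] := ltP s 1; last first.
  have -> : cutoff s = 0.
    by rewrite /cutoff /sqr_pos max_r ?expr0n// subr_le0 exprn_ege1.
  by rewrite mul0r mulr0 mulr_ge0// powR_ge0.
rewrite weight_zero_powR// opprB.
have h1 : cutoff s <= cutoff s `^ ((p - 1) / p).
  have := cutoff_ge0 s; rewrite le_eqVlt => /predU1P[<-|c0]; first exact: powR_ge0.
  apply: ger1_powR; first by rewrite c0 cutoff_le1.
  by rewrite ler_pdivrMr// mul1r gerBl.
have h2 : Num.sqrt s * (s + eta) `^ (- (n%:R / 2)) <=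
    2 * (s + eta) `^ (- (n%:R * (p - 1) / (2 * p))).
  have -> : - (n%:R / 2) = - (n%:R / (2 * p)) + - (n%:R * (p - 1) / (2 * p)) :> R.
    by field; rewrite gt_eqF.
  rewrite powRD ?(gt_eqF se) ?implybT// mulrA ler_wpM2r ?powR_ge0//.
  have sq : Num.sqrt s <= (s + eta) `^ 2^-1.
    by rewrite powR12_sqrt ?(ltW se)// ler_wsqrtr// lerDl ltW.
  apply: le_trans (ler_wpM2r (powR_ge0 _ _) sq) _.
  rewrite -powRD ?(gt_eqF se) ?implybT//.
  set al := 2^-1 + _.
  have al0 : 0 <= al.
    by rewrite /al subr_ge0 ler_pdivrMr ?mulr_gt0// mulrA mulVf ?mul1r//.
  have al1 : al <= 1.
    have : 0 <= n%:R / (2 * p) by rewrite divr_ge0// mulr_ge0// ltW.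
    by rewrite /al; lra.
  rewrite (@le_trans _ _ (2 `^ al))//.
    by rewrite ge0_ler_powR ?nnegrE ?(ltW se)//; have := eta1; lra.
  by rewrite -[leRHS]powRr1// ler_powR// ler1n.
rewrite [leLHS](_ : _ = cutoff s *
  (Num.sqrt s * (s + eta) `^ (- (n%:R / 2)) * log_zero s `^ (1 - p))); last by ring.
rewrite [leRHS](_ : _ = cutoff s `^ ((p - 1) / p) *
  (2 * (s + eta) `^ (- (n%:R * (p - 1) / (2 * p))) * log_zero s `^ (1 - p))); last by ring.
apply: ler_pM => //; first exact: cutoff_ge0.
  by rewrite !mulr_ge0 ?sqrtr_ge0 ?powR_ge0.
by rewrite ler_wpM2r ?powR_ge0.
Qed.

Lemma div_field_zeroE s : 0 <= s ->
  n%:R * field_zero s + 2 * s * dfield_zero s =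
  cutoff s * ((s + eta) `^ (- (n%:R / 2)) * log_zero s `^ (- p)) *
    (n%:R * log_zero s * (eta / (s + eta)) +
     2 * (p - 1) * (s / (s + eta)) / (s + (eta + 1)))
  + 2 * s * dcutoff s * core_zero s.
Proof.
move=> s0; have se := sh0 s0; have l0 := log_zero_gt0 s0; have se1 := shift1_gt0 s0.
rewrite /field_zero /dfield_zero /core_zero /dcore_zero.
have -> : (s + eta) `^ (- (n%:R / 2) - 1) = (s + eta) `^ (- (n%:R / 2)) / (s + eta).
  by rewrite powRB ?(gt_eqF se) ?implybT// powRr1// ltW.
have -> : log_zero s `^ (1 - p - 1) = log_zero s `^ (- p) by congr (_ `^ _); ring.
have -> : log_zero s `^ (1 - p) = log_zero s * log_zero s `^ (- p).
  by rewrite powRD ?(gt_eqF l0) ?implybT// powRr1// ltW.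
by field; rewrite !gt_eqF.
Qed.

Lemma div_field_zero_ge s : 0 <= s ->
  2 / 3 * weight_zero s `^ p - 4 * n%:R * Num.max (1 - s ^+ n) 0 <=
  n%:R * field_zero s + 2 * s * dfield_zero s.
Proof.
move=> s0; have se := sh0 s0; have l1 := log_zero_ge1 s0; have se1 := shift1_gt0 s0.
rewrite div_field_zeroE// weight_zero_powRp//.
have [s1|s1] := ltP s 1; last first.
  have m0 : Num.max (1 - s ^+ n) 0 = 0 by rewrite max_r// subr_le0 exprn_ege1.
  by rewrite /cutoff /dcutoff /sqr_pos m0 expr0n/= !(mul0r, mulr0) subr0 addr0.
set W := cutoff s * _; have W0 : 0 <= W.
  by apply: mulr_ge0; [exact: cutoff_ge0|rewrite mulr_ge0 ?powR_ge0].
have n2' : 2 <= n%:R :> R by rewrite ler_nat.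
(* The fractions eta / (s + eta) and s / (s + eta) sum to 1. Their coefficients are at least 2 and 2
   (p - 1) / 3 >= 2 / 3, because s + eta + 1 <= 3 on the support. *)
have h1 : 2 / 3 <= n%:R * log_zero s * (eta / (s + eta)) +
     2 * (p - 1) * (s / (s + eta)) / (s + (eta + 1)).
  have e0 : 0 <= eta / (s + eta) by rewrite divr_ge0// ltW.
  have s'0 : 0 <= s / (s + eta) by rewrite divr_ge0// ltW.
  have es : eta / (s + eta) + s / (s + eta) = 1 by field; rewrite gt_eqF.
  have g1 : 2 / 3 * (eta / (s + eta)) <= n%:R * log_zero s * (eta / (s + eta)).
    rewrite ler_wpM2r// (@le_trans _ _ (2 * 1))//; first by lra.
    by rewrite ler_pM.
  have g2 : 2 / 3 * (s / (s + eta)) <= 2 * (p - 1) * (s / (s + eta)) / (s + (eta + 1)).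
    rewrite ler_pdivlMr// mulrAC ler_wpM2r//.
    have se3 : s + (eta + 1) <= 3 by have := eta1; lra.
    have := p2; lra.
  by have := lerD g1 g2; rewrite -mulrDr es mulr1.
have h2 : - (4 * n%:R * Num.max (1 - s ^+ n) 0) <= 2 * s * dcutoff s * core_zero s.
  set mx := Num.max _ _; have mx0 : 0 <= mx by rewrite le_max lexx orbT.
  have -> : 2 * s * dcutoff s * core_zero s = - (4 * n%:R * mx * (s ^+ n * core_zero s)).
    have -> : s ^+ n = s * s ^+ n.-1 by rewrite -exprS prednK// (ltn_trans _ n2).
    by rewrite /dcutoff -/mx; ring.
  rewrite lerN2 -[leRHS]mulr1 ler_wpM2l ?mulr_ge0//.
  have lp : log_zero s `^ (1 - p) <= 1.
    by rewrite -[leRHS](powRr0 (log_zero s)) ler_powR//; have := p2; lra.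
  have sn : s ^+ n <= (s + eta) `^ (n%:R / 2).
    rewrite (@le_trans _ _ (s `^ (n%:R / 2)))//.
      rewrite -powR_mulrn//; move: s0; rewrite le_eqVlt => /predU1P[<-|s'0].
        by rewrite powR0 ?powR_ge0// pnatr_eq0 -lt0n (ltn_trans _ n2).
      by rewrite ger_powR ?s'0 ?ltW//; lra.
    apply: ge0_ler_powR; rewrite ?nnegrE ?divr_ge0 ?(ltW se)//.
    by rewrite lerDl ltW.
  rewrite -[leRHS]mulr1 /core_zero mulrA ler_pM ?mulr_ge0 ?exprn_ge0 ?powR_ge0//.
  by rewrite powRN ler_pdivrMr ?powR_gt0// mul1r.
have := ler_wpM2l W0 h1; rewrite [W * (2 / 3)]mulrC; lra.
Qed.

Lemma weight_zero_powR_le s : 0 <= s -> weight_zero s `^ p <= eta `^ (- (n%:R / 2)).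
Proof.
move=> s0; rewrite weight_zero_powRp// -[leRHS]mul1r.
apply: ler_pM; [exact: cutoff_ge0|by rewrite mulr_ge0 ?powR_ge0|exact: cutoff_le1|].
rewrite -[leRHS]mulr1 ler_pM ?powR_ge0//.
  rewrite !powRN lef_pV2 ?posrE ?powR_gt0 ?sh0//.
  by rewrite ge0_ler_powR ?nnegrE ?(ltW eta0) ?(ltW (sh0 s0)) ?lerDr// divr_ge0.
rewrite powRN invf_le1 ?powR_gt0 ?log_zero_gt0// -[leLHS](powRr0 (log_zero s)).
by rewrite ler_powR ?log_zero_ge1//; have := p2; lra.
Qed.

End field_at_origin.

(** * Comparison with the Hardy weight *)

Section weight_comparison.
Variables (R : realType) (n : nat) (p : R).
Local Notation vec := 'rV[R]_n.
Hypotheses (n2 : (2 <= n)%N) (np : n%:R <= p).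

Let p2 : 2 <= p.
Proof. by apply: le_trans np; rewrite ler_nat. Qed.

Let p0 : 0 < p := lt_le_trans (ltr0Sn _ _) p2.

Lemma sqr_eucl_norm (x : vec) : eucl_norm x ^+ 2 = dist2 0 x.
Proof.
rewrite sqr_sqrtr; last by apply: sumr_ge0 => j _; exact: sqr_ge0.
by apply: eq_bigr => j _; rewrite mxE subr0.
Qed.

Lemma eucl_norm_ge0 (x : vec) : 0 <= eucl_norm x. Proof. exact: sqrtr_ge0. Qed.

Lemma dist2_le (c x : vec) : dist2 c x <= 2 * dist2 0 x + 2 * dist2 0 c.
Proof.
rewrite /dist2 !mulr_sumr -big_split/=; apply: ler_sum => j _.
rewrite mxE !subr0; have := sqr_ge0 (x ord0 j + c ord0 j); lra.
Qed.

(** For eta <= s the smoothing is harmless, as s + eta <= 2 s. For s < 1/2 the logarithm stays away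
    from 0 and dominates the additive constants of [log_zero]. *)
Lemma hardy_weight_le_zero : exists2 K : R, 0 < K & forall (eta : R) (x : vec),
  0 < eta <= 1 -> eta <= dist2 0 x -> dist2 0 x < 2^-1 ->
  hardy_weight p x <= K * weight_zero n p eta (dist2 0 x) `^ p.
Proof.
have ln2 : 0 < ln 2 :> R by rewrite ln_gt0// ltr1n.
(* Comes from [log_zero] <= 3 - ln s = 3 + 2 |ln |x||, with 3 <= (6 / ln 2) |ln |x|| because |ln
   |x|| >= (ln 2) / 2. *)
pose k := 6 / ln 2 + 2 : R; have k0 : 0 < k by rewrite addr_gt0// divr_gt0.
exists (k `^ p * (2 `^ (n%:R / 2) * 4)).
  by rewrite !mulr_gt0 ?powR_gt0.
move=> eta x /andP[eta0 eta1]; set s := dist2 0 x => es s12.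
have s0 : 0 < s by rewrite (lt_le_trans eta0).
set r := eucl_norm x; have r0 : 0 < r.
  by rewrite lt_def eucl_norm_ge0 andbT -sqrf_eq0 sqr_eucl_norm gt_eqF.
have rs : r ^+ 2 = s by exact: sqr_eucl_norm.
have lnr : `|ln r| = - (2^-1 * ln s).
  have -> : ln s = 2 * ln r by rewrite -rs lnXn// mulr_natl.
  rewrite mulrA mulVf ?mul1r// ltr0_norm//.
  by rewrite ln_lt0// r0/= -(ltr_pXn2r (n := 2)) ?nnegrE ?(ltW r0)// expr1n rs; lra.
have lns : ln 2 <= - ln s.
  rewrite -lnV ?posrE// ler_ln ?posrE ?invr_gt0//.
  by rewrite -[leLHS]invrK lef_pV2 ?posrE ?invr_gt0// ltW.
have lr0 : 0 < `|ln r| by rewrite lnr; lra.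
rewrite weight_zero_powRp ?(ltW s0)//.
have cut : 4^-1 <= cutoff n s.
  have sn : s ^+ n <= 2^-1.
    rewrite (@le_trans _ _ (s ^+ 1))//; last by rewrite expr1 ltW.
    by rewrite ler_wiXn2l ?(ltW s0)//; [lra|rewrite (ltn_trans _ n2)].
  rewrite /cutoff /sqr_pos max_l; last by lra.
  rewrite (_ : 4^-1 = 2^-1 ^+ 2 :> R); last by field.
  by rewrite lerXn2r ?nnegrE//; lra.
have pw : (2 `^ (n%:R / 2))^-1 * (r ^+ n)^-1 <= (s + eta) `^ (- (n%:R / 2)).
  rewrite powRN -invfM.
  have -> : r ^+ n = s `^ (n%:R / 2).
    by rewrite -sqrtr_powR ?(ltW s0)// powR_mulrn ?sqrtr_ge0// -rs sqrtr_sqr gtr0_norm.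
  rewrite -powRM ?(ltW s0)// lef_pV2 ?posrE ?powR_gt0 ?addr_gt0 ?mulr_gt0//.
  by apply: ge0_ler_powR; rewrite ?nnegrE ?divr_ge0//; lra.
have lg0 := log_zero_gt0 eta0 (ltW s0).
have lg : log_zero eta s <= k * `|ln r|.
  have h1 : ln (s + (eta + 1)) <= 2.
    have sp : 0 < s + (eta + 1) by rewrite addr_gt0// addr_gt0.
    by have := ln_sublinear sp; lra.
  have h2 : ln s <= ln (s + eta) by rewrite ler_ln ?posrE ?addr_gt0// lerDl ltW.
  have h3 : 3 <= 6 / ln 2 * `|ln r|.
    rewrite -ler_pdivrMl ?divr_gt0// invf_div lnr.
    by rewrite (_ : ln 2 / 6 * 3 = 2^-1 * ln 2); [lra|field].
  have -> : k * `|ln r| = 6 / ln 2 * `|ln r| + 2 * `|ln r| by rewrite /k; ring.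
  by move: h3; rewrite /log_zero lnr; lra.
have lgp : log_zero eta s `^ p <= k `^ p * `|ln r| `^ p.
  by rewrite -powRM ?(ltW k0)//; apply: ge0_ler_powR; rewrite ?nnegrE ?(ltW lg0) ?mulr_ge0 ?(ltW k0) ?(ltW p0).
have rn0 : 0 < r ^+ n by rewrite exprn_gt0.
have T0 : 0 < 2 `^ (n%:R / 2) :> R by rewrite powR_gt0.
have kp0 : 0 < k `^ p by rewrite powR_gt0.
have lp0 : 0 < `|ln r| `^ p by rewrite powR_gt0.
have lgp0 : 0 < log_zero eta s `^ p by rewrite powR_gt0.
apply: (@le_trans _ _ ((r ^+ n * `|ln r| `^ p)^-1)).
  rewrite /hardy_weight lef_pV2 ?posrE ?mulr_gt0 ?addr_gt0 ?powR_gt0//.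
  by rewrite ler_wpM2l ?(ltW rn0)// lerDl powR_ge0.
apply: (@le_trans _ _ (k `^ p * (2 `^ (n%:R / 2) * 4) * (4^-1 *
    ((2 `^ (n%:R / 2))^-1 * (r ^+ n)^-1 * log_zero eta s `^ (- p))))).
  rewrite powRN [leRHS](_ : _ = (r ^+ n)^-1 * (k `^ p / log_zero eta s `^ p)); last first.
    by field; rewrite !gt_eqF.
  rewrite invfM ler_wpM2l ?invr_ge0 ?(ltW rn0)//.
  by rewrite ler_pdivlMr// mulrC ler_pdivrMr.
rewrite ler_wpM2l ?mulr_ge0 ?powR_ge0//.
apply: ler_pM => //; first by rewrite !mulr_ge0 ?invr_ge0 ?powR_ge0// ltW.
by rewrite ler_wpM2r ?powR_ge0.
Qed.

(** Away from the origin |x - c|^2 + eta is at most a multiple of |x|^2, so its power p / 2 is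
    controlled by |x|^n |x|^(p-n); the logarithm remains to be compared. *)
Lemma hardy_weight_le_inf (eta : R) (c : vec) : 0 < eta ->
  exists2 K : R, 0 < K & forall x : vec, 2^-1 <= dist2 0 x ->
  hardy_weight p x <= K * weight_inf n p eta (dist2 c x) `^ p.
Proof.
move=> eta0; pose k2 := 2 + 2 * (2 * dist2 0 c + eta).
have k20 : 0 < k2 by rewrite addr_gt0// mulr_gt0// ltr_wpDl// mulr_ge0// dist2_ge0.
pose k3 := 1 + `|ln k2| + `|ln eta|.
have k30 : 0 < k3 by rewrite !ltr_pwDl.
have p0' : 0 <= p by rewrite ltW.
pose k4 := 2 `^ p * (k3 `^ p + 2 `^ p).
have T1 : 1 <= 2 `^ p :> R by rewrite -[leLHS](powRr0 2) ler_powR// ler1n.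
have k40 : 1 <= k4.
  rewrite -[leLHS]mulr1 ler_pM// (le_trans T1)// lerDr powR_ge0//.
exists (k2 `^ (p / 2) * k4); first by rewrite mulr_gt0 ?powR_gt0// (lt_le_trans _ k40).
move=> x; set s := dist2 0 x => s12.
have s0 : 0 < s by lra.
set r := eucl_norm x; have r0 : 0 < r.
  by rewrite lt_def eucl_norm_ge0 andbT -sqrf_eq0 sqr_eucl_norm gt_eqF.
have rs : r ^+ 2 = s by exact: sqr_eucl_norm.
have d0 : 0 <= dist2 c x by exact: dist2_ge0.
have rn0 : 0 < r ^+ n by rewrite exprn_gt0.
have sg : dist2 c x + eta <= k2 * s.
  have := dist2_le c x; rewrite -/s => h.
  have t0 : 0 <= 2 * dist2 0 c + eta.
    by rewrite addr_ge0 ?(ltW eta0)// mulr_ge0// dist2_ge0.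
  by have := ler_wpM2r t0 s12; rewrite /k2; lra.
have sg0 : 0 < dist2 c x + eta by rewrite ltr_wpDl.
have lg1 : 1 <= log_inf n p eta (dist2 c x) by exact: log_inf_ge1.
have lg0 : 0 < log_inf n p eta (dist2 c x) by rewrite (lt_le_trans _ lg1).
rewrite weight_inf_powR// !powRN -invfM.
have den0 : 0 < r ^+ n * (`|ln r| `^ p + r `^ (p - n%:R)).
  by rewrite mulr_gt0// ltr_wpDl ?powR_ge0// powR_gt0.
rewrite /hardy_weight -/r -[leLHS]mul1r ler_pdivrMr// mulrAC ler_pdivlMr ?mulr_gt0 ?powR_gt0// mul1r.
have sgp : (dist2 c x + eta) `^ (p / 2) <= k2 `^ (p / 2) * (r ^+ n * r `^ (p - n%:R)).
  have -> : r ^+ n * r `^ (p - n%:R) = s `^ (p / 2).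
    rewrite -powR_mulrn ?(ltW r0)// -powRD ?(gt_eqF r0) ?implybT//.
    by rewrite -sqrtr_powR ?(ltW s0)// -rs sqrtr_sqr gtr0_norm//; congr (_ `^ _); ring.
  rewrite -powRM ?(ltW k20) ?(ltW s0)//.
  by apply: ge0_ler_powR; rewrite ?nnegrE ?divr_ge0 ?mulr_ge0 ?(ltW sg0) ?(ltW k20) ?(ltW s0).
(* For p > n [log_inf] is 1 and the power term of the denominator suffices. For p = n that term is 1
   and takes care of the unit sphere, where |ln |x|| vanishes. *)
have lgp : r `^ (p - n%:R) * log_inf n p eta (dist2 c x) `^ p <= k4 * (`|ln r| `^ p + r `^ (p - n%:R)).
  have [pn|pn] := eqVneq p n%:R; last first.
    rewrite /log_inf (negPf pn) mul0r addr0 powR1 mulr1.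
    rewrite (@le_trans _ _ (1 * r `^ (p - n%:R)))//; first by rewrite mul1r.
    by rewrite ler_pM ?powR_ge0// lerDr powR_ge0.
  have -> : p - n%:R = 0 by rewrite pn subrr.
  rewrite powRr0 mul1r.
  have lle : log_inf n p eta (dist2 c x) <= k3 + 2 * `|ln r|.
    rewrite /log_inf pn eqxx mul1r.
    have h1 : ln (dist2 c x + eta) <= ln k2 + 2 * ln r.
      rewrite (_ : 2 * ln r = ln s); last by rewrite -rs lnXn// mulr_natl.
      by rewrite -lnM ?posrE// ler_ln ?posrE ?mulr_gt0.
    have := ler_norm (ln k2); have := ler_norm (ln r); have := ler_norm (- ln eta).
    rewrite normrN /k3; lra.
  apply: (@le_trans _ _ ((k3 + 2 * `|ln r|) `^ p)).
    by apply: ge0_ler_powR; rewrite ?nnegrE ?(ltW lg0) ?addr_ge0 ?mulr_ge0 ?(ltW k30).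
  apply: (le_trans (powR_add_le p0' (ltW k30) _)); first by rewrite mulr_ge0.
  rewrite /k4 -mulrA ler_wpM2l ?powR_ge0// powRM//.
  have := powR_ge0 k3 p; have := powR_ge0 2 p; have := powR_ge0 `|ln r| p.
  move: (k3 `^ p) (2 `^ p) (`|ln r| `^ p) => a b c' a0 b0 c0.
  have := mulr_ge0 a0 c0; have := mulr_ge0 a0 b0; lra.
apply: le_trans (ler_wpM2r (powR_ge0 _ _) sgp) _.
rewrite [leLHS](_ : _ = k2 `^ (p / 2) * r ^+ n *
  (r `^ (p - n%:R) * log_inf n p eta (dist2 c x) `^ p)); last by ring.
rewrite [leRHS](_ : _ = k2 `^ (p / 2) * r ^+ n *
  (k4 * (`|ln r| `^ p + r `^ (p - n%:R)))); last by ring.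
by rewrite ler_wpM2l// mulr_ge0 ?powR_ge0// ltW.
Qed.

End weight_comparison.

(** * Test functions *)

Section test_functions.
Variables (R : realType) (n : nat) (p : R).
Local Notation vec := 'rV[R]_n.
Hypotheses (n2 : (2 <= n)%N) (np : n%:R <= p).

Let p2 : 2 <= p.
Proof. by apply: le_trans np; rewrite ler_nat. Qed.

Let p0 : 0 < p := lt_le_trans (ltr0Sn _ _) p2.

Lemma weight_inf_powR_mono (eta s t : R) : 0 < eta -> 0 <= s -> s <= t ->
  weight_inf n p eta t `^ p <= weight_inf n p eta s `^ p.
Proof.
move=> eta0 s0 st; have t0 : 0 <= t by exact: le_trans st.
rewrite !weight_inf_powR//; apply: ler_pM; rewrite ?powR_ge0//.
  rewrite !powRN lef_pV2 ?posrE ?powR_gt0 ?(shift_gt0 eta0)//.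
  apply: ge0_ler_powR; rewrite ?nnegrE ?(ltW (shift_gt0 eta0 _))//; first by rewrite divr_ge0// ltW.
  by rewrite lerD2r.
rewrite !powRN lef_pV2 ?posrE ?powR_gt0 ?(log_inf_gt0 _ _ eta0)//.
apply: ge0_ler_powR; rewrite ?nnegrE ?(ltW (log_inf_gt0 _ _ eta0 _)) ?(ltW p0)//.
rewrite /log_inf lerD2l ler_wpM2l ?ler0n// lerD2r.
by rewrite ler_ln ?posrE ?(shift_gt0 eta0)// lerD2r.
Qed.

Lemma exists_dist2_ball (be : vec -> R) (x0 : vec) : {for x0, continuous be} ->
  0 < be x0 -> exists2 r, 0 < r & forall x, dist2 x0 x < r -> be x0 / 2 <= be x.
Proof.
move=> cb b0; have b20 : 0 < be x0 / 2 by rewrite divr_gt0.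
have /cvgrPdist_le/(_ _ b20)/nbhs_ballP[e /= e0 xe] := cb.
exists (e ^+ 2); first by rewrite exprn_gt0.
move=> x xr; have : ball x0 e x.
  split => // i j; rewrite (_ : i = ord0); last exact: ord1.
  rewrite /ball/= distrC (le_lt_trans (coord_le_dist2 _ _ _))//.
  by rewrite -[ltRHS]gtr0_norm// -sqrtr_sqr ltr_sqrt// exprn_gt0.
by move=> /xe; rewrite ler_norml; lra.
Qed.

(* Adds up the three differential inequalities; the commutator term is absorbed
   by the field at infinity and controls what that field lacks near x0. *)
Lemma combine_real (c V0 C1 C2 C3 K3 K4 Kt T h1 h2 h3 W W0 X t M D S e A : R) :
  0 < c -> 0 <= V0 -> 0 <= K3 -> 0 <= K4 -> 0 <= M ->
  t <= Kt * W -> 0 < Kt -> e = c / (4 * (V0 + 1) * Kt) -> 0 <= W ->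
  c / 2 * (W * M) <= h2 + V0 * t ^+ 2 * M + C2 * D ->
  t ^+ 2 * M <= h1 + e * (t * M) + C1 * D + C1 * T * t ->
  2 / 3 / 2 * (W0 * M) <= h3 + X * M + C3 * D ->
  X <= K3 * W -> S <= K4 * (W + W0) ->
  A = K4 * (1 + 3 * K3) * (4 / c) ->
  S * M <= (A * (h2 + V0 * h1) + K4 * 3 * h3) +
    ((A * (C2 + V0 * C1) + K4 * 3 * C3) * D + A * V0 * C1 * T * t).
Proof.
move=> c0 V00 K30 K40 M0 tW Kt0 eE W0' H2 H1 H3 XW SW ->.
have e0 : 0 < e by rewrite eE divr_gt0// !mulr_gt0// ltr_wpDl.
(* The commutator error uses up half of the c / 2 supplied by the field at infinity; the remaining c
   / 4 explains the factor 4 / c in [A]. *)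
have eK : V0 * e * Kt <= c / 4.
  rewrite eE (_ : V0 * _ * Kt = c / 4 * (V0 / (V0 + 1))); last first.
    by field; rewrite !gt_eqF// ltr_wpDl.
  by rewrite ler_piMr// ?divr_ge0 ?(ltW c0)// ler_pdivrMr ?ltr_wpDl// mul1r lerDl.
have WM : 0 <= W * M by rewrite mulr_ge0.
have a1 : V0 * (t ^+ 2 * M) <= V0 * (h1 + e * (t * M) + C1 * D + C1 * T * t).
  by rewrite ler_wpM2l.
have a2 : V0 * (e * (t * M)) <= c / 4 * (W * M).
  apply: (@le_trans _ _ (V0 * e * Kt * (W * M))); last by rewrite ler_wpM2r.
  rewrite -!mulrA ler_wpM2l// ler_wpM2l ?(ltW e0)// !mulrA ler_wpM2r//.
have a3 : c / 4 * (W * M) <= (h2 + V0 * h1) + (C2 + V0 * C1) * D + V0 * C1 * T * t.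
  by move: H2 a1 a2; lra.
have a4 : W * M <= 4 / c * ((h2 + V0 * h1) + (C2 + V0 * C1) * D + V0 * C1 * T * t).
  rewrite -ler_pdivrMl ?divr_gt0// invf_div; exact: a3.
(* The factor 3 inverts 2 / 3 / 2. *)
have a5 : W0 * M <= 3 * h3 + 3 * K3 * (W * M) + 3 * C3 * D.
  by have := ler_wpM2r M0 XW; move: H3; lra.
have a6 : S * M <= K4 * (W * M + W0 * M).
  by rewrite -mulrDl mulrA ler_wpM2r.
apply: (le_trans a6).
apply: (@le_trans _ _ (K4 * (W * M + (3 * h3 + 3 * K3 * (W * M) + 3 * C3 * D)))).
  by rewrite ler_wpM2l// lerD2l.
rewrite (_ : W * M + _ = (1 + 3 * K3) * (W * M) + (3 * h3 + 3 * C3 * D)); last by ring.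
have a7 := ler_wpM2l (addr_ge0 ler01 (mulr_ge0 (ler0n R 3) K30)) a4.
by have := ler_wpM2l K40 a7; lra.
Qed.

(** Bounded for each [eta], hence stable under L^p approximation, and increasing to the Hardy weight
    as [eta] decreases to 0. The same [eta] smooths the field at the origin. *)
Definition trunc_weight (eta : R) (x : vec) : R :=
  if eta <= dist2 0 x then hardy_weight p x else 0.

Lemma trunc_weight_le (eta1 : R) (x0 : vec) : 0 < eta1 ->
  exists2 K : R, 0 < K & forall (eta : R) (x : vec), 0 < eta <= 1 ->
  trunc_weight eta x <= K * (weight_inf n p eta1 (dist2 x0 x) `^ p +
                             weight_zero n p eta (dist2 0 x) `^ p).
Proof.
move=> eta10; have [K1 K10 h1] := hardy_weight_le_zero n2 np.
have [K2 K20 h2] := hardy_weight_le_inf n2 np x0 eta10.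
exists (K1 + K2); first exact: addr_gt0.
move=> eta x eta01; set W := weight_inf _ _ _ _ `^ p; set W0 := weight_zero _ _ _ _ `^ p.
have Wp : 0 <= W by exact: powR_ge0.
have W0p : 0 <= W0 by exact: powR_ge0.
have g1 : 0 <= K1 * W by rewrite mulr_ge0// ltW.
have g2 : 0 <= K1 * W0 by rewrite mulr_ge0// ltW.
have g3 : 0 <= K2 * W by rewrite mulr_ge0// ltW.
have g4 : 0 <= K2 * W0 by rewrite mulr_ge0// ltW.
rewrite /trunc_weight; case: ifPn => [ex|_]; last by lra.
have [x12|x12] := ltP (dist2 0 x) 2^-1.
  by have := h1 _ _ eta01 ex x12; rewrite -/W0; lra.
by have := h2 _ x12; rewrite -/W; lra.
Qed.

(** The defect of the field at the origin is bounded and lives in the unit ball. There |x - x0|^2 <=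
    2 + 2 |x0|^2, and the decreasing weight at infinity is at least its value at that number. *)
Lemma dist2_origin_bound (eta1 : R) (x0 : vec) : 0 < eta1 ->
  exists2 K : R, 0 <= K & forall x : vec,
  4 * n%:R * Num.max (1 - dist2 0 x ^+ n) 0 <= K * weight_inf n p eta1 (dist2 x0 x) `^ p.
Proof.
move=> eta10; pose t1 := 2 + 2 * dist2 0 x0.
have t10 : 0 <= t1 by rewrite addr_ge0// mulr_ge0// dist2_ge0.
have W10 : 0 < weight_inf n p eta1 t1 `^ p by rewrite powR_gt0// weight_inf_gt0.
exists (4 * n%:R / weight_inf n p eta1 t1 `^ p).
  by rewrite divr_ge0 ?mulr_ge0// ltW.
move=> x; set s := dist2 0 x; have s0 : 0 <= s by exact: dist2_ge0.
have [s1|s1] := ltP s 1; last first.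
  rewrite max_r ?subr_le0 ?exprn_ege1// mulr0 mulr_ge0 ?powR_ge0//.
  by rewrite divr_ge0 ?mulr_ge0// ltW.
rewrite [leRHS]mulrAC -[leRHS]mulrA ler_wpM2l ?mulr_ge0//.
apply: (@le_trans _ _ 1).
  by rewrite ge_max ler01 andbT lerBlDr lerDl exprn_ge0.
rewrite ler_pdivlMr// mul1r weight_inf_powR_mono ?dist2_ge0//.
by rewrite (le_trans (dist2_le _ _))// /t1 lerD2r -/s; lra.
Qed.

Lemma tent_bound (r eta1 : R) (x0 : vec) : 0 < r -> 0 < eta1 ->
  exists2 K : R, 0 < K & forall x : vec,
  tent r x0 x <= K * weight_inf n p eta1 (dist2 x0 x) `^ p.
Proof.
move=> r0 eta10; have W10 : 0 < weight_inf n p eta1 r `^ p.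
  by rewrite powR_gt0// weight_inf_gt0// ltW.
exists (r / weight_inf n p eta1 r `^ p); first by rewrite divr_gt0.
move=> x; have [rx|rx] := leP r (dist2 x0 x).
  by rewrite /tent max_r ?subr_le0// mulr_ge0 ?powR_ge0// ltW// divr_gt0.
apply: (le_trans (tent_le x0 x (ltW r0))).
rewrite mulrAC ler_pdivlMr// ler_wpM2l ?(ltW r0)//.
by rewrite weight_inf_powR_mono ?dist2_ge0// ltW.
Qed.

End test_functions.

Section test_estimate.
Variables (R : realType) (n : nat) (p : R).
Local Notation vec := 'rV[R]_n.
Local Notation mu := (lebesgue_rV R n).
Hypotheses (n2 : (2 <= n)%N) (np : n%:R <= p).

Let p2 : 2 <= p.
Proof. by apply: le_trans np; rewrite ler_nat. Qed.

Let p0 : 0 < p := lt_le_trans (ltr0Sn _ _) p2.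

Lemma continuous_eucl_norm : continuous (@eucl_norm R n).
Proof.
move=> x; apply: (@continuous_comp _ _ _ (fun x : vec => \sum_j x ord0 j ^+ 2) (@Num.sqrt R)).
  rewrite (_ : (fun x => _) = dist2 0); first exact: continuous_dist2.
  by apply/funext => y; apply: eq_bigr => j _; rewrite mxE subr0.
exact: sqrt_continuous.
Qed.

Lemma measurable_hardy_weight : measurable_fun [set: vec] (@hardy_weight R n p).
Proof.
have mr : measurable_fun [set: vec] (@eucl_norm R n).
  by apply: continuous_measurable_rV; exact: continuous_eucl_norm.
rewrite (_ : hardy_weight p = fun x : vec => (eucl_norm x ^+ n *
   (`|ln (eucl_norm x)| `^ p + eucl_norm x `^ (p - n%:R))) `^ (- 1)); last first.
  apply/funext => x; rewrite powR_inv1// mulr_ge0 ?exprn_ge0 ?eucl_norm_ge0//.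
  by rewrite addr_ge0// powR_ge0.
have mpow q : measurable_fun [set: R] (fun t : R => t `^ q) by exact: measurable_powR.
apply: (measurableT_comp (mpow _)); apply: measurable_funM.
  exact: measurable_funX.
apply: measurable_funD; apply: (measurableT_comp (mpow _)) => //.
by apply: measurableT_comp => //; apply: measurableT_comp => //.
Qed.

Lemma measurable_trunc_weight eta : measurable_fun [set: vec] (@trunc_weight R n p eta).
Proof.
apply: measurable_fun_ifT => //; last exact: measurable_hardy_weight.
apply: measurable_fun_ler => //.
by apply: continuous_measurable_rV; exact: continuous_dist2.
Qed.

Lemma trunc_weight_ge0 eta (x : vec) : 0 <= trunc_weight p eta x.
Proof.
rewrite /trunc_weight; case: ifP => // _; rewrite invr_ge0 mulr_ge0 ?exprn_ge0 ?eucl_norm_ge0//.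
by rewrite addr_ge0// powR_ge0.
Qed.

Variables (A : vec -> vec) (a b : vec -> R).
Hypotheses (A1 : forall k, of_class_C 1 (fun x => A x ord0 k)).
Hypotheses (a2 : of_class_C 2 a) (b2 : of_class_C 2 b).
Hypotheses (sa : bounded_support a) (sb : bounded_support b).

Lemma continuous_norm_powR_comp (u : vec -> R) q : 0 <= q -> continuous u ->
  (forall x, 0 <= u x) -> continuous (fun x => u x `^ q).
Proof.
move=> q0 cu u0; rewrite (_ : (fun x => _) = fun x => `|u x| `^ q); last first.
  by apply/funext => x; rewrite ger0_norm.
move=> x; apply: (@continuous_comp _ _ _ u (fun t : R => `|t| `^ q)); first exact: cu.
exact: continuous_norm_powR.
Qed.

Lemma continuous_cov_norm : continuous (cov_norm A a b).
Proof.
have C1c (f : vec -> R) : of_class_C 1 f -> continuous f by case.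
have cf (f : vec -> R) : of_class_C 2 f -> continuous f by case.
have cd (f : vec -> R) j : of_class_C 2 f -> continuous (partial j f).
  by move=> [_ /(_ j)[_ []]].
have cre j : continuous (cov_re A a b j).
  by move=> x; exact: (cvgB (cd _ j a2 x) (cvgM (C1c _ (A1 j) x) (cf _ b2 x))).
have cim j : continuous (cov_im A a b j).
  by move=> x; exact: (cvgD (cd _ j b2 x) (cvgM (C1c _ (A1 j) x) (cf _ a2 x))).
move=> x; apply: (@continuous_comp _ _ _
  (fun x => \sum_j (cov_re A a b j x ^+ 2 + cov_im A a b j x ^+ 2)) (@Num.sqrt R)).
  apply: (@continuous_big R _ +%R 0 xpredT _ vec); first exact: add_continuous.
  move=> j _ {}x.
  exact: (cvgD (cvgM (cre j x) (cre j x)) (cvgM (cim j x) (cim j x))).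
exact: sqrt_continuous.
Qed.

Lemma bounded_support_cov_norm : bounded_support (fun x => cov_norm A a b x `^ p).
Proof.
have [M aM] := sa; have [N bN] := sb.
have sup j : exists K : R, forall (x : vec) i, K < `|x ord0 i| ->
    partial j a x = 0 /\ partial j b x = 0.
  have [Ma haM] := bounded_support_partial j sa.
  have [Mb hbM] := bounded_support_partial j sb.
  exists (Num.max Ma Mb) => x i; rewrite gt_max => /andP[/haM -> /hbM ->]; by [].
have [K hK] := choice sup.
exists (`|M| + `|N| + \sum_j `|K j|) => x i xi.
have K0 : 0 <= \sum_j `|K j| by rewrite sumr_ge0.
rewrite /cov_norm big1 ?sqrtr0 ?powR0 ?gt_eqF//.
move=> j _; have Mx : M < `|x ord0 i|.
  have := ler_norm M; have := normr_ge0 N; move: xi; lra.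
have Nx : N < `|x ord0 i|.
  have := ler_norm N; have := normr_ge0 M; move: xi; lra.
have Kx : K j < `|x ord0 i|.
  have : `|K j| <= \sum_j `|K j| by rewrite (bigD1 j)//= lerDl sumr_ge0.
  have := ler_norm (K j); have := normr_ge0 M; have := normr_ge0 N; move: xi; lra.
have [da db] := hK j x i Kx.
by rewrite /cov_re /cov_im da db (aM _ _ Mx) (bN _ _ Nx) !mulr0 subr0 addr0 expr0n addr0.
Qed.

End test_estimate.

(** * The truncated inequality for test functions *)

Section hardy_test.
Variables (R : realType) (n : nat) (p : R).
Local Notation vec := 'rV[R]_n.
Local Notation mu := (lebesgue_rV R n).
Hypotheses (n2 : (2 <= n)%N) (np : n%:R <= p).

Let p2 : 2 <= p.
Proof. by apply: le_trans np; rewrite ler_nat. Qed.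

Let p0 : 0 < p := lt_le_trans (ltr0Sn _ _) p2.

(* a and b are the real and imaginary parts of the test function. *)
Definition test_data (A : vec -> vec) (a b : vec -> R) :=
  [/\ forall k, of_class_C 1 (fun x => A x ord0 k),
      of_class_C 2 a, of_class_C 2 b, bounded_support a & bounded_support b].

(** The quantifiers carry the content: all constants depend on [be] only and precede [eta], [A], the
    test function and [k]. The smoothing [eta1] of the field at infinity is fixed, while [eta] stays
    free to tend to 0. *)
Lemma hardy_test_pointwise (be : vec -> R) (x0 : vec) (i j : 'I_n) :
  {for x0, continuous be} -> 0 < be x0 ->
  exists r C C' : R, [/\ 0 <= C, 0 <= C' &
    forall eta A a b, 0 < eta <= 1 -> test_data A a b ->
    (forall x, be x = partial i (fun y => A y ord0 j) x
                    - partial j (fun y => A y ord0 i) x) ->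
    forall k, 0 < k -> exists2 h, exact_density h & forall x,
      trunc_weight p eta x * modulus a b x `^ p <=
      h x + (C * cov_norm A a b x `^ p + C' * k `^ (p / 2) * tent r x0 x)].
Proof.
move=> cb b0; have [r r0 hr] := exists_dist2_ball cb b0.
have b20 : 0 < be x0 / 2 by rewrite divr_gt0.
have [eta1 [c [V0 [eta10 c0 V00 hinf]]]] := exists_field_inf n2 np r0.
have [C2 C20 hC2] := radial_estimate n p2 c0 ler01.
have [C3 C30 hC3] := radial_estimate n (c := 2 / 3) p2
  (divr_gt0 (ltr0Sn _ _) (ltr0Sn _ _)) (ler0n R 2).
have [K3 K30 hK3] := dist2_origin_bound n2 np x0 eta10.
have [K4 K40 hK4] := trunc_weight_le n2 np x0 eta10.
have [Kt Kt0 hKt] := tent_bound n2 np x0 r0 eta10.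
pose e := c / (4 * (V0 + 1) * Kt).
have e0 : 0 < e by rewrite divr_gt0// !mulr_gt0// ltr_wpDl.
have [C1 C10 hC1] := commutator_estimate i j p2 r0 b20 e0 hr.
pose Q := K4 * (1 + 3 * K3) * (4 / c).
have Q0 : 0 <= Q by rewrite !mulr_ge0 ?addr_ge0 ?mulr_ge0 ?invr_ge0// ltW.
exists r, (Q * (C2 + V0 * C1) + K4 * 3 * C3), (Q * V0 * C1); split.
- exact: (addr_ge0 (mulr_ge0 Q0 (addr_ge0 C20 (mulr_ge0 V00 C10)))
    (mulr_ge0 (mulr_ge0 (ltW K40) (ler0n _ 3)) C30)).
- exact: (mulr_ge0 (mulr_ge0 Q0 V00) C10).
move=> eta A a b eta01 [A1 a2 b2 sa sb] hbe k k0; have /andP[eta0 eta1'] := eta01.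
have a1 := of_class_C21 a2; have b1 := of_class_C21 b2.
have [h1 Eh1 hh1] := hC1 A a b A1 a2 b2 sa sb hbe k k0.
have [h2 Eh2 hh2] : exists2 h, exact_density h & forall x,
    c / 2 * (weight_inf n p eta1 (dist2 x0 x) `^ p * modulus a b x `^ p) <=
    h x + V0 * tent r x0 x ^+ 2 * modulus a b x `^ p + C2 * cov_norm A a b x `^ p.
  apply: (hC2 x0 (field_inf n p eta1) (dfield_inf n p eta1) (weight_inf n p eta1)
    (fun s => V0 * Num.max (r - s) 0 ^+ 2)) => // s s0.
  - exact: is_derive_field_inf.
  - exact: continuous_dfield_inf.
  - exact/ltW/weight_inf_gt0.
  - exact: sqrt_field_inf_le.
have [h3 Eh3 hh3] : exists2 h, exact_density h & forall x,
    2 / 3 / 2 * (weight_zero n p eta (dist2 0 x) `^ p * modulus a b x `^ p) <=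
    h x + 4 * n%:R * Num.max (1 - dist2 0 x ^+ n) 0 * modulus a b x `^ p +
    C3 * cov_norm A a b x `^ p.
  apply: (hC3 0 (field_zero n p eta) (dfield_zero n p eta) (weight_zero n p eta)
    (fun s => 4 * n%:R * Num.max (1 - s ^+ n) 0)) => // s s0.
  - exact: is_derive_field_zero.
  - exact: continuous_dfield_zero.
  - exact: weight_zero_ge0.
  - exact: div_field_zero_ge.
  - exact: sqrt_field_zero_le.
exists (fun x => Q * (h2 x + V0 * h1 x) + K4 * 3 * h3 x).
  apply: exact_densityD; apply: exact_densityZ => //.
  by apply: exact_densityD => //; exact: exact_densityZ.
move=> x; apply: (combine_real c0 V00 K30 (ltW K40) (powR_ge0 _ _) (hKt x) Kt0 erefl
  (powR_ge0 _ _) (hh2 x) (hh1 x) (hh3 x) (hK3 x) (hK4 eta x eta01) erefl).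
Qed.

Lemma continuous_modulus_powR (a b : vec -> R) : of_class_C 2 a -> of_class_C 2 b ->
  continuous (fun x => modulus a b x `^ p).
Proof.
move=> [ca _] [cb _]; apply: continuous_norm_powR_comp; first exact: ltW.
  move=> x; apply: (@continuous_comp _ _ _ (fun x => a x ^+ 2 + b x ^+ 2) (@Num.sqrt R)).
    exact: (cvgD (cvgM (ca x) (ca x)) (cvgM (cb x) (cb x))).
  exact: sqrt_continuous.
exact: modulus_ge0.
Qed.

Lemma hardy_test (be : vec -> R) (x0 : vec) (i j : 'I_n) :
  {for x0, continuous be} -> 0 < be x0 ->
  exists2 C : R, 0 < C &
    forall eta A a b, 0 < eta <= 1 -> test_data A a b ->
    (forall x, be x = partial i (fun y => A y ord0 j) x
                    - partial j (fun y => A y ord0 i) x) ->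
    (\int[mu]_x (trunc_weight p eta x * modulus a b x `^ p)%:E <=
     C%:E * \int[mu]_x (cov_norm A a b x `^ p)%:E)%E.
Proof.
move=> cb b0; have [r [C [C' [C0 C'0 hC]]]] := hardy_test_pointwise i j cb b0.
exists (C + 1); first by rewrite ltr_wpDl.
move=> eta A a b eta01 td hbe; have [A1 a2 b2 sa sb] := td.
have cD : continuous (fun x => cov_norm A a b x `^ p).
  apply: continuous_norm_powR_comp; rewrite ?(ltW p0)//.
  exact: continuous_cov_norm.
  exact: cov_norm_ge0.
have sD : bounded_support (fun x => cov_norm A a b x `^ p).
  exact: bounded_support_cov_norm.
have ct : continuous (tent r x0) by exact: continuous_tent.
have st : bounded_support (tent r x0) by exact: bounded_support_tent.
have iD := integrable_bounded_support cD sD.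
have it := integrable_bounded_support ct st.
have [D DE] : exists D, (\int[mu]_x (cov_norm A a b x `^ p)%:E = D%:E)%E.
  by exists (fine (\int[mu]_x (cov_norm A a b x `^ p)%:E)%E); rewrite fineK// integrable_fin_num.
have [T TE] : exists T, (\int[mu]_x (tent r x0 x)%:E = T%:E)%E.
  by exists (fine (\int[mu]_x (tent r x0 x)%:E)%E); rewrite fineK// integrable_fin_num.
have D0 : 0 <= D by rewrite -lee_fin -DE integral_ge0// => x _; rewrite lee_fin powR_ge0.
have T0 : 0 <= T by rewrite -lee_fin -TE integral_ge0// => x _; rewrite lee_fin tent_ge0.
rewrite DE -EFinM; apply: (@le_trans _ _ (C * D)%:E); last first.
  by rewrite lee_fin ler_wpM2r// lerDl.
apply/lee_addgt0Pr => e e0; rewrite -EFinD.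
have CT : 0 < C' * T + 1 by rewrite ltr_wpDl// mulr_ge0.
(* Solves k^(p/2) = e / (C' T + 1), so that the regularization error C' k^(p/2) T stays below
   [e]. *)
pose k := (e / (C' * T + 1)) `^ (2 / p).
have k0 : 0 < k by rewrite powR_gt0// divr_gt0.
have kE : k `^ (p / 2) = e / (C' * T + 1).
  rewrite -powRrM (_ : 2 / p * (p / 2) = 1); last by field; rewrite gt_eqF.
  by rewrite powRr1// ltW// divr_gt0.
have [h Eh hh] := hC eta A a b eta01 td hbe k k0.
have mf : measurable_fun setT (fun x => trunc_weight p eta x * modulus a b x `^ p).
  apply: measurable_funM; first exact: measurable_trunc_weight.
  by apply: continuous_measurable_rV; exact: continuous_modulus_powR.
apply: (le_trans (le_integral_exact mf _ _ _ Eh hh)).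
- by move=> x; rewrite mulr_ge0 ?trunc_weight_ge0 ?powR_ge0.
- move=> x; exact: (cvgD (cvgM (cvg_cst _) (cD x)) (cvgM (cvg_cst _) (ct x))).
- by apply: bounded_supportD; apply: bounded_supportMr.
under eq_integral do rewrite EFinD !(EFinM (_ * _)) EFinM.
rewrite integralD//; last 2 first.
- exact: integrableZl.
- exact: integrableZl.
rewrite !integralZl// DE TE -!EFinM -EFinD lee_fin lerD2l kE.
rewrite [leLHS](_ : _ = e * (C' * T / (C' * T + 1))); last by ring.
by rewrite ler_piMr ?(ltW e0)// ler_pdivrMr// mul1r lerDl.
Qed.


End hardy_test.

(** * Density *)

Section complex_norms.
Variables (R : realType) (n : nat).
Local Notation vec := 'rV[R]_n.
Local Open Scope complex_scope.
Notation Re := complex.Re.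
Notation Im := complex.Im.

Lemma cnormE (z : R[i]) : cnorm z = Num.sqrt (Re z ^+ 2 + Im z ^+ 2).
Proof. by case: z. Qed.

Lemma cnorm_ge0 (z : R[i]) : 0 <= cnorm z.
Proof. by rewrite cnormE sqrtr_ge0. Qed.

Lemma sqr_cnorm (z : R[i]) : cnorm z ^+ 2 = Re z ^+ 2 + Im z ^+ 2.
Proof. by rewrite cnormE sqr_sqrtr// addr_ge0// sqr_ge0. Qed.

(** A triangle inequality up to a factor is enough, since the final constant is not tracked; the
    parallelogram identity gives it coordinate by coordinate. *)
Lemma sqr_cnormD_le (z w : R[i]) :
  cnorm (z + w) ^+ 2 <= 2 * (cnorm z ^+ 2 + cnorm w ^+ 2).
Proof.
rewrite !sqr_cnorm; case: z w => a b [c d] /=.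
have := sqr_ge0 (a - c); have := sqr_ge0 (b - d); lra.
Qed.

Lemma le_sqr_sum (x y z : R) : 0 <= x -> 0 <= y -> 0 <= z ->
  x ^+ 2 <= 2 * (y ^+ 2 + z ^+ 2) -> x <= 2 * (y + z).
Proof.
move=> x0 y0 z0 h; rewrite -(ler_pXn2r (n := 2)) ?nnegrE ?mulr_ge0 ?addr_ge0//.
by have := mulr_ge0 y0 z0; have := sqr_ge0 y; have := sqr_ge0 z; lra.
Qed.

Lemma cnormD_le (z w : R[i]) : cnorm (z + w) <= 2 * (cnorm z + cnorm w).
Proof. by apply: le_sqr_sum; rewrite ?cnorm_ge0 ?sqr_cnormD_le. Qed.

Lemma ceucl_norm_ge0 (v : 'rV[R[i]]_n) : 0 <= ceucl_norm v.
Proof. exact: sqrtr_ge0. Qed.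

Lemma ceucl_normD_le (v w : 'rV[R[i]]_n) :
  ceucl_norm (v + w) <= 2 * (ceucl_norm v + ceucl_norm w).
Proof.
apply: le_sqr_sum; rewrite ?ceucl_norm_ge0// !sqr_sqrtr;
  do ?by apply: sumr_ge0 => j _; exact: sqr_ge0.
rewrite -big_split mulr_sumr/=; apply: ler_sum => j _.
by rewrite mxE sqr_cnormD_le.
Qed.

Lemma powR_sum_le (p x y z : R) : 0 <= p -> 0 <= x -> 0 <= y -> 0 <= z ->
  x <= 2 * (y + z) -> x `^ p <= 2 `^ p * 2 `^ p * (y `^ p + z `^ p).
Proof.
move=> p0 x0 y0 z0 xyz; apply: (@le_trans _ _ ((2 * (y + z)) `^ p)).
  by apply: ge0_ler_powR; rewrite ?nnegrE ?mulr_ge0 ?addr_ge0.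
rewrite powRM ?addr_ge0// -mulrA ler_wpM2l ?powR_ge0//.
exact: powR_add_le.
Qed.

Lemma measurable_sqrt_sum2 d (T : measurableType d) (f g : T -> R) :
  measurable_fun setT f -> measurable_fun setT g ->
  measurable_fun setT (fun x => Num.sqrt (f x ^+ 2 + g x ^+ 2)).
Proof.
move=> mf mg; apply: measurableT_comp; first exact: continuous_measurable_fun (@sqrt_continuous R).
by apply: measurable_funD; exact: measurable_funX.
Qed.

Lemma measurable_cnorm d (T : measurableType d) (f : T -> R[i]) :
  measurable_fun setT (fun x => Re (f x)) -> measurable_fun setT (fun x => Im (f x)) ->
  measurable_fun setT (fun x => cnorm (f x)).
Proof.
move=> mr mi; under eq_fun do rewrite cnormE; exact: measurable_sqrt_sum2.
Qed.

Lemma measurable_ceucl_norm d (T : measurableType d) (f : T -> 'rV[R[i]]_n) :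
  (forall j, measurable_fun setT (fun x => Re (f x ord0 j))) ->
  (forall j, measurable_fun setT (fun x => Im (f x ord0 j))) ->
  measurable_fun setT (fun x => ceucl_norm (f x)).
Proof.
move=> mr mi; apply: measurableT_comp.
  exact: continuous_measurable_fun (@sqrt_continuous R).
apply: measurable_sum => j; apply: measurable_funX; exact: measurable_cnorm.
Qed.

Lemma magnetic_gradientE (A : vec -> vec) (u : vec -> R[i]) g x j :
  (Re (magnetic_gradient A u g x ord0 j) = Re (g x ord0 j) - A x ord0 j * Im (u x)) *
  (Im (magnetic_gradient A u g x ord0 j) = Im (g x ord0 j) + A x ord0 j * Re (u x)).
Proof.
rewrite /magnetic_gradient !mxE; case: (g x ord0 j) (u x) => g1 g2 [u1 u2] /=.
by split; ring.
Qed.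

Lemma ceucl_norm_gradient (A : vec -> vec) (phi : vec -> R[i]) x :
  ceucl_norm (magnetic_gradient A phi (gradient phi) x) =
  cov_norm A (fun y => Re (phi y)) (fun y => Im (phi y)) x.
Proof.
rewrite /ceucl_norm /cov_norm; congr Num.sqrt; apply: eq_bigr => j _.
by rewrite sqr_cnorm !magnetic_gradientE /gradient !mxE.
Qed.

Lemma magnetic_gradientB (A : vec -> vec) (u v : vec -> R[i]) g h x :
  magnetic_gradient A u g x =
  magnetic_gradient A (u \- v) (g \- h) x + magnetic_gradient A v h x.
Proof.
apply/rowP => j; rewrite /magnetic_gradient !mxE /=; ring.
Qed.

Lemma magnetic_gradientN (A : vec -> vec) (u v : vec -> R[i]) g h x :
  ceucl_norm (magnetic_gradient A (v \- u) (h \- g) x) =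
  ceucl_norm (magnetic_gradient A (u \- v) (g \- h) x).
Proof.
rewrite /ceucl_norm; congr Num.sqrt; apply: eq_bigr => j _.
rewrite !sqr_cnorm /magnetic_gradient !mxE /=.
case: (g x ord0 j) (h x ord0 j) (u x) (v x) => g1 g2 [h1 h2] [u1 u2] [v1 v2] /=.
ring.
Qed.

End complex_norms.

(** * From test functions to the form domain *)

Section density.
Variables (R : realType) (n : nat) (p : R).
Local Notation vec := 'rV[R]_n.
Local Notation mu := (lebesgue_rV R n).
Local Notation Re := complex.Re.
Local Notation Im := complex.Im.
Hypotheses (n2 : (2 <= n)%N) (np : n%:R <= p).

Let p2 : 2 <= p.
Proof. by apply: le_trans np; rewrite ler_nat. Qed.

Let p0 : 0 < p := lt_le_trans (ltr0Sn _ _) p2.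

Lemma compact_bounded_support (V : nmodType) (f : vec -> V) (h : vec -> R) :
  compactly_supported f -> (forall x, f x = 0 -> h x = 0) -> bounded_support h.
Proof.
move=> cf fh; have [M [_ hM]] := compact_bounded cf.
exists (`|M| + 1) => x i xi; apply/fh/eqP/negPn/negP => fx.
have /hM : M < `|M| + 1 by rewrite (le_lt_trans (ler_norm M))// ltrDl.
move=> /(_ x (@subset_closure _ [set y | f y != 0] x fx)) /= xM.
have : `|x ord0 i| <= `|x|.
  rewrite {2}/Num.norm/= mx_normrE; exact: (le_bigmax _ (fun ij => `|x ij.1 ij.2|) (ord0, i)).
by move=> /le_trans/(_ xM); rewrite leNgt xi.
Qed.

Lemma ctest_data (A : vec -> vec) (phi : vec -> R[i]) :
  (forall j, smooth (fun x => A x ord0 j)) -> ctest phi ->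
  test_data A (fun x => Re (phi x)) (fun x => Im (phi x)).
Proof.
move=> sA [sr si cs]; split.
- by move=> k; exact: (sA k 1%N).
- exact: (sr 2%N).
- exact: (si 2%N).
- by apply: (compact_bounded_support cs) => x ->.
- by apply: (compact_bounded_support cs) => x ->.
Qed.

Lemma form_norm_lt (A : vec -> vec) (u : vec -> R[i]) g (e : R) : 0 < e ->
  (form_norm A p u g < e%:E)%E ->
  (magnetic_form A p u g <= (e `^ p)%:E)%E /\
  (\int[mu]_x (cnorm (u x) `^ p)%:E <= (e `^ p)%:E)%E.
Proof.
move=> e0; rewrite /form_norm.
have : (0 <= magnetic_form A p u g)%E.
  by apply: integral_ge0 => x _; rewrite lee_fin powR_ge0.
have : (0 <= \int[mu]_x (cnorm (u x) `^ p)%:E)%E.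
  by apply: integral_ge0 => x _; rewrite lee_fin powR_ge0.
move: (magnetic_form _ _ _ _) (integral _ _ _) => X Y Y0 X0 XYe.
have XY : (X + Y <= (e `^ p)%:E)%E.
  rewrite leNgt; apply/negP => eXY; move: XYe; apply/negP; rewrite -leNgt.
  rewrite (_ : e%:E = ((e `^ p)%:E `^ p^-1)%E); last first.
    by rewrite poweR_EFin -powRrM mulfV ?gt_eqF// powRr1// ltW.
  apply: gt0_ler_poweR; rewrite ?in_itv/= ?andbT ?leey ?adde_ge0 ?lee_fin ?powR_ge0//.
  - by rewrite invr_ge0 ltW.
  exact: ltW.
by split; apply: le_trans XY; [rewrite leeDl|rewrite leeDr].
Qed.

Lemma trunc_weight_bounded (eta : R) : 0 < eta <= 1 ->
  exists2 M : R, 0 <= M & forall x : vec, trunc_weight p eta x <= M.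
Proof.
move=> eta01; have /andP[eta0 eta1] := eta01.
have [K K0 hK] := trunc_weight_le n2 np 0 (ltr01 : 0 < 1 :> R).
exists (K * (1 `^ (- (p / 2)) + eta `^ (- (n%:R / 2)))).
  by rewrite mulr_ge0 ?addr_ge0 ?powR_ge0// ltW.
move=> x; apply: (le_trans (hK eta x eta01)); rewrite ler_wpM2l ?(ltW K0)//.
apply: lerD; first exact: (weight_inf_powR_le n2 np ltr01 (dist2_ge0 _ _)).
by apply: weight_zero_powR_le => //; exact: dist2_ge0.
Qed.


Lemma le_integral_lin (f g h : vec -> R) (c d : R) :
  0 <= c -> 0 <= d -> measurable_fun setT f -> measurable_fun setT g -> measurable_fun setT h ->
  (forall x, 0 <= f x) -> (forall x, 0 <= g x) -> (forall x, 0 <= h x) ->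
  (forall x, f x <= c * g x + d * h x) ->
  (\int[mu]_x (f x)%:E <= c%:E * \int[mu]_x (g x)%:E + d%:E * \int[mu]_x (h x)%:E)%E.
Proof.
move=> c0 d0 mf mg mh f0 g0 h0 fgh.
have mg' : measurable_fun setT (EFin \o g) by exact/measurable_EFinP.
have mh' : measurable_fun setT (EFin \o h) by exact/measurable_EFinP.
rewrite -!ge0_integralZl_EFin// -?ge0_integralD//.
- apply: ge0_le_integral => //=.
  + by move=> x _; rewrite lee_fin.
  + exact/measurable_EFinP.
  + by apply: emeasurable_funD; exact: measurable_funeM.
  + by move=> x _; rewrite -!EFinM -EFinD lee_fin.
- by move=> x _; rewrite -EFinM lee_fin mulr_ge0.
- exact: measurable_funeM.
- by move=> x _; rewrite -EFinM lee_fin mulr_ge0.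
- exact: measurable_funeM.
- by move=> x _; rewrite lee_fin.
- by move=> x _; rewrite lee_fin.
Qed.

Lemma weak_gradient_measurable (u : vec -> R[i]) g : weak_gradient u g ->
  [/\ measurable_fun setT (fun x => Re (u x)),
      measurable_fun setT (fun x => Im (u x)),
      (forall j, measurable_fun setT (fun x => Re (g x ord0 j))) &
      (forall j, measurable_fun setT (fun x => Im (g x ord0 j)))].
Proof.
move=> wg; have [[[mr _] _ _] [[mi _] _ _]] := wg (Ordinal (ltn_trans (ltnSn 0) n2)).
by split=> // j; have [[_ [mgr _] _] [_ [mgi _] _]] := wg j.
Qed.

(** Comparing [u] with a test function costs [T] twice: once from |u|^p to |phi|^p, where the bound
    [M] on the truncated weight controls the remainder, and once from the form of phi back to that
    of [u]. *)
Lemma trunc_hardy (C eta : R) (A : vec -> vec) (u : vec -> R[i]) g :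
  0 < C -> 0 < eta <= 1 -> (forall j, smooth (fun x => A x ord0 j)) ->
  (forall a b, test_data A a b ->
    (\int[mu]_x (trunc_weight p eta x * modulus a b x `^ p)%:E <=
     C%:E * \int[mu]_x (cov_norm A a b x `^ p)%:E)%E) ->
  form_domain A p u g ->
  (\int[mu]_x (trunc_weight p eta x * cnorm (u x) `^ p)%:E <=
   (2 `^ p * 2 `^ p * (2 `^ p * 2 `^ p) * C)%:E * magnetic_form A p u g)%E.
Proof.
move=> C0 eta01 sA hC [wg dense]; set T := 2 `^ p * 2 `^ p.
have T0 : 0 < T by rewrite mulr_gt0 ?powR_gt0.
have [M M0 hM] := trunc_weight_bounded eta01.
have F0 : (0 <= magnetic_form A p u g)%E.
  by apply: integral_ge0 => x _; rewrite lee_fin powR_ge0.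
have [mur mui mgr mgi] := weak_gradient_measurable wg.
case FE : (magnetic_form A p u g) F0 => [F| |] // F0; last first.
  by rewrite gt0_muley ?leey// lte_fin !mulr_gt0.
(* The total coefficient of e^p in the final error; e^p = del / (K + 1) keeps that error below
   [del]. *)
pose K := T * M + T * C * T.
have K0 : 0 <= K by rewrite addr_ge0// !mulr_ge0// ltW.
apply/lee_addgt0Pr => del del0.
pose e := (del / (K + 1)) `^ p^-1.
have de0 : 0 < del / (K + 1) by rewrite divr_gt0// ltr_wpDl.
have e0 : 0 < e by rewrite powR_gt0.
have eE : e `^ p = del / (K + 1) by rewrite -powRrM mulVf ?gt_eqF// powRr1// ltW.
have [phi cphi /(form_norm_lt e0) [hF hL]] := dense e e0.
have td := ctest_data sA cphi; have [A1 a2 b2 _ _] := td.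
have mA j : measurable_fun setT (fun x => A x ord0 j).
  by apply: continuous_measurable_rV; case: (A1 j).
have mpr : measurable_fun setT (fun x => Re (phi x)).
  by apply: continuous_measurable_rV; case: a2.
have mpi : measurable_fun setT (fun x => Im (phi x)).
  by apply: continuous_measurable_rV; case: b2.
have mpow (f : vec -> R) : measurable_fun setT f -> measurable_fun setT (fun x => f x `^ p).
  by move=> mf; exact: (measurableT_comp (@measurable_powR R p) mf).
have step1 : (\int[mu]_x (trunc_weight p eta x * cnorm (u x) `^ p)%:E <=
    (T * M)%:E * \int[mu]_x (cnorm ((u \- phi) x) `^ p)%:E +
    T%:E * \int[mu]_x (trunc_weight p eta x *
      modulus (fun y => Re (phi y)) (fun y => Im (phi y)) x `^ p)%:E)%E.
  apply: le_integral_lin.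
  - by rewrite mulr_ge0// ltW.
  - exact: ltW.
  - apply: measurable_funM; first exact: measurable_trunc_weight.
    by apply: mpow; exact: measurable_cnorm.
  - apply: mpow; apply: measurable_cnorm.
    + rewrite (_ : (fun x => _) = fun x => Re (u x) - Re (phi x)).
        exact: measurable_funB.
      by apply/funext => x /=; case: (u x) (phi x) => ? ? [].
    + rewrite (_ : (fun x => _) = fun x => Im (u x) - Im (phi x)).
        exact: measurable_funB.
      by apply/funext => x /=; case: (u x) (phi x) => ? ? [].
  - apply: measurable_funM; first exact: measurable_trunc_weight.
    by apply: continuous_measurable_rV; exact: continuous_modulus_powR.
  - by move=> x; rewrite mulr_ge0 ?trunc_weight_ge0 ?powR_ge0.
  - by move=> x; exact: powR_ge0.
  - by move=> x; rewrite mulr_ge0 ?trunc_weight_ge0 ?powR_ge0.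
  - move=> x; have -> : modulus (fun y => Re (phi y)) (fun y => Im (phi y)) x =
        cnorm (phi x) by rewrite cnormE.
    have w0 := trunc_weight_ge0 p eta x.
    have uB : cnorm (u x) <= 2 * (cnorm ((u \- phi) x) + cnorm (phi x)).
      by rewrite -{1}(subrK (phi x) (u x)); exact: cnormD_le.
    have := powR_sum_le (ltW p0) (cnorm_ge0 _) (cnorm_ge0 _) (cnorm_ge0 _) uB.
    rewrite -/T => /(ler_wpM2l w0)/le_trans; apply.
    rewrite mulrCA mulrDr mulrDr lerD//.
    by rewrite -mulrA ler_wpM2l ?(ltW T0)// ler_wpM2r ?powR_ge0.
have mphi j : measurable_fun setT (fun x => Re (gradient phi x ord0 j)) /\
    measurable_fun setT (fun x => Im (gradient phi x ord0 j)).
  rewrite /gradient; split; under eq_fun do rewrite mxE /=;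
    apply: continuous_measurable_rV.
  - by case: a2 => _ /(_ j)[_ []].
  - by case: b2 => _ /(_ j)[_ []].
have mD (v : vec -> R[i]) (h : vec -> 'rV[R[i]]_n) :
    measurable_fun setT (fun x => Re (v x)) -> measurable_fun setT (fun x => Im (v x)) ->
    (forall j, measurable_fun setT (fun x => Re (h x ord0 j))) ->
    (forall j, measurable_fun setT (fun x => Im (h x ord0 j))) ->
    measurable_fun setT (fun x => ceucl_norm (magnetic_gradient A v h x) `^ p).
  move=> m1 m2 m3 m4; apply: mpow; apply: measurable_ceucl_norm => j.
    under eq_fun do rewrite magnetic_gradientE.
    by apply: measurable_funB => //; exact: measurable_funM.
  under eq_fun do rewrite magnetic_gradientE.
  by apply: measurable_funD => //; exact: measurable_funM.
have step2 : (\int[mu]_x (cov_norm A (fun y => Re (phi y)) (fun y => Im (phi y)) x `^ p)%:E <=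
    T%:E * magnetic_form A p (u \- phi)%R (g \- gradient phi)%R +
    T%:E * magnetic_form A p u g)%E.
  apply: le_integral_lin.
  - exact: ltW.
  - exact: ltW.
  - under eq_fun do rewrite -ceucl_norm_gradient.
    by apply: mD; [exact: mpr|exact: mpi| |] => j; have [] := mphi j.
  - apply: mD => [||j|j].
    + rewrite (_ : (fun x => _) = fun x => Re (u x) - Re (phi x)).
        exact: measurable_funB.
      by apply/funext => x /=; case: (u x) (phi x) => ? ? [].
    + rewrite (_ : (fun x => _) = fun x => Im (u x) - Im (phi x)).
        exact: measurable_funB.
      by apply/funext => x /=; case: (u x) (phi x) => ? ? [].
    + rewrite (_ : (fun x => _) = fun x => Re (g x ord0 j) - Re (gradient phi x ord0 j)).
        by apply: measurable_funB => //; have [] := mphi j.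
      by apply/funext => x /=; rewrite !mxE/=; case: (g x ord0 j).
    + rewrite (_ : (fun x => _) = fun x => Im (g x ord0 j) - Im (gradient phi x ord0 j)).
        by apply: measurable_funB => //; have [] := mphi j.
      by apply/funext => x /=; rewrite !mxE/=; case: (g x ord0 j).
  - exact: mD.
  - by move=> x; exact: powR_ge0.
  - by move=> x; exact: powR_ge0.
  - by move=> x; exact: powR_ge0.
  - move=> x; rewrite -mulrDr; apply: powR_sum_le;
      rewrite ?ceucl_norm_ge0 ?cov_norm_ge0 ?(ltW p0)//.
    rewrite -ceucl_norm_gradient (magnetic_gradientB A phi u _ g).
    by rewrite -(magnetic_gradientN A u phi g); exact: ceucl_normD_le.
have := hC _ _ td; move: step1 step2; rewrite FE.
move: (\int[mu]_x (trunc_weight p eta x * modulus _ _ x `^ p)%:E)%E => X.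
move: (\int[mu]_x (cov_norm A _ _ x `^ p)%:E)%E => Y step1 step2 XY.
apply: (le_trans step1).
have Y1 : (Y <= (T * (e `^ p) + T * F)%:E)%E.
  apply: (le_trans step2); rewrite EFinD !EFinM leeD2r//.
  by apply: lee_wpmul2l => //; rewrite lee_fin ltW.
have X1 : (X <= (C * (T * (e `^ p) + T * F))%:E)%E.
  apply: (le_trans XY); rewrite EFinM; apply: lee_wpmul2l => //.
  by rewrite lee_fin ltW.
apply: (@le_trans _ _ ((T * M * (e `^ p) + T * (C * (T * (e `^ p) + T * F)))%:E)).
  rewrite EFinD (EFinM (T * M)) (EFinM T (C * _)); apply: leeD; apply: lee_wpmul2l => //.
  - by rewrite lee_fin mulr_ge0// ltW.
  - by rewrite lee_fin ltW.
rewrite -EFinM -EFinD lee_fin.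
rewrite [leLHS](_ : _ = T * T * C * F + T * M * e `^ p + T * C * T * e `^ p); last by ring.
rewrite -addrA lerD2l -mulrDl -/K eE mulrCA ler_piMr ?(ltW del0)//.
by rewrite ler_pdivrMr ?ltr_wpDl// mul1r lerDl.
Qed.

Lemma hardy_of_trunc (u : vec -> R[i]) (F : \bar R) :
  measurable_fun setT (fun x => Re (u x)) -> measurable_fun setT (fun x => Im (u x)) ->
  (forall eta : R, 0 < eta <= 1 ->
    (\int[mu]_x (trunc_weight p eta x * cnorm (u x) `^ p)%:E <= F)%E) ->
  (\int[mu]_x (hardy_weight p x * cnorm (u x) `^ p)%:E <= F)%E.
Proof.
move=> mr mi hF; pose f k x := (trunc_weight p k.+1%:R^-1 x * cnorm (u x) `^ p)%:E.
have f0 k x : (0 <= f k x)%E.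
  by rewrite lee_fin mulr_ge0 ?trunc_weight_ge0 ?powR_ge0.
have mf k : measurable_fun setT (f k).
  apply/measurable_EFinP; apply: measurable_funM; first exact: measurable_trunc_weight.
  exact: (measurableT_comp (@measurable_powR R p) (measurable_cnorm mr mi)).
have inv01 (k : nat) : 0 < (k.+1%:R^-1 : R) <= 1.
  apply/andP; split; first by rewrite invr_gt0.
  by rewrite invf_le1// ler1n.
have limf x : (f k x @[k --> \oo] --> (hardy_weight p x * cnorm (u x) `^ p)%:E)%E.
  (* At the origin the convention 0^-1 = 0 makes the Hardy weight 0, in agreement with every
     truncation. Elsewhere the sequence is eventually constant. *)
  have [x0|x0] := eqVneq (dist2 0 x) 0.
    have -> : hardy_weight p x = 0.
      have r0 : eucl_norm x = 0 by apply/eqP; rewrite -sqrf_eq0 sqr_eucl_norm x0.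
      by rewrite /hardy_weight r0 expr0n gtn_eqF ?mul0r ?invr0// (ltn_trans _ n2).
    apply: cvg_near_cst; apply: nearW => k; rewrite /f /trunc_weight x0.
    by have /andP[h _] := inv01 k; rewrite leNgt h.
  have xp : 0 < dist2 0 x by rewrite lt_def x0 dist2_ge0.
  apply: cvg_near_cst; near=> k; rewrite /f /trunc_weight ifT//.
  rewrite ltW// invf_plt ?posrE ?ltr0Sn//.
  rewrite (lt_le_trans (truncnS_gt _))// ler_nat ltnS.
  by near: k; exact: nbhs_infty_ge.
have ndf x : nondecreasing_seq (f ^~ x).
  move=> k l kl; rewrite lee_fin ler_wpM2r ?powR_ge0// /trunc_weight.
  case: ifPn => [kx|_]; last first.
    by case: ifP => // lx; have := trunc_weight_ge0 p (l.+1%:R^-1) x; rewrite /trunc_weight lx.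
  rewrite ifT// (le_trans _ kx)// lef_pV2 ?posrE ?ltr0Sn//.
  by rewrite ler_nat ltnS.
have -> : (\int[mu]_x (hardy_weight p x * cnorm (u x) `^ p)%:E =
    \int[mu]_x limn (f ^~ x))%E.
  by apply: eq_integral => x _; apply/esym/cvg_lim => //; exact: limf.
rewrite monotone_convergence//; apply: lime_le.
  apply: ereal_nondecreasing_is_cvgn => k l kl.
  by apply: ge0_le_integral => // x _; exact: ndf.
by apply: nearW => k; exact: hF.
Unshelve. all: by end_near. Qed.

End density.

Theorem theorem1p1 (R : realType) (d : nat) (p : R)
    (B : 'rV[R]_d -> 'M[R]_d) :
  (2 <= d)%N -> d%:R <= p ->
  magnetic_field B -> closed_form2 B -> (exists x, B x != 0) ->
  exists C : R, 0 < C /\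
    forall A : 'rV[R]_d -> 'rV[R]_d, magnetic_potential B A ->
    forall (u : 'rV[R]_d -> R[i]) (g : 'rV[R]_d -> 'rV[R[i]]_d),
      form_domain A p u g ->
      (C%:E * \int[lebesgue_rV R d]_x
                (hardy_weight p x * cnorm (u x) `^ p)%:E
       <= magnetic_form A p u g)%E.
Proof.
move=> d2 dp [sB skB] _ [x0 Bx0].
have [i [j Bij]] : exists i j, 0 < B x0 i j.
  have [i [j Bij]] : exists i j, B x0 i j != 0.
    apply: contrapT => B0; move/eqP: Bx0; apply; apply/matrixP => i j.
    by rewrite mxE; apply: contrapT => /eqP Bij; apply: B0; exists i, j.
  (* The commutator estimate needs a positive lower bound on the component; if it is negative,
     skew-symmetry makes the transposed entry positive. *)
  have [?|Bn] := ltP 0 (B x0 i j); first by exists i, j.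
  exists j, i; have /matrixP/(_ i j) := skB x0; rewrite !mxE => ->.
  by rewrite oppr_gt0 lt_def eq_sym Bij.
have cB : {for x0, continuous (fun x => B x i j)} by exact: (sB i j 0%N).
have [C C0 hC] := hardy_test d2 dp i j cB Bij.
set T : R := 2 `^ p * 2 `^ p * (2 `^ p * 2 `^ p) * C.
have T0 : 0 < T by rewrite !mulr_gt0 ?powR_gt0.
exists T^-1; split; first by rewrite invr_gt0.
move=> A [sA BA] u g dom; have [mr mi _ _] := weak_gradient_measurable d2 dom.1.
have h : (\int[lebesgue_rV R d]_x (hardy_weight p x * cnorm (u x) `^ p)%:E <=
    T%:E * magnetic_form A p u g)%E.
  apply: hardy_of_trunc => // eta eta01.
  apply: trunc_hardy => // a b td; apply: hC => // x; exact: BA.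
rewrite -[leRHS]mul1e (_ : 1%E = (T^-1)%:E * T%:E)%E; last first.
  by rewrite -EFinM mulVf// gt_eqF.
by rewrite -muleA; apply: lee_wpmul2l; rewrite // lee_fin invr_ge0 ltW.
Qed.
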